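(* Let $G$ be a $d$-regular graph of order $n$, where $n$ is large enough and $d\ge(\log n)^{130}$. Then there is a collection of at most $\frac{n}{d+1}$ pairwise vertex-disjoint cycles in $G$ covering all but at most $O\left(\frac{n}{(\log\log n)^{1/30}}\right)$ vertices of $G$.
   Context: All graphs are finite and simple, and logarithms are base $2$. The implicit constant in $O(\cdot)$ and the threshold for ''$n$ large enough'' are absolute. *)

(* Defs.v *)
From HB Require Import structures.
From mathcomp Require Import all_boot all_order all_algebra.
From mathcomp Require Import reals exp.

Set Implicit Arguments.
Unset Strict Implicit.
Unset Printing Implicit Defensive.

Import Order.TTheory GRing.Theory Num.Theory.

Definition simple_graph (T : finType) (e : rel T) : Prop :=
  symmetric e /\ irreflexive e.

Definition neighbours (T : finType) (e : rel T) (x : T) : {set T} :=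
  [set y | e x y].

Definition regular (T : finType) (e : rel T) (d : nat) : Prop :=
  forall x : T, #|neighbours e x| = d.

(* A cycle is given by the cyclic list of its vertices. The length bound
   matters: [ucycle] also accepts the empty list and, for a symmetric [e],
   the two ends of an edge. *)
Definition graph_cycle (T : finType) (e : rel T) (c : seq T) : Prop :=
  (3 <= size c)%N /\ ucycle e c.

(* Graph cycles are nonempty, so a disjoint family has no repetitions and the
   size of the list is the number of cycles. *)
Definition disjoint_cycles (T : finType) (e : rel T) (cs : seq (seq T)) : Prop :=
  (forall c, c \in cs -> graph_cycle e c) /\
  pairwise (fun c1 c2 : seq T => [disjoint c1 & c2]) cs.

Definition uncovered (T : finType) (cs : seq (seq T)) : {set T} :=
  [set x | ~~ has (fun c : seq T => x \in c) cs].

Definition log2 (R : realType) (x : R) : R := (ln x / ln 2)%R.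

(* Main.v *)
Require Import Defs.
From mathcomp Require Import all_boot all_order all_algebra.
From mathcomp Require Import boolp reals sequences exp.
From mathcomp Require Import zify ring lra.

(** Put lam = floor (log n) + 1, so that n <= 2 ^ lam and d >= lam ^ 100. The graph
    is cut into expanders, each of them is almost covered by a single cycle, and
    the number of these cycles is then reduced to n / (d + 1). At most 21 n / lam
    vertices stay uncovered, and lam dominates (log log n) ^ (1 / 30).

    Decomposition. Take a labelling of the vertices that minimises
    lam ^ 5 * cut + 2 d * (sum over x of log |class of x|). Splitting a sparse small
    side off a class would lower this potential, so every class is an expander,
    and only O(d n / lam ^ 4) edges run between classes ([expander_partition]).
    Hence all but O(n / lam) vertices lie in good classes, which send out so few
    edges that they are nearly d-regular and have almost d + 1 vertices at least.

    One cycle in an expander ([expander_cycle]). A random colouring provides 4 lam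
    disjoint reservoirs of small total size. A reservoir hits every large set that
    is determined by few vertices ([reservoir_colouring]); together with expansion
    this lets neighbourhoods grow geometrically inside the reservoir, so that two
    sets with many neighbours are linked through it by a short path, even when many
    of its vertices are forbidden ([link]). The other vertices are distributed
    at random into lam ^ 18 layers. Almost every vertex then has about as many
    neighbours in the previous layer as in the next one, so a set separating the
    first layer from the last is almost as large as a layer ([cut_bound]), and
    Menger's theorem gives disjoint paths through all layers that cover almost
    everything ([layered_paths]). Since each vertex has only a small share of its
    neighbours in the two outer layers, any set of path ends has many neighbours.
    The paths are therefore merged through the reservoirs: each reservoir removes
    at least a quarter of the superfluous paths ([merge_rounds]), and the last one
    closes the remaining path into a cycle ([close_cycle]).

    Number of cycles ([nearly_covering_cycles]). Let N be the number of good classes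
    and N0 = floor (n / (d + 1)). The class sizes give N <= (1 + O(lam ^ -3)) (N0 + 1).
    If N > N0 >= lam, keeping the N0 largest classes loses O(n / lam) vertices. If
    N > N0 and N0 < lam, then N = N0 + 1, and every good class has about d + 1
    vertices and is nearly complete. Were any two of these N dense cores separated
    by a single vertex, cutting the graph along such vertices and counting degrees
    would give n >= N (d + 1) ([separated_count]), against the choice of N0. So by
    Menger's theorem some two cores are joined by two disjoint paths, one cycle
    runs through both of them ([merged_cycle]), and N0 cycles suffice
    ([dense_merge]). *)

Set Implicit Arguments.
Unset Strict Implicit.
Unset Printing Implicit Defensive.

Import Order.TTheory GRing.Theory Num.Theory.

(** * Neighbourhoods and edge counts *)

Section Basics.
Variables (T : finType) (e : rel T).
Implicit Types (A B S P W : {set T}).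

Definition nbs P : {set T} := \bigcup_(x in P) neighbours e x.
Definition edges A B : nat := \sum_(x in A) #|neighbours e x :&: B|.

Lemma nbsP P y : reflect (exists2 x, x \in P & e x y) (y \in nbs P).
Proof.
apply: (iffP bigcupP) => -[x xP]; first by rewrite inE => xy; exists x.
by move=> xy; exists x => //; rewrite inE.
Qed.

Lemma nbsS P P' : P \subset P' -> nbs P \subset nbs P'.
Proof.
move=> /subsetP sPP; apply/subsetP => y /nbsP[x xP xy].
by apply/nbsP; exists x; rewrite ?sPP.
Qed.

Lemma nbsU P P' : nbs (P :|: P') = nbs P :|: nbs P'.
Proof. by rewrite /nbs bigcup_setU. Qed.

Lemma nbs1 x : nbs [set x] = neighbours e x.
Proof. by rewrite /nbs big_set1. Qed.

Lemma edges_nbsE P A : nbs A \subset P ->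
  edges A P = \sum_(x in A) #|neighbours e x|.
Proof.
move=> sAP; apply: eq_bigr => x xA; congr #|pred_of_set _|; apply/setIidPl.
apply: subset_trans sAP; apply/subsetP => y; rewrite inE => xy.
by apply/nbsP; exists x.
Qed.

Hypothesis sym_e : symmetric e.

Lemma edgesC A B : edges A B = edges B A.
Proof.
have E (C D : {set T}) : edges C D = \sum_(x in C) \sum_(y in D) e x y.
  apply: eq_bigr => x _; rewrite -sum1_card big_mkcond [RHS]big_mkcond /=.
  by apply: eq_bigr => y _; rewrite !inE andbC; case: (y \in D); case: (e x y).
rewrite !E exchange_big /=; apply: eq_bigr => x _; apply: eq_bigr => y _.
by rewrite sym_e.
Qed.

Variable d : nat.
Hypothesis max_deg : forall x, #|neighbours e x| <= d.

Lemma edges_leql A B : edges A B <= d * #|A|.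
Proof.
rewrite mulnC -sum_nat_const; apply: leq_sum => x _.
by apply: leq_trans (max_deg x); apply: subset_leq_card; apply: subsetIl.
Qed.

Lemma edges_leqr A B : edges A B <= d * #|B|.
Proof. by rewrite edgesC edges_leql. Qed.

End Basics.

(** * Decomposition into expanders *)

Section Decomposition.
Variables (T : finType) (e : rel T).
Hypothesis sym_e : symmetric e.

Definition label_class (h : {ffun T -> 'I_#|T|.+1}) c : {set T} :=
  [set x | h x == c].

Lemma sum_mul_mem (A : {set T}) (F : T -> nat) :
  \sum_x (x \in A) * F x = \sum_(x in A) F x.
Proof.
rewrite [RHS]big_mkcond; apply: eq_bigr => x _.
by case: (x \in A); rewrite ?mul1n ?mul0n.
Qed.

(** A minimiser of the displayed cut plus an entropy term. Giving a fresh label to a set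
    S of at most half of its class lowers the entropy term by 2d|S| at least, because
    the logarithm of the class size drops by one on S; minimality makes the new cut pay
    for it. *)
Lemma expander_partition (d q lam : nat) : #|T| <= 2 ^ lam ->
  exists h : {ffun T -> 'I_#|T|.+1},
    (forall c (S : {set T}), S \subset label_class h c -> 2 * #|S| <= #|label_class h c| ->
       d * #|S| <= q * edges e S (label_class h c :\: S)) /\
    q * (\sum_x #|neighbours e x :\: label_class h (h x)|) <= 2 * d * #|T| * lam.
Proof.
move=> le_T; pose cut h := \sum_x #|neighbours e x :\: label_class h (h x)|.
pose lg h := \sum_x trunc_log 2 #|label_class h (h x)|.
pose Phi h := q * cut h + 2 * d * lg h.
pose h0 : {ffun T -> 'I_#|T|.+1} := [ffun=> ord0].
case: (arg_minnP Phi (i0 := h0) (P := predT)) => // h _ min_h; exists h; split; last first.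
  apply: leq_trans (_ : Phi h <= _); first by rewrite leq_addr.
  apply: leq_trans (min_h h0 isT) _; rewrite /Phi.
  have E x : label_class h0 (h0 x) = setT by apply/setP => y; rewrite !inE !ffunE eqxx.
  rewrite [cut _]big1 => [|x _]; last by rewrite E setDT cards0.
  rewrite muln0 add0n -[leqRHS]mulnA leq_mul2l; apply/orP; right.
  rewrite [lg _](eq_bigr (fun=> trunc_log 2 #|T|)) => [|x _]; last by rewrite E cardsT.
  rewrite sum_nat_const leq_mul2l; apply/orP; right.
  have [->|T_gt0] := posnP #|T|; first by rewrite trunc_log0.
  by rewrite -(@leq_exp2l 2) //; apply: leq_trans le_T; apply: trunc_logP.
move=> c S; set U := label_class h c => sSU leS; rewrite leqNgt; apply/negP => lt_cut.
(* There is one label more than there are vertices, so a label is free for S. *)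
have [z zP] : exists z, forall x, h x != z.
  suff: ~~ ('I_#|T|.+1 \subset codom h).
    by case/subsetPn => z _ zN; exists z => x; apply: contraNneq zN => <-; apply: codom_f.
  apply: contraL (leqnn #|T|.+1) => /subset_leq_card; rewrite card_ord => le1.
  by rewrite -ltnNge ltnS (leq_trans le1) // (leq_trans (card_size _)) // size_codom.
pose h' : {ffun T -> 'I_#|T|.+1} := [ffun x => if x \in S then z else h x].
have clS x : x \in S -> label_class h' (h' x) = S.
  move=> xS; apply/setP => y; rewrite inE !ffunE xS.
  by case: (y \in S); rewrite ?eqxx ?(negPf (zP _)).
have clN x : x \notin S -> label_class h' (h' x) = label_class h (h x) :\: S.
  move=> xS; apply/setP => y; rewrite !inE !ffunE (negPf xS).
  by case: (y \in S); rewrite ?andbT //= eq_sym (negPf (zP _)).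
have hU x : x \in U -> label_class h (h x) = U.
  by rewrite inE => /eqP->.
have hNU x : x \notin U -> label_class h (h x) :\: S = label_class h (h x).
  move=> xU; apply/setP => y; rewrite !inE.
  case yS: (y \in S) => //=; apply/esym/negbTE.
  have:= subsetP sSU y yS; rewrite inE => /eqP->.
  by apply: contra xU => /eqP cx; rewrite inE -cx.
have UE x : x \in S -> x \in U := subsetP sSU x.
have cut_le : cut h' <= cut h + 2 * edges e S (U :\: S).
  rewrite mul2n -addnn {2}edgesC // /edges -!sum_mul_mem -!big_split /=.
  apply: leq_sum => x _; case: (boolP (x \in S)) => xS.
    rewrite clS // hU ?UE // inE xS /= !mul1n mul0n addn0.
    rewrite -cardsUI; apply: leq_trans (leq_addr _ _); apply: subset_leq_card.
    by apply/subsetP => y; rewrite !inE => /andP[/negPf-> ->]; case: (h y == c).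
  rewrite clN // mul0n add0n inE xS /=; case: (boolP (x \in U)) => xU.
    rewrite hU // mul1n -cardsUI; apply: leq_trans (leq_addr _ _).
    by apply: subset_leq_card; apply/subsetP => y; rewrite !inE => /andP[];
       case: (y \in S) => //= H ->; move: H; case: (h y == c).
  by rewrite hNU // mul0n addn0.
have lg_le : lg h' + #|S| <= lg h.
  rewrite -sum1_card -sum_mul_mem -big_split /=; apply: leq_sum => x _; rewrite muln1.
  case: (boolP (x \in S)) => xS; last first.
    by rewrite addn0 clN //; apply: leq_trunc_log; apply: subset_leq_card; apply: subsetDl.
  rewrite clS // hU ?UE // addn1 -trunc_log2_double; last by apply/card_gt0P; exists x.
  by apply: leq_trunc_log; rewrite -mul2n.
have := min_h h' isT; apply/negP; rewrite -ltnNge /Phi.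
have: q * cut h' <= q * (cut h + 2 * edges e S (U :\: S)) by rewrite leq_mul2l cut_le orbT.
have: 2 * d * (lg h' + #|S|) <= 2 * d * lg h by rewrite leq_mul2l lg_le orbT.
move: lt_cut; move: (edges _ _ _) (cut h) (cut h') (lg h) (lg h') #|S| => E a b l l' s; nia.
Qed.

End Decomposition.

(** * Random colourings and reservoirs *)

Section Counting.
Local Open Scope ring_scope.

(** The first-moment method: an average below one is attained below one. *)
Lemma exists_lt1 (R : realFieldType) (F : finType) (w : F -> R) :
  \sum_f w f < #|F|%:R -> exists f, w f < 1.
Proof.
move=> lt_w; apply/existsP; apply: contraLR lt_w => /existsPn w_ge1.
rewrite -leNgt -sum1_card natr_sum; apply: ler_sum => f _.
by rewrite leNgt w_ge1.
Qed.

Lemma sum_subsets (R : realFieldType) (T : finType) (y : R) :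
  \sum_(P : {set T}) y ^+ #|P| = (1 + y) ^+ #|T|.
Proof.
transitivity (\prod_(x : T) (y + 1)); last by rewrite prodr_const addrC.
rewrite bigA_distr /=; apply: eq_big => [P|P _]; first by rewrite inE.
by rewrite -big_mkcond /= prodr_const.
Qed.

Lemma exp1D_le (R : realFieldType) (y : R) m :
  0 <= y -> m%:R * y <= 1 / 2 -> (1 + y) ^+ m <= 1 + 2 * (m%:R * y).
Proof.
move=> y_ge0; elim: m => [|m IHm] my; first by rewrite mul0r mulr0 addr0.
rewrite -natr1 mulrDl mul1r in my *; rewrite exprSr.
have my_ge0 : 0 <= m%:R * y by rewrite mulr_ge0.
have {}IHm : (1 + y) ^+ m <= 1 + 2 * (m%:R * y) by apply: IHm; lra.
apply: le_trans (_ : (1 + 2 * (m%:R * y)) * (1 + y) <= _).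
  by apply: ler_wpM2r => //; lra.
by move: (m%:R * y) my my_ge0 {IHm} => z; nra.
Qed.

Lemma exp1B_le_half (R : realFieldType) M : (0 < M)%N ->
  (1 - M%:R^-1) ^+ M <= 1 / 2 :> R.
Proof.
move=> M_gt0; have M_neq0 : M%:R != 0 :> R by rewrite pnatr_eq0 -lt0n.
have bern n (x : R) : 0 <= x -> 1 + n%:R * x <= (1 + x) ^+ n.
  move=> x_ge0; elim: n => [|n IHn]; first by rewrite mul0r addr0.
  rewrite exprSr -natr1; apply: le_trans (_ : (1 + n%:R * x) * (1 + x) <= _); last first.
    by apply: ler_wpM2r => //; lra.
  have: 0 <= n%:R * x * x by rewrite !mulr_ge0.
  by move: (n%:R : R) => r; lra.
set x : R := M%:R^-1; have x_ge0 : 0 <= x by rewrite invr_ge0.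
have x_le1 : x <= 1 by rewrite invf_le1 ?ltr0n // ler1n.
have := bern M x x_ge0; rewrite mulfV // => le2.
have : (1 - x) ^+ M * (1 + x) ^+ M <= 1.
  rewrite -exprMn exprn_ile1 //; first by rewrite mulr_ge0 //; lra.
  by have := sqr_ge0 x; lra.
have : 0 <= (1 - x) ^+ M by rewrite exprn_ge0 //; lra.
move=> a_ge0 ab_le1; have : (1 - x) ^+ M * 2 <= (1 - x) ^+ M * (1 + x) ^+ M.
  by apply: ler_wpM2l => //; lra.
by lra.
Qed.

Section Colourings.
Variables (R : realType) (T : finType).
Implicit Types S : {set T}.

(** The moment generating function of the size of a colour class inside S, before
    division by the number of colourings: colours are independent over the vertices. *)
Lemma sum_colour_weight (k : nat) S (c : 'I_k) (a : R) :
  \sum_(f : {ffun T -> 'I_k}) a ^+ #|S :&: [set x | f x == c]| =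
  k%:R ^+ #|T| * (1 + (a - 1) / k%:R) ^+ #|S|.
Proof.
case: k c => [[]//|k] c.
have k_gt0 : k.+1%:R != 0 :> R by rewrite pnatr_eq0.
pose w x (j : 'I_k.+1) : R := if (x \in S) && (j == c) then a else 1.
under eq_bigr => f _.
  have -> : a ^+ #|S :&: [set x | f x == c]| = \prod_x w x (f x).
    rewrite -big_mkcond /= -prodr_const; apply: eq_bigl => x.
    by rewrite !inE.
  over.
rewrite -(bigA_distr_bigA w) /=.
have -> : \prod_x \sum_(j < k.+1) w x j =
          \prod_(x : T) (k.+1%:R * (if x \in S then 1 + (a - 1) / k.+1%:R else 1)).
  apply: eq_bigr => x _; rewrite /w; case: (x \in S) => /=; last first.
    by rewrite mulr1 sumr_const card_ord.
  rewrite (bigD1 c) //= eqxx (eq_bigr (fun=> 1)) => [|j /negPf->] //.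
  rewrite sumr_const cardC1 card_ord mulrDr mulr1 mulrCA mulfV // mulr1.
  by rewrite -natr1; ring.
rewrite big_split /= prodr_const; congr (_ * _).
by rewrite -big_mkcond /= prodr_const.
Qed.

(** The expected number of missed pairs (colour, set) is below one. It is
    [sum_colour_weight] at a = 0, since 0 ^+ m indicates that m = 0. *)
Lemma hitting_colouring (M : nat) (I : finType) (P : pred I) (G : I -> {set T}) :
  (0 < M)%N ->
  M%:R * (\sum_(i | P i) (1 - M%:R^-1) ^+ #|G i|) < 1 :> R ->
  exists f : {ffun T -> 'I_M}, forall c i, P i -> exists2 x, x \in G i & f x = c.
Proof.
move=> M_gt0 lt1.
have [f fP] : exists f : {ffun T -> 'I_M},
    \sum_(c < M) \sum_(i | P i) (0 : R) ^+ #|G i :&: [set x | f x == c]| < 1.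
  apply: exists_lt1; rewrite card_ffun card_ord natrX.
  rewrite exchange_big /=; under eq_bigr => c _.
    rewrite exchange_big /=; under eq_bigr do rewrite sum_colour_weight sub0r mulNr mul1r.
    rewrite -mulr_sumr; over.
  rewrite sumr_const card_ord -[_ *+ M]mulr_natl mulrCA gtr_pMr //.
  by rewrite exprn_gt0 // ltr0n.
exists f => c i Pi; have: ~~ (#|G i :&: [set x | f x == c]| == 0%N); last first.
  by rewrite cards_eq0 => /set0Pn[x]; rewrite !inE => /andP[xG /eqP fx]; exists x.
apply/eqP => G0; move: fP; rewrite (bigD1 c) //= (bigD1 i) //= G0 expr0 -!addrA gtrDl.
by apply/negP; rewrite -leNgt addr_ge0 // sumr_ge0 // => *; rewrite ?sumr_ge0 // => *;
   rewrite exprn_ge0.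
Qed.

End Colourings.

Section Reservoir.
Variable T : finType.
Variables (e : rel T) (theta h : nat).

(** The vertices of N(P) outside W that still see theta vertices beyond N(P') and W: if
    one of them joins P', the neighbourhood of P' grows by theta. *)
Definition active (P P' W : {set T}) : {set T} :=
  [set x in nbs e P :\: W | (theta <= #|neighbours e x :\: (nbs e P' :|: W)|)%N].

Definition common (P P' W : {set T}) : {set T} := (nbs e P :&: nbs e P') :\: W.

(** The sets to be hit are determined by the triples (P, P', W), and the size asked of
    them is proportional to the size of the triple; this is what makes the union bound
    in [reservoir_colouring] converge. W is the set of vertices that may not be used. *)
Definition reservoir (Q : {set T}) := forall P P' W : {set T}, P != set0 ->
  ((h * (#|P| + #|P'| + #|W|) <= #|active P P' W|)%N ->
     exists2 x, x \in active P P' W & x \in Q) /\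
  ((h * (#|P| + #|P'| + #|W|) <= #|common P P' W|)%N ->
     exists2 x, x \in common P P' W & x \in Q).

End Reservoir.

(** A union bound over all triples (P, P', W): a set of size h s avoids a given colour
    with probability at most 2 ^ (- 5 lam s), where s is the size of the triple, and
    there are at most (3 n) ^ s triples of size s. *)
Lemma reservoir_colouring (R : realType) (T : finType) (e : rel T) (theta M lam : nat) :
  (0 < M)%N -> (M <= 2 ^ lam)%N -> (#|T| <= 2 ^ lam)%N -> (2 <= lam)%N ->
  exists f : {ffun T -> 'I_M}, forall c,
    reservoir e theta (5 * M * lam) [set x | f x == c].
Proof.
move=> M_gt0 M_le T_le lam_ge2; set h := (5 * M * lam)%N.
pose I : Type := ((({set T} * {set T}) * {set T}) * bool)%type.
pose G (i : I) := if i.2 then active e theta i.1.1.1 i.1.1.2 i.1.2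
                  else common e i.1.1.1 i.1.1.2 i.1.2.
pose P (i : I) := (i.1.1.1 != set0) &&
  (h * (#|i.1.1.1| + #|i.1.1.2| + #|i.1.2|) <= #|G i|)%N.
suff [f fP] : exists f : {ffun T -> 'I_M}, forall c (i : I), P i -> exists2 x, x \in G i & f x = c.
  exists f => c A A' W A0; split=> hle.
    have [|x xG fx] := fP c (A, A', W, true); first by rewrite /P /= A0.
    by exists x => //; rewrite inE fx.
  have [|x xG fx] := fP c (A, A', W, false); first by rewrite /P /= A0.
  by exists x => //; rewrite inE fx.
apply: (@hitting_colouring R) => //.
(* Summed over all triples, weights y ^+ s with y = 2 ^ (- 5 lam) factor into powers of
   1 + y, which are close to 1. *)
pose Q : R := 2 ^+ lam; pose y : R := Q ^- 5.
have Q_ge4 : 4 <= Q by rewrite (_ : 4 = 2 ^+ 2) /Q ?ler_eXn2l ?ltr1n //; ring.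
have MQ : M%:R <= Q by rewrite /Q -natrX ler_nat.
have TQ : #|T|%:R <= Q by rewrite /Q -natrX ler_nat.
have y_gt0 : 0 < y by rewrite invr_gt0 exprn_gt0 //; lra.
have yE : y = (1 / 2) ^+ (5 * lam) by rewrite /y /Q -exprM mulnC div1r exprVn.
pose a (A : {set T}) : R := y ^+ #|A|.
have term (i : I) : P i -> (1 - M%:R^-1) ^+ #|G i| <= a i.1.1.1 * a i.1.1.2 * a i.1.2.
  case/andP=> _ hle; rewrite /a -!exprD.
  have x0 : 0 <= 1 - M%:R^-1 :> R by rewrite subr_ge0 invf_le1 ?ltr0n // ler1n.
  apply: le_trans (_ : (1 - M%:R^-1) ^+ (h * (#|i.1.1.1| + #|i.1.1.2| + #|i.1.2|)) <= _).
    by apply: ler_wiXn2l => //; rewrite gerBl invr_ge0.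
  rewrite exprM; apply: lerXn2r; rewrite ?nnegrE ?exprn_ge0 ?(ltW y_gt0) //.
  rewrite yE /h -mulnA mulnCA exprM; apply: lerXn2r.
  - by rewrite nnegrE exprn_ge0.
  - by rewrite nnegrE; lra.
  - exact: exp1B_le_half.
have sum_le : \sum_(i : I | P i) (1 - M%:R^-1) ^+ #|G i| <=
   2 * (((1 + y) ^+ #|T| - 1) * (1 + y) ^+ #|T| * (1 + y) ^+ #|T|) :> R.
  apply: le_trans (_ : \sum_(i : I | i.1.1.1 != set0) (a i.1.1.1 * a i.1.1.2 * a i.1.2) <= _).
    rewrite big_mkcond [leRHS]big_mkcond /=; apply: ler_sum => i _.
    have := term i; rewrite /P; case: (i.1.1.1 != set0) => //=.
    case: (_ <= _)%N => [->|_] //.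
    by rewrite !mulr_ge0 ?exprn_ge0 ?ltW.
  rewrite -!sum_subsets.
  have -> : \sum_(P0 : {set T}) y ^+ #|P0| - 1 = \sum_(P0 : {set T} | P0 != set0) a P0.
    by rewrite (bigD1 set0) //= cards0 expr0 addrC addrK.
  have -> : (2 : R) = \sum_(b : bool) 1 by rewrite big_bool.
  rewrite mulrC big_distrlr pair_big big_distrlr pair_big big_distrlr pair_big /=.
  rewrite le_eqVlt; apply/orP; left; apply/eqP; apply: eq_big => [i|i _].
    by rewrite !andbT.
  by rewrite mulr1.
pose s := Q^-1; have Qs : Q * s = 1 by rewrite mulfV //; lra.
have s_gt0 : 0 < s by rewrite invr_gt0; lra.
have s_le : s <= 1 / 4 by nra.
have ys : y = s * s * s * s * s by rewrite /y -exprVn -/s; ring.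
pose t := s * s; have t_gt0 : 0 < t by rewrite mulr_gt0.
have t_le : t <= 1 / 16 by rewrite /t; nra.
have Qy : Q * y = t * t by rewrite ys !mulrA Qs mul1r /t; ring.
have tt_le : t * t <= 1 / 256 by nra.
have N_le : (1 + y) ^+ #|T| <= 1 + 2 * (t * t).
  have Ty : #|T|%:R * y <= t * t by rewrite -Qy; apply: ler_wpM2r => //; exact: ltW.
  apply: le_trans (exp1D_le _ _) _; [exact: ltW | lra | lra].
set N := (1 + y) ^+ #|T| in sum_le N_le.
have N_ge1 : 1 <= N by rewrite /N exprn_ege1 //; lra.
have N_le2 : N <= 2 by lra.
have b1 : (N - 1) * N * N <= 2 * (t * t) * 2 * 2.
  apply: ler_pM; rewrite ?mulr_ge0 //; try lra.
  by apply: ler_pM => //; lra.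
have b2 : M%:R * (\sum_(i : I | P i) (1 - M%:R^-1) ^+ #|G i|) <= Q * (16 * (t * t)) :> R.
  apply: ler_pM => //; last lra.
  apply: sumr_ge0 => i _; rewrite exprn_ge0 // subr_ge0 invf_le1 ?ltr0n // ler1n //.
apply: le_lt_trans b2 _.
have -> : Q * (16 * (t * t)) = (Q * s) * (16 * (s * t)) by rewrite /t; ring.
by rewrite Qs mul1r; nra.
Qed.

End Counting.

(** * A Chernoff bound for random colourings *)

Section Chernoff.
Local Open Scope ring_scope.

Section Layers.
Variables (R : realType) (T : finType).
Implicit Types S : {set T}.

(** With 1 + eta below and above an exponential, the Chernoff estimate becomes an
    inequality between exponents. *)
Lemma expR_quadratic_le (eta : R) : 0 <= eta <= 1 -> expR (eta - eta ^+ 2) <= 1 + eta.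
Proof.
move=> /andP[e_ge0 e_le1]; set u := eta - eta ^+ 2.
have u_le1 : 0 < 1 - u by rewrite /u; have := sqr_ge0 eta; rewrite expr2; nra.
have := expR_ge1Dx (- u); rewrite expRN => le_inv.
have -> : expR u = (expR u)^-1^-1 by rewrite invrK.
apply: le_trans (_ : (1 - u)^-1 <= _).
  by rewrite lef_pV2 ?posrE ?invr_gt0 ?expR_gt0.
rewrite -[_^-1]mul1r ler_pdivrMr // /u.
have : 0 <= eta ^+ 3 by rewrite exprn_ge0.
by rewrite !exprS expr0; lra.
Qed.

(** The exponential moment with parameter 1 + eta, divided by a lower bound for (1 +
    eta) ^ t at the threshold t = (|S| + 3 eta D) / k. The slack D in place of |S| keeps
    the bound useful for small S. *)
Lemma colour_upper_tail (k : nat) S (c : 'I_k) (D : nat) (eta : R) :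
  0 <= eta <= 1 / 3 -> (#|S| <= D)%N ->
  \sum_(f : {ffun T -> 'I_k})
     ((1 + eta) ^+ #|S :&: [set x | f x == c]| /
       expR ((eta - eta ^+ 2) * ((#|S|%:R + 3 * eta * D%:R) / k%:R))) <=
  k%:R ^+ #|T| * expR (- (eta ^+ 2 * D%:R / k%:R)).
Proof.
move=> /andP[e_ge0 e_le] SD; rewrite -mulr_suml sum_colour_weight -mulrA.
apply: ler_wpM2l; first by rewrite exprn_ge0.
rewrite -expRN; apply: le_trans (_ : expR (#|S|%:R * (eta / k%:R)) * _ <= _).
  apply: ler_wpM2r; first by rewrite ltW ?expR_gt0.
  rewrite (_ : 1 + eta - 1 = eta); last by lra.
  rewrite expRM_natl; apply: lerXn2r; last exact: expR_ge1Dx.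
    by rewrite nnegrE addr_ge0 // divr_ge0.
  by rewrite nnegrE ltW ?expR_gt0.
rewrite -expRD ler_expR.
set s : R := #|S|%:R; set d : R := D%:R.
have sd : s <= d by rewrite ler_nat.
have s_ge0 : 0 <= s by []; have -> : s * (eta / k%:R) -
  (eta - eta ^+ 2) * ((s + 3 * eta * d) / k%:R) =
  (s * eta - (eta - eta ^+ 2) * (s + 3 * eta * d)) / k%:R by ring.
rewrite -[leRHS]mulNr; apply: ler_wpM2r; first by rewrite invr_ge0.
have -> : s * eta - (eta - eta ^+ 2) * (s + 3 * eta * d) =
  eta ^+ 2 * (s + 3 * eta * d - 3 * d) by ring.
rewrite -[leRHS]mulrN; apply: ler_wpM2l; first exact: sqr_ge0.
by have : 0 <= d := ler0n _ _; nra.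
Qed.

(** A union bound over the sets S i and the colours. *)
Lemma colouring_upper (I : finType) (S : I -> {set T}) (D : I -> nat) (k lam D0 : nat) :
  (0 < k)%N -> (0 < lam)%N -> (#|I| * k < 2 ^ (3 * lam))%N ->
  (forall i, #|S i| <= D i)%N -> (forall i, D0 <= D i)%N ->
  (27 * k ^ 5 * lam ^ 3 <= D0)%N ->
  exists f : {ffun T -> 'I_k}, forall i c,
    (k ^ 2 * lam * (k * #|S i :&: [set x | f x == c]|) <= k ^ 2 * lam * #|S i| + D i)%N.
Proof.
move=> k_gt0 lam_gt0 Ik SD D0D D0_ge.
(* With this eta the slack 3 eta D of the tail bound is D / (k ^ 2 lam). *)
pose K : R := k%:R; pose L : R := lam%:R; pose eta : R := (3 * K ^+ 2 * L)^-1.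
have K_ge1 : 1 <= K by rewrite ler1n.
have L_ge1 : 1 <= L by rewrite ler1n.
have KL_ge1 : 1 <= K ^+ 2 * L by rewrite -[1]mulr1; apply: ler_pM => //; rewrite exprn_ege1.
have eta_gt0 : 0 < eta by rewrite invr_gt0 -mulrA; lra.
have eta_le : eta <= 1 / 3.
  by rewrite div1r lef_pV2 ?posrE -?mulrA //; lra.
pose w i c (f : {ffun T -> 'I_k}) : R := (1 + eta) ^+ #|S i :&: [set x | f x == c]| /
       expR ((eta - eta ^+ 2) * ((#|S i|%:R + 3 * eta * (D i)%:R) / K)).
have w_ge0 i c f : 0 <= w i c f.
  by rewrite divr_ge0 ?(ltW (expR_gt0 _)) // exprn_ge0 //; lra.
have small i : expR (- (eta ^+ 2 * (D i)%:R / K)) <= 2 ^- (3 * lam) :> R.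
  rewrite expRN lef_pV2 ?posrE ?expR_gt0 ?exprn_gt0 //.
  apply: le_trans (_ : expR ((3 * lam)%:R * 1) <= _).
    rewrite expRM_natl; apply: lerXn2r; rewrite ?nnegrE ?(ltW (expR_gt0 _)) //.
    by have := expR_ge1Dx (1 : R); lra.
  rewrite ler_expR mulr1 ler_pdivlMr; last lra.
  have DR : 27 * K ^+ 5 * L ^+ 3 <= (D i)%:R :> R.
    rewrite -!natrX -!natrM ler_nat; exact: leq_trans D0_ge (D0D i).
  apply: le_trans (_ : eta ^+ 2 * (27 * K ^+ 5 * L ^+ 3) <= _); last first.
    by apply: ler_wpM2l => //; rewrite sqr_ge0.
  rewrite natrM -/L (_ : eta ^+ 2 * _ = 3 * L * K) // /eta; field.
  by apply/andP; split; lra.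
have [f fP] : exists f : {ffun T -> 'I_k}, \sum_i \sum_c w i c f < 1.
  apply: exists_lt1; rewrite card_ffun card_ord natrX.
  rewrite exchange_big /=; under eq_bigr do rewrite exchange_big /=.
  apply: le_lt_trans (_ : \sum_(i : I) \sum_(c < k) K ^+ #|T| * 2 ^- (3 * lam) < _).
    apply: ler_sum => i _; apply: ler_sum => c _.
    apply: le_trans (colour_upper_tail _ _ (SD i)) _; first by rewrite ltW.
    by apply: ler_wpM2l => //; rewrite exprn_ge0 //; lra.
  rewrite !sumr_const card_ord -mulrnA -[_ *+ _]mulr_natl mulrCA gtr_pMr; last first.
    by rewrite exprn_gt0; lra.
  by rewrite ltr_pdivrMr ?exprn_gt0 // mul1r -natrX ltr_nat mulnC.
exists f => i c; rewrite leqNgt; apply/negP => bad; move: fP; apply/negP; rewrite -leNgt.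
rewrite (bigD1 i) //= (bigD1 c) //= -addrA.
rewrite -[leLHS]addr0; apply: lerD; last first.
  by rewrite addr_ge0 ?sumr_ge0 // => *; rewrite sumr_ge0.
rewrite /w ler_pdivlMr ?expR_gt0 // mul1r; set X := #|_ :&: _| in bad *.
apply: le_trans (_ : expR (X%:R * (eta - eta ^+ 2)) <= _); last first.
  rewrite expRM_natl; apply: lerXn2r; rewrite ?nnegrE ?(ltW (expR_gt0 _)) //; first lra.
  by apply: expR_quadratic_le; lra.
rewrite ler_expR mulrC; apply: ler_wpM2r; first by rewrite expr2; nra.
rewrite ler_pdivrMr; last lra.
have {bad} : K ^+ 2 * L * #|S i|%:R + (D i)%:R <= K ^+ 2 * L * (K * X%:R).
  by rewrite -!natrX -!natrM -natrD ler_nat ltnW.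
have -> : 3 * eta = (K ^+ 2 * L)^-1 by rewrite /eta; field; apply/andP; split; lra.
move=> le1; rewrite -(ler_pM2l (_ : 0 < K ^+ 2 * L)); last lra.
rewrite mulrDr !mulrA mulfV ?mul1r; last lra.
by move: le1; rewrite !mulrA [_ * X%:R * K]mulrAC.
Qed.

End Layers.

End Chernoff.

(** * Menger's theorem *)

Section Menger.
Variable T : finType.
Implicit Types (e : rel T) (A B S X Y : {set T}) (p : T * seq T).

(** A path is a pair of its first vertex and the sequence of the others, so that it is
    never empty. *)
Definition verts p : seq T := p.1 :: p.2.

Definition joins e A B p : Prop :=
  [/\ path e p.1 p.2, p.1 \in A, last p.1 p.2 \in B & uniq (verts p)].

Definition separates e A B S : Prop :=
  forall u s, path e u s -> u \in A -> last u s \in B -> has (mem S) (u :: s).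

Lemma first_hit X u s : has (mem X) (u :: s) ->
  exists s1 s2, [/\ s = s1 ++ s2, last u s1 \in X & ~~ has (mem X) (belast u s1)].
Proof.
elim: s u => [|v s IHs] u /=; first by rewrite orbF => uX; exists [::], [::].
case uX: (u \in X); first by exists [::], (v :: s).
move/IHs => [s1 [s2 [-> lX nX]]]; exists (v :: s1), s2; split => //=.
by rewrite uX.
Qed.

Lemma last_hit X u s : has (mem X) (u :: s) ->
  exists s1 s2, [/\ s = s1 ++ s2, last u s1 \in X & ~~ has (mem X) s2].
Proof.
elim: s u => [|v s IHs] u; first by rewrite /= orbF => uX; exists [::], [::].
have [/IHs[s1 [s2 [-> lX nX]]] _|nX] := boolP (has (mem X) (v :: s)).
  by exists (v :: s1), s2.
by rewrite /= -/(has _ (v :: s)) in nX *; rewrite (negPf nX) orbF => uX; exists [::], (v :: s).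
Qed.

Lemma joins_shorten e A B u s : path e u s -> u \in A -> last u s \in B ->
  exists p, joins e A B p /\ {subset verts p <= u :: s}.
Proof.
move=> es uA; case: (shortenP es) => s' es' us' sub lB; exists (u, s'); split => // v.
by rewrite !inE => /orP[-> //|/sub->]; rewrite orbT.
Qed.

Section DeleteEdge.
Variables (e : rel T) (x y : T).
Definition del_edge : rel T := fun u v => e u v && ((u, v) != (x, y)).

Lemma path_del_tail u s : path e u s -> x \notin belast u s -> path del_edge u s.
Proof.
elim: s u => //= v s IHs u /andP[uv vs]; rewrite inE negb_or => /andP[xu xs].
by rewrite /del_edge uv xpair_eqE eq_sym (negPf xu) /= IHs.
Qed.

Lemma path_del_head u s : path e u s -> y \notin s -> path del_edge u s.
Proof.
elim: s u => //= v s IHs u /andP[uv vs]; rewrite inE negb_or => /andP[yv ys].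
by rewrite /del_edge uv xpair_eqE [v == y]eq_sym (negPf yv) andbF /= IHs.
Qed.

Lemma path_del u s : path e u s ->
  path del_edge u s \/ (x \in u :: s /\ y \in u :: s).
Proof.
elim: s u => [|v s IHs] u /=; first by left.
case/andP => uv /IHs[vs|[xs ys]]; last by right; rewrite !inE in xs ys *; rewrite xs ys !orbT.
have [[-> ->]|neq] := eqVneq (u, v) (x, y); last by left; rewrite /del_edge uv neq.
by right; rewrite !inE !eqxx /= orbT.
Qed.
End DeleteEdge.

(** Goering's proof, by deleting an edge xy. If a set S with fewer than n vertices
    separates A from B without xy, then adding x, or y, to S gives a separator of size n
    of the whole graph. By induction n disjoint paths lead from A to x + S and n from y
    + S to B; they meet only in S and are glued there and along xy. *)
Theorem menger e A B n : (forall S, separates e A B S -> n <= #|S|) ->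
  exists F : 'I_n -> T * seq T, (forall i, joins e A B (F i)) /\
    forall i j v, v \in verts (F i) -> v \in verts (F j) -> i = j.
Proof.
have [N] := ubnP #|[set z : T * T | e z.1 z.2]|.
elim: N => // N IHN in e A B n *; rewrite ltnS => leN sepn.
have [/existsP[[x y] /= exy]|noedge] := boolP [exists z : T * T, e z.1 z.2]; last first.
  have {}noedge u v : e u v = false.
    by apply: contraNF noedge => uv; apply/existsP; exists (u, v).
  have AB : n <= #|A :&: B|.
    apply: sepn => u [|v s] /=; last by rewrite noedge.
    by move=> _ uA uB; rewrite inE uA uB.
  exists (fun i => (enum_val (widen_ord AB i), [::])); split => [i|i j v].
    by have:= enum_valP (widen_ord AB i); rewrite inE => /andP[].
  rewrite !inE => /eqP-> /eqP /enum_val_inj /(congr1 val) /= ij; exact: val_inj.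
pose e' := del_edge e x y.
have e'e : subrel e' e by move=> u v /andP[].
have ltN : #|[set z : T * T | e' z.1 z.2]| < N.
  apply: leq_trans leN; apply: proper_card; apply/properP; split.
    by apply/subsetP => z; rewrite !inE => /e'e.
  by exists (x, y); rewrite !inE // /e' /del_edge eqxx andbF.
have [all_n|] := pselect (forall S, separates e' A B S -> n <= #|S|).
  have [F [jF dF]] := IHN e' A B n ltN all_n; exists F; split => // i.
  by have [pF *] := jF i; split => //; apply: sub_path pF.
move/existsNP=> [S /not_implyP[sepS /negP]]; rewrite -ltnNge => ltS.
(* A path that avoids S uses the deleted edge and so contains x and y. *)
have sepx : separates e A B (x |: S).
  move=> u s us uA lB; have [us'|[xs _]] := path_del x y us.
    have /hasP[v vs vS] := sepS _ _ us' uA lB; apply/hasP; exists v => //=.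
    by rewrite inE; apply/orP; right.
  by apply/hasP; exists x => //=; rewrite setU11.
have sepy : separates e A B (y |: S).
  move=> u s us uA lB; have [us'|[_ ys]] := path_del x y us.
    have /hasP[v vs vS] := sepS _ _ us' uA lB; apply/hasP; exists v => //=.
    by rewrite inE; apply/orP; right.
  by apply/hasP; exists y => //=; rewrite setU11.
have xS : x \notin S.
  apply: contraL ltS => xS; rewrite -leqNgt.
  by have:= sepn _ sepx; rewrite cardsU1 xS.
have yS : y \notin S.
  apply: contraL ltS => yS; rewrite -leqNgt.
  by have:= sepn _ sepy; rewrite cardsU1 yS.
have cardx : #|x |: S| = n.
  by apply/eqP; rewrite eqn_leq sepn // andbT cardsU1 xS.
have cardy : #|y |: S| = n.
  by apply/eqP; rewrite eqn_leq sepn // andbT cardsU1 yS.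
(* The part of an A-B path up to its first vertex in x + S cannot use the edge xy, so
   any set separating A from x + S without xy separates A from B. *)
have [F [jF dF]] : exists F : 'I_n -> T * seq T, (forall i, joins e' A (x |: S) (F i)) /\
    forall i j v, v \in verts (F i) -> v \in verts (F j) -> i = j.
  apply: IHN ltN _ => Z sepZ; apply: sepn => u s us uA lB.
  have [s1 [s2 [def_s lX nX]]] := first_hit (sepx _ _ us uA lB).
  move: us; rewrite def_s cat_path => /andP[us1 _].
  have /hasP[v vs vZ] : has (mem Z) (u :: s1).
    apply: sepZ => //; apply: path_del_tail => //.
    by apply: contra nX => xs; apply/hasP; exists x => //=; rewrite setU11.
  by apply/hasP; exists v => //; rewrite -cat_cons mem_cat vs.
have [G [jG dG]] : exists G : 'I_n -> T * seq T, (forall i, joins e' (y |: S) B (G i)) /\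
    forall i j v, v \in verts (G i) -> v \in verts (G j) -> i = j.
  apply: IHN ltN _ => Z sepZ; apply: sepn => u s us uA lB.
  have [s1 [s2 [def_s lX nX]]] := last_hit (sepy _ _ us uA lB).
  move: us lB; rewrite def_s cat_path last_cat => /andP[_ us2] lB.
  have /hasP[v vs vZ] : has (mem Z) (last u s1 :: s2).
    apply: sepZ => //; apply: path_del_head => //.
    by apply: contra nX => ys; apply/hasP; exists y => //=; rewrite setU11.
  apply/hasP; exists v => //; move: vs; rewrite inE => /orP[/eqP->|vs].
    by rewrite -cat_cons mem_cat mem_last.
  by rewrite -cat_cons mem_cat vs orbT.
pose lastF i := last (F i).1 (F i).2.
have lastF_in i : lastF i \in verts (F i) by rewrite /lastF mem_last.
have firstG_in i : (G i).1 \in verts (G i) by rewrite mem_head.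
have onto (X : {set T}) (f : 'I_n -> T) : #|X| = n -> injective f ->
    (forall i, f i \in X) -> forall v, v \in X -> exists i, f i = v.
  move=> cX inj_f fX v vX; suff /codomP[i ->] : v \in codom f by exists i.
  have /subset_leqif_cards/geq_leqif : [set f i | i in 'I_n] \subset X.
    by apply/subsetP => _ /imsetP[i _ ->].
  rewrite card_imset // card_ord cX leqnn => /esym/eqP XE.
  by move: vX; rewrite -XE => /imsetP[i _ ->]; apply: codom_f.
have ontoF : forall v, v \in x |: S -> exists i, lastF i = v.
  apply: onto => // [i j ij|i]; last by case: (jF i).
  by apply: (dF i j (lastF i)) => //; rewrite ij.
have ontoG : forall v, v \in y |: S -> exists i, (G i).1 = v.
  apply: onto => // [i j ij|i]; last by case: (jG i).
  by apply: (dG i j (G i).1) => //; rewrite ij.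
(* At a common vertex outside S, the start of one path and the end of the other would
   form a path from A to B that avoids both S and xy. *)
have cross i j v : v \in verts (F i) -> v \in verts (G j) ->
    [/\ v \in S, v = lastF i & v = (G j).1].
  move=> vF vG; have [pF FA FX uF] := jF i; have [pG GY GB uG] := jG j.
  have split_at u s : v \in u :: s -> exists s1 s2, s = s1 ++ s2 /\ last u s1 = v.
    move=> vs; have [|s1 [s2 [-> ]]] := @last_hit [set v] u s.
      by apply/hasP; exists v => //=; rewrite inE.
    by rewrite inE => /eqP l1 _; exists s1, s2.
  have [s1 [s2 [FE l1]]] := split_at _ _ vF; have [t1 [t2 [GE l2]]] := split_at _ _ vG.
  have pw : path e' (F i).1 (s1 ++ t2).
    rewrite cat_path l1; move: pF pG; rewrite FE GE !cat_path l2.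
    by case/andP=> -> _ /andP[].
  have /hasP[z] : has (mem S) ((F i).1 :: s1 ++ t2).
    apply: sepS pw FA _; rewrite last_cat l1 -l2.
    by move: GB; rewrite GE last_cat.
  rewrite -cat_cons mem_cat => /orP[zs1|zt2] /= zS; last first.
    have [j' Gj'] := ontoG z (setU1r _ zS).
    have jj' : j' = j.
      apply: (dG _ _ z); first by rewrite -Gj'.
      by rewrite /verts GE inE mem_cat zt2 !orbT.
    move: uG; rewrite /verts GE /= mem_cat negb_or -jj' Gj'.
    by case/andP=> /andP[_]; rewrite zt2.
  have zF : z \in verts (F i) by rewrite /verts FE -cat_cons mem_cat zs1.
  have [i' Fi'] := ontoF z (setU1r _ zS).
  have ii' : i' = i by apply: (dF _ _ z) => //; rewrite -Fi'.
  rewrite {i'}ii' in Fi'.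
  have s20 : s2 = [::].
    case: s2 FE => // a s2 FE; have zs2 : z \in a :: s2.
      by rewrite -Fi' /lastF FE last_cat /= mem_last.
    move: uF; rewrite /verts FE -cat_cons cat_uniq => /and3P[_ /hasPn/(_ z zs2)].
    by rewrite /= zs1.
  have vz : v = z by rewrite -Fi' /lastF FE s20 cats0 l1.
  have [j' Gj'] := ontoG z (setU1r _ zS).
  have jj' : j' = j by apply: (dG _ _ z); [rewrite -Gj' | rewrite -vz].
  by split; [rewrite vz | rewrite vz -Fi' | rewrite vz -jj' Gj'].
have /fin_all_exists[H HP] (i : 'I_n) : exists pj : (T * seq T) * 'I_n,
    [/\ joins e A B pj.1, {subset verts pj.1 <= verts (F i) ++ verts (G pj.2)} &
      (lastF i \in S /\ (G pj.2).1 = lastF i) \/ (lastF i = x /\ (G pj.2).1 = y)].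
  have [pF FA FX uF] := jF i; move: (FX); rewrite in_setU1 => /orP[/eqP lx|lS].
    have [j Gj] := ontoG y (setU11 _ _); have [pG GY GB uG] := jG j.
    have pw : path e (F i).1 ((F i).2 ++ verts (G j)).
      rewrite cat_path (sub_path e'e pF) /= lx Gj exy -Gj.
      exact: sub_path pG.
    have [|p [jp sp]] := joins_shorten (B := B) pw FA; first by rewrite last_cat.
    by exists (p, j); split => //=; right.
  have [j Gj] := ontoG _ (setU1r y lS); have [pG GY GB uG] := jG j.
  have pw : path e (F i).1 ((F i).2 ++ (G j).2).
    by rewrite cat_path (sub_path e'e pF) /= -Gj; apply: sub_path pG.
  have [|p [jp sp]] := joins_shorten (B := B) pw FA; first by rewrite last_cat -Gj.
  exists (p, j); split; [exact: jp | | by left].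
  move=> v /sp; rewrite -cat_cons mem_cat -/(verts (F i)) => vFG.
  rewrite mem_cat; case/orP: vFG => [->//|vG].
  by rewrite [_ \in verts (G j)]inE vG !orbT.
exists (fun i => (H i).1); split => [i|i i' v]; first by case: (HP i).
have [_ /(_ v) + ri] := HP i; have [_ /(_ v) + ri'] := HP i'.
move=> sub' sub /sub + /sub'; rewrite !mem_cat => /orP[vF|vG] /orP[vF'|vG'].
- exact: dF vF vF'.
- have [vS vl vg] := cross _ _ _ vF vG'.
  case: ri' => -[lF' gH]; last by move: yS; rewrite -gH -vg vS.
  by apply: (dF _ _ v) => //; rewrite vg gH.
- have [vS vl vg] := cross _ _ _ vF' vG.
  case: ri => -[lF' gH]; last by move: yS; rewrite -gH -vg vS.
  by apply: (dF _ _ v) => //; rewrite vg gH.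
have jj : (H i).2 = (H i').2 := dG _ _ _ vG vG'.
have ll : lastF i = lastF i'.
  move: ri ri'; rewrite jj => -[[lS gl]|[lx gl]] [[lS' gl']|[lx' gl']].
  - by rewrite -gl.
  - by move: yS; rewrite -gl' gl lS.
  - by move: yS; rewrite -gl gl' lS'.
  - by rewrite lx.
by apply: (dF _ _ (lastF i)) => //; rewrite ll.
Qed.

End Menger.

(** * Growing neighbourhoods through a reservoir *)

Lemma expnS_bernoulli x n : n * x ^ n.-1 + x ^ n <= x.+1 ^ n.
Proof.
elim: n => [|n IHn]; first by rewrite !expn0.
apply: leq_trans (_ : x.+1 * (n * x ^ n.-1 + x ^ n) <= _); last first.
  by rewrite expnS leq_mul2l IHn orbT.
case: n {IHn} => [|n]; first by rewrite !expn1 !expn0; lia.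
by rewrite /= [x ^ n.+2]expnS !expnS; move: (x ^ n) => y; nia.
Qed.

(** This is (1 + 1/x) ^ x >= 2, which turns a growth factor 1 + 1/x into a number of
    rounds. *)
Lemma growth_doubles x : 0 < x -> 2 * x ^ x <= x.+1 ^ x.
Proof.
move=> x0; have := expnS_bernoulli x x.
by rewrite -expnS prednK // addnn mul2n.
Qed.

Lemma leq_card_setU3 (T : finType) (X A B C : {set T}) :
  X \subset A :|: B :|: C -> #|X| <= #|A| + #|B| + #|C|.
Proof.
move/subset_leq_card/leq_trans; apply.
by apply: leq_trans (leq_card_setU _ _) _; rewrite leq_add2r leq_card_setU.
Qed.

Section Growth.
Variables (T : finType) (e : rel T).
Implicit Types (A B P Q W Z : {set T}).
Hypothesis sym_e : symmetric e.

Fixpoint reach Q W A l : {set T} :=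
  if l is l'.+1 then reach Q W A l' :|: (nbs e (reach Q W A l') :&: (Q :\: W)) else A.

Lemma reachS Q W A l : reach Q W A l \subset reach Q W A l.+1.
Proof. exact: subsetUl. Qed.

Lemma reach_path Q W A l v : v \in reach Q W A l ->
  exists u s, [/\ u \in A, path e u s, last u s = v, {subset s <= Q :\: W} & size s <= l].
Proof.
elim: l v => [|l IHl] v /=; first by move=> vA; exists v, [::].
rewrite inE => /orP[/IHl[u [s [? ? ? ? sz]]]|]; first by exists u, s; split=> //; exact: ltnW.
rewrite inE => /andP[/nbsP[w /IHl[u [s [uA us lw sQ sz]]] wv] vQ].
exists u, (rcons s v); split; rewrite ?last_rcons ?size_rcons //.
  by rewrite rcons_path us lw.
by move=> z; rewrite mem_rcons inE => /orP[/eqP->//|/sQ].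
Qed.

Variables (d q h theta K : nat) (Q W : {set T}).
Hypothesis max_deg : forall x, #|neighbours e x| <= d.
Hypothesis expands : forall S : {set T}, 2 * #|S| <= #|T| -> d * #|S| <= q * edges e S (~: S).
Hypothesis Q_res : reservoir e theta h Q.
Hypotheses (q_gt0 : 0 < q) (h_gt0 : 0 < h) (KE : K = 48 * q * h).
Hypotheses (K_le : K <= theta) (theta_le : 12 * q * theta <= d).

(** Expansion of sets beyond half of the vertices comes from their complements. *)
Lemma boundary_large Z : 4 * #|Z| <= 3 * #|T| -> d * #|Z| <= 3 * (q * edges e Z (~: Z)).
Proof.
move=> Z_le; have := cardsC Z; have [/expands|Z_big] := leqP (2 * #|Z|) #|T|; first lia.
move=> cZ; have /expands : 2 * #|~: Z| <= #|T| by lia.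
rewrite setCK edgesC // => le1.
suff : d * #|Z| <= d * (3 * #|~: Z|) by lia.
by rewrite leq_mul2l; apply/orP; right; lia.
Qed.

(** One step of growth. P' is a largest set that adds vertices of Q to P, each new one
    paying with theta further neighbours. If N(P') were not much larger than Z = N(P)
    minus W, then by expansion many vertices of Z would still be active, and Q would
    contain one that extends P'. *)
Lemma grow A l P : P != set0 -> P \subset reach Q W A l ->
  4 * #|nbs e P :\: W| <= 3 * #|T| -> K * (#|P| + #|W|) <= #|nbs e P :\: W| ->
  exists P', [/\ P \subset P', P' \subset reach Q W A l.+1,
    K * (#|P'| + #|W|) <= #|nbs e P' :\: W| &
    (12 * q).+1 * #|nbs e P :\: W| <= 12 * q * #|nbs e P' :\: W|].
Proof.
move=> P0 Pr; set Z := nbs e P :\: W => Z_le KZ.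
pose ok (P' : {set T}) := [&& P \subset P', P' \subset P :|: (Z :&: Q) &
  theta * #|P' :\: P| + #|Z| <= #|nbs e P' :\: W|].
have okP : ok P by rewrite /ok subxx subsetUl setDv cards0 muln0 add0n leqnn.
case: (arg_maxnP (fun P' => #|P'|) okP) => P' /and3P[sPP' sP' gain] maxP'.
set Z' := nbs e P' :\: W in gain *.
have sZZ' : Z \subset Z' by apply: setSD; apply: nbsS.
have cardP' : #|P'| = #|P| + #|P' :\: P| by rewrite -(cardsID P P') (setIidPr sPP').
exists P'; split => //.
- apply: subset_trans sP' _; rewrite subUset (subset_trans Pr (reachS _ _ _ _)) /=.
  apply/subsetP => x; rewrite !inE => /andP[/andP[xW xP] ->].
  by rewrite (subsetP (nbsS e Pr)) // xW orbT.
- move: gain (leq_mul2r #|P' :\: P| K theta); rewrite K_le orbT cardP'.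
  by rewrite -/Z in KZ; move: (#|Z|) (#|Z'|) KZ => z z' KZ *; lia.
rewrite leqNgt; apply/negP => slow.
set act := active e theta P P' W.
have d_gt0 : 0 < d by apply: leq_trans theta_le; rewrite !muln_gt0 q_gt0 /=; lia.
have cZ' : #|Z'| = #|Z| + #|Z' :\: Z| by rewrite -(cardsID Z Z') (setIidPr sZZ').
(* An edge leaving Z ends in W or in the new part of Z', or is one of the edges beyond
   Z' and W, of which a vertex that is not active has fewer than theta. *)
have bound : edges e Z (~: Z) <= d * #|act| + theta * #|Z| + d * #|W| + d * #|Z' :\: Z|.
  apply: leq_trans (_ : \sum_(x in Z) #|neighbours e x :\: (nbs e P' :|: W)| +
                        edges e Z W + edges e Z (Z' :\: Z) <= _).
    rewrite -!big_split /=; apply: leq_sum => x _.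
    apply: leq_card_setU3; apply/subsetP => y; rewrite !inE.
    by case: (e x y) => //=; case: (y \in W); case: (y \in nbs e P'); case: (y \in nbs e P).
  apply: leq_add; last exact: edges_leqr.
  apply: leq_add; last exact: edges_leqr.
  have sact : act \subset Z by apply/subsetP => x; rewrite inE => /andP[].
  rewrite (big_setID act) /= (setIidPr sact) leq_add //.
    rewrite mulnC -sum_nat_const; apply: leq_sum => x _.
    by apply: leq_trans (max_deg x); apply: subset_leq_card; apply: subsetDl.
  apply: leq_trans (_ : \sum_(x in Z :\: act) theta <= _).
    apply: leq_sum => x; rewrite in_setD => /andP[xNact xZ].
    by move: xNact; rewrite inE xZ /= -ltnNge => /ltnW.
  rewrite sum_nat_const mulnC leq_mul2l; apply/orP; right.
  exact/subset_leq_card/subsetDl.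
have W_small : 12 * q * #|W| <= #|Z|.
  apply: leq_trans KZ; rewrite KE; apply: leq_mul; last exact: leq_addl.
  by nia.
have act_big : #|Z| <= 12 * q * #|act|.
  rewrite -(leq_pmul2l d_gt0).
  have := boundary_large Z_le; rewrite cZ' in slow.
  move: bound theta_le W_small slow; move: (edges _ _ _) (#|Z|) (#|act|) (#|W|) (#|_ :\: _|).
  move=> E z a w g bound th ws slow dz.
  have g_small : 12 * q * g <= z by lia.
  have : q * E <= q * (d * a + theta * z + d * w + d * g) by rewrite leq_mul2l bound orbT.
  have : 12 * q * theta * z <= d * z by rewrite leq_mul2r th orbT.
  have : d * (12 * q * w) <= d * z by rewrite leq_mul2l ws orbT.
  have : d * (12 * q * g) <= d * z by rewrite leq_mul2l g_small orbT.
  by nia.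
have hP : h * (#|P| + #|P'| + #|W|) <= #|act|.
  have q12 : 0 < 12 * q by rewrite muln_gt0.
  rewrite -(leq_pmul2l q12); apply: leq_trans act_big; rewrite cardP'.
  rewrite cZ' in gain slow; have K_le' := K_le; rewrite KE in KZ K_le'.
  move: gain slow KZ {cZ'}; move: (#|P|) (#|Z|) (#|W|) (#|_ :\: _|) (#|_ :\: _|).
  move=> p z w g f gain slow KZ.
  have f_small : theta * f <= g by lia.
  have : 48 * q * h * f <= theta * f by rewrite leq_mul2r K_le' orbT.
  have : 12 * q * g <= z by lia.
  have : 12 * q * (theta * f) <= 12 * q * g by rewrite leq_mul2l f_small orbT.
  have : 12 * (q * h * f) <= 12 * q * (48 * q * h * f) by nia.
  by nia.
have [/(_ hP)[x xact xQ] _] := Q_res P' W P0.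
move: xact; rewrite inE -/Z => /andP[xZ x_new].
have xNP' : x \notin P'.
  apply: contraL x_new => xP'; rewrite (_ : _ :\: _ = set0).
    rewrite cards0 -ltnNge; apply: leq_trans K_le.
    by rewrite KE !muln_gt0 q_gt0 h_gt0.
  apply/eqP; rewrite setD_eq0; apply/subsetP => y; rewrite inE => xy.
  by rewrite inE; apply/orP; left; apply/nbsP; exists x.
suff /maxP' : ok (x |: P') by rewrite /= cardsU1 xNP' ltnn.
apply/and3P; split.
- exact: subset_trans sPP' (subsetUr _ _).
- by rewrite subUset sP' andbT sub1set in_setU in_setI xZ xQ orbT.
have -> : #|(x |: P') :\: P| = #|P' :\: P|.+1.
  have xNP : x \notin P by apply: contra xNP'; apply/subsetP.
  have xPx : [set x] :\: P = [set x].
    by apply/setP => y; rewrite !inE andbC; case: eqP => //= ->; rewrite xNP.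
  by rewrite setDUl xPx cardsU1 in_setD (negPf xNP') andbF.
rewrite nbsU nbs1; set X := (_ :|: _) :\: W.
have sZ'X : Z' \subset X by apply: setSD; apply: subsetUr.
rewrite -(cardsID Z' X) (setIidPr sZ'X) mulnS -addnA addnC leq_add //.
apply: leq_trans x_new _; apply: subset_leq_card; apply/subsetP => y.
by rewrite !inE; case: (y \in W); case: (y \in nbs e P'); case: (e x y).
Qed.

(** The neighbourhood grows by a factor 1 + 1 / (12 q) in each step, so more than 12 q
    lam steps are impossible before it exceeds three quarters of the graph. *)
Lemma grow_big A : A != set0 -> K * (#|A| + #|W|) <= #|nbs e A :\: W| ->
  forall lam, #|T| <= 2 ^ lam -> exists P,
    [/\ P != set0, P \subset reach Q W A (12 * q * lam),
      K * (#|P| + #|W|) <= #|nbs e P :\: W| & 3 * #|T| < 4 * #|nbs e P :\: W|].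
Proof.
move=> A0 KA lam T_le; set x := 12 * q.
have x_gt0 : 0 < x by rewrite muln_gt0.
have step l : exists P, [/\ P != set0, P \subset reach Q W A l,
    K * (#|P| + #|W|) <= #|nbs e P :\: W| &
    3 * #|T| < 4 * #|nbs e P :\: W| \/ x.+1 ^ l <= x ^ l * #|nbs e P :\: W|].
  elim: l => [|l [P [P0 Pr KP big]]].
    exists A; split => //; right; rewrite !expn0 mul1n; apply: leq_trans KA.
    rewrite muln_gt0 addn_gt0 card_gt0 A0 andbT KE !muln_gt0 q_gt0 h_gt0 //.
  have [Zbig|Zsmall] := ltnP (3 * #|T|) (4 * #|nbs e P :\: W|).
    by exists P; split => //; [apply: subset_trans Pr (reachS _ _ _ _) | left].
  have [P' [sPP' P'r KP' gr]] := grow P0 Pr Zsmall KP.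
  exists P'; split => //.
    by apply: contraNneq P0 => P'0; rewrite P'0 subset0 in sPP'.
  right; case: big => [|le1]; first by rewrite ltnNge Zsmall.
  rewrite -/x in gr; rewrite !expnS.
  apply: leq_trans (_ : x.+1 * (x ^ l * #|nbs e P :\: W|) <= _).
    by rewrite leq_mul2l le1.
  by rewrite mulnCA [x * x ^ l]mulnC -mulnA leq_mul2l gr orbT.
have [P [P0 Pr KP big]] := step (x * lam); exists P; split => //.
case: big => // le1.
have Z_gt0 : 0 < #|nbs e P :\: W|.
  apply: leq_trans KP; rewrite muln_gt0 addn_gt0 card_gt0 P0 andbT.
  by rewrite KE !muln_gt0 q_gt0 h_gt0.
rewrite ltnNge; apply/negP => small.
have : 2 ^ lam * x ^ (x * lam) <= x.+1 ^ (x * lam).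
  rewrite [x ^ (x * lam)]expnM [x.+1 ^ (x * lam)]expnM -expnMn; case: (lam) => // n; rewrite leq_exp2r //.
  exact: growth_doubles.
move/leq_trans/(_ le1); rewrite mulnC leq_pmul2l ?expn_gt0 ?x_gt0 // => le2.
lia.
Qed.

End Growth.

Lemma link_length q lam l w s t : w <= s + t -> s <= (12 * q * lam).+1 ->
  t <= (12 * q * lam).+1 -> l.+1 = w -> l <= 24 * q * lam + 1.
Proof. lia. Qed.

Lemma meeting_size q h z z' u i p p' w m : 0 < q ->
  3 * m < 4 * z -> 3 * m < 4 * z' ->
  48 * q * h * (p + w) <= z -> 48 * q * h * (p' + w) <= z' ->
  z' <= m -> z <= m -> u <= m -> u + i = z + z' -> h * (p + p' + w) <= i.
Proof.
case: q => // q _ bz bz' kz kz' *.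
have : 48 * h * (p + w) <= z by apply: leq_trans kz; rewrite -!mulnA mulSn; lia.
have : 48 * h * (p' + w) <= z' by apply: leq_trans kz'; rewrite -!mulnA mulSn; lia.
lia.
Qed.

Section Link.
Variables (T : finType) (e : rel T).
Implicit Types (A B P Q W Z : {set T}).
Hypothesis sym_e : symmetric e.
Variables (d q h theta K lam : nat).
Hypothesis max_deg : forall x, #|neighbours e x| <= d.
Hypothesis expands : forall S : {set T}, 2 * #|S| <= #|T| -> d * #|S| <= q * edges e S (~: S).
Hypotheses (q_gt0 : 0 < q) (h_gt0 : 0 < h) (KE : K = 48 * q * h).
Hypotheses (K_le : K <= theta) (theta_le : 12 * q * theta <= d).
Hypothesis T_le : #|T| <= 2 ^ lam.

(** Growing from both sides gives P and P' with more than three quarters of the vertices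
    as neighbours each; half of all vertices are then common neighbours, and Q contains
    one. *)
Lemma link (Q W A B : {set T}) : reservoir e theta h Q ->
  A != set0 -> B != set0 -> [disjoint A & Q] -> [disjoint B & Q] -> [disjoint A & B] ->
  K * (#|A| + #|W|) <= #|nbs e A :\: W| -> K * (#|B| + #|W|) <= #|nbs e B :\: W| ->
  exists a b w, [/\ a \in A, b \in B, path e a (rcons w b), uniq w &
    {subset w <= Q :\: W} /\ size w <= 24 * q * lam + 1].
Proof.
move=> Q_res A0 B0 AQ BQ AB KA KB.
have [P [P0 Pr KP bigP]] := grow_big sym_e max_deg expands Q_res q_gt0 h_gt0 KE K_le theta_le A0 KA T_le.
have [P' [P'0 P'r KP' bigP']] := grow_big sym_e max_deg expands Q_res q_gt0 h_gt0 KE K_le theta_le B0 KB T_le.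
have [_ []] := Q_res P P' W P0.
  have -> : common e P P' W = (nbs e P :\: W) :&: (nbs e P' :\: W).
    by apply/setP => y; rewrite !inE; case: (y \in W).
  have := cardsUI (nbs e P :\: W) (nbs e P' :\: W).
  have := max_card (mem ((nbs e P :\: W) :|: (nbs e P' :\: W))).
  have := max_card (mem (nbs e P :\: W)); have := max_card (mem (nbs e P' :\: W)).
  move: bigP bigP' KP KP'; rewrite KE.
  exact: meeting_size.
move=> r; rewrite !inE => /andP[rW /andP[rP rP']] rQ.
set l := 12 * q * lam in Pr P'r.
have rA : r \in reach e Q W A l.+1.
  by rewrite /= !inE rW rQ (subsetP (nbsS e Pr)) ?orbT.
have rB : r \in reach e Q W B l.+1.
  by rewrite /= !inE rW rQ (subsetP (nbsS e P'r)) ?orbT.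
have [a [s [aA ps ls sQ szs]]] := reach_path rA.
have [b [t [bB pt lt tQ szt]]] := reach_path rB.
have ra : r != a by apply: contraTneq rQ => ->; rewrite (disjointFr AQ aA).
have rb : r != b by apply: contraTneq rQ => ->; rewrite (disjointFr BQ bB).
have ab : a != b by apply: contraTneq bB => <-; rewrite (disjointFr AB aA).
have pB : path e r (rev (belast b t)).
  by rewrite -lt rev_path (eq_path (e' := e)) // => x y; apply: sym_e.
have lB : last r (rev (belast b t)) = b.
  by case: (t) lt rb => [/= <-|t0 t' _ _]; rewrite ?eqxx // rev_cons last_rcons.
have pAB : path e a (s ++ rev (belast b t)) by rewrite cat_path ps ls.
have lAB : last a (s ++ rev (belast b t)) = b by rewrite last_cat ls.
case: (shortenP pAB) lAB => p' pp' up' sub lp'.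
case/lastP: p' pp' up' sub lp' => [|w b'] pp' up' sub; first by move=> /= /eqP; rewrite (negPf ab).
rewrite last_rcons => Eb; rewrite {b'}Eb in pp' up' sub *.
have szw : size (rcons w b) <= size s + size t.
  rewrite -[size t](size_belast b) -[size (belast b t)]size_rev -size_cat.
  by apply: uniq_leq_size => //; case/andP: up'.
move: up'; rewrite /= rcons_uniq mem_rcons inE negb_or => /andP[_ /andP[bw uw]].
exists a, b, w; split => //; split; last first.
  by apply: (@link_length q lam _ _ _ _ szw szs szt); rewrite size_rcons.
move=> v vw; have vb : v != b by apply: contraNneq bw => <-.
have: v \in s ++ rev (belast b t) by apply: sub; rewrite mem_rcons inE vw orbT.
rewrite mem_cat mem_rev => /orP[/sQ//|/mem_belast].
by rewrite inE (negPf vb) => /tQ.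
Qed.
End Link.

(** * Joining paths through reservoirs *)

Lemma merge_arith a j : 2 * j.+1 <= a.+1 -> 0 < a - j /\ j <= a - j.
Proof. lia. Qed.

Section Rounds.
Variables (T : finType) (e : rel T) (Term : {set T}) (L : nat).
Implicit Types (A B Q W : {set T}) (p : T * seq T) (ps F S D : seq (T * seq T)).

(** W is the part of the reservoir already spent in the current round; it may be as
    large as L times the number of terminals still available. *)
Definition linkable Q : Prop := forall A B W,
  A \subset Term -> B \subset Term -> A != set0 -> B != set0 -> [disjoint A & B] ->
  #|W| <= L * #|A| -> #|W| <= L * #|B| ->
  exists a b w, [/\ a \in A, b \in B, path e a (rcons w b), uniq w &
    {subset w <= Q :\: W} /\ size w <= L].

Definition end_of p := last p.1 p.2.
Definition terminal_path p := [&& path e p.1 p.2, p.1 \in Term & end_of p \in Term].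
Definition vertices_of ps : seq T := flatten (map (@verts T) ps).
Definition path_family ps := all terminal_path ps && uniq (vertices_of ps).

Lemma vertices_of_cat F S : vertices_of (F ++ S) = vertices_of F ++ vertices_of S.
Proof. by rewrite /vertices_of map_cat flatten_cat. Qed.

Lemma vertices_of_cons p F : vertices_of (p :: F) = verts p ++ vertices_of F.
Proof. by []. Qed.

Lemma perm_vertices_of F S : perm_eq F S -> perm_eq (vertices_of F) (vertices_of S).
Proof. by move=> FS; apply: perm_flatten; apply: perm_map. Qed.

Lemma mem_vertices_of p F x : p \in F -> x \in verts p -> x \in vertices_of F.
Proof. by move=> pF xp; apply/flattenP; exists (verts p) => //; apply: map_f. Qed.

Lemma uniq_map_vertices (g : T * seq T -> T) F : (forall p, g p \in verts p) ->
  uniq (vertices_of F) -> uniq (map g F).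
Proof.
move=> gP; elim: F => // p F IHF; rewrite vertices_of_cons cat_uniq [uniq (map _ _)]/=.
case/and3P=> _ /hasPn pF uF; rewrite IHF // andbT; apply/mapP => -[p' p'F gpp'].
have := pF (g p'); rewrite (mem_vertices_of p'F) // -?gpp' => /(_ isT).
by move/negP; apply; apply: gP.
Qed.

Lemma end_in p : end_of p \in verts p. Proof. exact: mem_last. Qed.
Lemma start_in p : p.1 \in verts p. Proof. exact: mem_head. Qed.

(** F and S hold the paths whose last, respectively first, vertices are still to be
    linked, and D the finished paths. After j links the reservoir has lost at most L j
    vertices, and as 2j does not exceed the size of F0 by more than one, the remaining
    ends are numerous enough for the next link. *)
Lemma merge_step Q F0 S0 D0 j : linkable Q ->
  path_family (F0 ++ S0 ++ D0) -> size F0 = size S0 ->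
  {in vertices_of (F0 ++ S0 ++ D0), forall x, x \notin Q} ->
  2 * j <= (size F0).+1 ->
  exists F S D,
    [/\ size F = size F0 - j, size S = size F0 - j & size D = j + size D0] /\
    [/\ path_family (F ++ S ++ D),
        {subset F ++ S <= F0 ++ S0},
        {in vertices_of (F ++ S ++ D), forall x, x \in vertices_of (F0 ++ S0 ++ D0) \/ x \in Q},
        size (vertices_of (F0 ++ S0 ++ D0)) <= size (vertices_of (F ++ S ++ D)) &
        #|[set x in Q | x \in vertices_of D]| <= L * j].
Proof.
move=> Qlink fam0 szFS NQ; elim: j => [|j IHj] lej.
  exists F0, S0, D0; rewrite subn0; split => //; split => //; first by move=> x ->; left.
  rewrite muln0 leqn0 cards_eq0; apply/eqP/setP => x; rewrite !inE.
  by apply/negP => /andP[xQ xD]; move: xQ; apply/negP/NQ; rewrite !vertices_of_cat !mem_cat xD !orbT.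
have [F [S [D [[szF szS szD] [fam subFS inQ szv WD]]]]] := IHj (ltac:(lia)).
set W := [set x in Q | x \in vertices_of D] in WD.
pose A := [set x in map end_of F]; pose B := [set x in map fst S].
have [/allP goodFSD uFSD] := andP fam.
have uFSD' := uFSD; rewrite !vertices_of_cat catA cat_uniq in uFSD'.
have [uFS _ _] := and3P uFSD'; rewrite cat_uniq in uFS; have [uF /hasPn FS uS] := and3P uFS.
have cardA : #|A| = size F.
  rewrite -(size_map end_of) cardsE; apply/card_uniqP.
  exact: uniq_map_vertices end_in uF.
have cardB : #|B| = size S.
  rewrite -(size_map fst) cardsE; apply/card_uniqP.
  exact: uniq_map_vertices start_in uS.
have sA : A \subset Term.
  apply/subsetP => x; rewrite inE => /mapP[p pF ->].
  by have /and3P[] := goodFSD p (ltac:(by rewrite mem_cat pF)).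
have sB : B \subset Term.
  apply/subsetP => x; rewrite inE => /mapP[p pS ->].
  by have /and3P[] := goodFSD p (ltac:(by rewrite !mem_cat pS orbT)).
have dAB : [disjoint A & B].
  rewrite -setI_eq0; apply/eqP/setP => x; rewrite !inE; apply/negP => /andP[/mapP[p pF xp] /mapP[p' p'S xp']].
  have := FS x; rewrite xp' (mem_vertices_of p'S) ?start_in // => /(_ isT).
  by move/negP; apply; rewrite /= -xp' xp; apply: mem_vertices_of pF (end_in p).
have [aj_gt0 le_jaj] := merge_arith lej.
have [||||a [b [w [aA bB abw uw [wQ szw]]]]] := Qlink A B W sA sB _ _ dAB.
- by rewrite -card_gt0 cardA szF.
- by rewrite -card_gt0 cardB szS.
- by apply: leq_trans WD _; rewrite cardA szF leq_mul2l le_jaj orbT.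
- by apply: leq_trans WD _; rewrite cardB szS leq_mul2l le_jaj orbT.
move: aA bB; rewrite !inE => /mapP[p pF def_a] /mapP[p' p'S def_b].
pose F' := rem p F; pose S' := rem p' S; pose np := (p.1, p.2 ++ w ++ verts p').
have permF : perm_eq F (p :: F') by apply: perm_to_rem.
have permS : perm_eq S (p' :: S') by apply: perm_to_rem.
have perm0 : perm_eq (vertices_of (F ++ S ++ D)) (verts p ++ verts p' ++ vertices_of (F' ++ S' ++ D)).
  rewrite -!vertices_of_cons; apply: perm_vertices_of.
  apply: perm_trans (perm_cat permF (perm_cat permS (perm_refl D))) _.
  by rewrite /= perm_cons -cat1s -[p' :: F' ++ _]cat1s perm_catCA.
have perm1 : perm_eq (vertices_of (F' ++ S' ++ np :: D)) (w ++ vertices_of (F ++ S ++ D)).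
  apply: perm_trans (_ : perm_eq _ (w ++ verts p ++ verts p' ++ vertices_of (F' ++ S' ++ D))) _; last first.
    by rewrite perm_cat2l perm_sym.
  apply: perm_trans (_ : perm_eq _ (vertices_of (np :: F' ++ S' ++ D))) _.
    by apply: perm_vertices_of; rewrite catA -(cat1s np D) perm_catCA -catA.
  rewrite vertices_of_cons (_ : verts np = verts p ++ w ++ verts p') //.
  by rewrite -!catA perm_catCA.
exists F', S', (np :: D); split.
  by rewrite !size_rem //= szD szF szS !subnS.
have subF' : {subset F' <= F} := @mem_rem _ p F.
have subS' : {subset S' <= S} := @mem_rem _ p' S.
have wD x : x \in w -> x \notin vertices_of (F ++ S ++ D).
  move=> /wQ; rewrite inE => /andP[xW xQ]; apply/negP => xv.
  have NQ' : x \notin vertices_of (F ++ S).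
    apply: contraL xQ => /flattenP[_ /mapP[z zFS ->] xz].
    apply: NQ; rewrite catA vertices_of_cat mem_cat (mem_vertices_of (subFS z zFS) xz) //.
  move: xv; rewrite catA vertices_of_cat mem_cat (negPf NQ') /= => xD.
  by move: xW; rewrite inE xQ xD.
split.
- apply/andP; split.
    apply/allP => z; rewrite !mem_cat inE => /or4P[/subF' zF|/subS' zS|/eqP->|zD].
    + by apply: goodFSD; rewrite mem_cat zF.
    + by apply: goodFSD; rewrite !mem_cat zS orbT.
    + have /and3P[pp p1 _] : terminal_path p by apply: goodFSD; rewrite mem_cat pF.
      have /and3P[pp' _ p'2] : terminal_path p' by apply: goodFSD; rewrite !mem_cat p'S orbT.
      rewrite /terminal_path /np /= p1 /end_of /= !last_cat /= p'2 andbT.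
      move: abw; rewrite rcons_path def_a def_b => /andP[abw lw].
      by rewrite !cat_path pp abw /= lw pp'.
    + by apply: goodFSD; rewrite !mem_cat zD !orbT.
  rewrite (perm_uniq perm1) cat_uniq uw uFSD andbT; apply/hasPn => x xv.
  by apply/negP => /wD/negP.
- move=> z; rewrite mem_cat => /orP[/subF'|/subS'] zz; apply: subFS; rewrite mem_cat zz ?orbT //.
- move=> x; rewrite (perm_mem perm1) mem_cat => /orP[/wQ|/inQ//].
  by rewrite inE => /andP[_]; right.
- by rewrite (perm_size perm1) size_cat; apply: leq_trans szv _; apply: leq_addl.
rewrite mulnS addnC; apply: leq_trans (_ : #|W :|: [set x in w]| <= _).
  apply: subset_leq_card; apply/subsetP => x; rewrite in_setU !in_set => /andP[xQ].
  have NQp z : z \in F ++ S -> x \in verts z -> false.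
    move=> zFS xz; have: x \notin Q; last by rewrite xQ.
    by apply: NQ; rewrite catA vertices_of_cat mem_cat (mem_vertices_of (subFS z zFS) xz).
  rewrite vertices_of_cons mem_cat xQ /= => /orP[|->//].
  rewrite -[x \in verts _]/(x \in verts p ++ w ++ verts p') !mem_cat => /or3P[xp|->|xp].
  - by have := NQp p (ltac:(by rewrite mem_cat pF)) xp.
  - by rewrite orbT.
  - by have := NQp p' (ltac:(by rewrite mem_cat p'S orbT)) xp.
apply: leq_trans (leq_card_setU _ _) _; apply: leq_add => //.
by rewrite cardsE; apply: leq_trans (card_size _) _.
Qed.

(** Half of the paths serve as F and half as S in [merge_step], and half of the possible
    links are made, which removes about a quarter of the paths. *)
Lemma merge_round Q ps : linkable Q -> path_family ps -> 0 < size ps ->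
  {in vertices_of ps, forall x, x \notin Q} ->
  exists ps', [/\ path_family ps', 0 < size ps', 4 * (size ps').-1 <= 3 * (size ps).-1,
     {in vertices_of ps', forall x, x \in vertices_of ps \/ x \in Q} &
     size (vertices_of ps) <= size (vertices_of ps')].
Proof.
move=> Qlink fam ps_gt0 NQ; pose a := (size ps)./2.
pose F0 := take a ps; pose S0 := take a (drop a ps); pose D0 := drop a (drop a ps).
have psE : ps = F0 ++ S0 ++ D0 by rewrite !cat_take_drop.
have szF0 : size F0 = a by rewrite size_takel /a; lia.
have szS0 : size S0 = a by rewrite size_takel ?size_drop /a; lia.
have szD0 : size D0 = size ps - a - a by rewrite !size_drop.
have [|||F [S [D [[szF szS szD] [fam' _ inQ szv _]]]]] :=
  @merge_step Q F0 S0 D0 (uphalf a) Qlink _ _ _ (ltac:(rewrite szF0; lia)).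
- by rewrite -psE.
- by rewrite szF0.
- by rewrite -psE.
exists (F ++ S ++ D); rewrite psE; split => //.
  by rewrite !size_cat; lia.
by rewrite -psE !size_cat; move: ps_gt0; rewrite /a in szF0 szF szS szD szD0 *; lia.
Qed.

(** The counts are those of the superfluous paths, since the last path stays. *)
Lemma merge_rounds (Q : nat -> {set T}) r ps :
  (forall i, i < r -> linkable (Q i)) -> {in gtn r &, forall i j, i != j -> [disjoint Q i & Q j]} ->
  path_family ps -> 0 < size ps ->
  (forall i, i < r -> {in vertices_of ps, forall x, x \notin Q i}) ->
  exists ps', [/\ path_family ps', 0 < size ps', 4 ^ r * (size ps').-1 <= 3 ^ r * (size ps).-1,
     {in vertices_of ps', forall x, x \in vertices_of ps \/ exists2 i, i < r & x \in Q i} &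
     size (vertices_of ps) <= size (vertices_of ps')].
Proof.
elim: r => [|r IHr] Qlink dQ fam ps_gt0 NQ.
  by exists ps; split => // x ->; left.
have [|i j ir jr|//|//|i ir|ps1 [fam1 ps1_gt0 sz1 in1 szv1]] := IHr.
- by move=> i ir; apply: Qlink; exact: ltnW.
- by apply: dQ; rewrite !inE in ir jr *; exact: ltnW.
- by apply: NQ; exact: ltnW.
have [x|ps2 [fam2 ps2_gt0 sz2 in2 szv2]] := @merge_round (Q r) ps1 (Qlink r (ltnSn r)) fam1 ps1_gt0.
  case/in1 => [|[i ir xQi]]; first exact: NQ.
  have := dQ i r; rewrite !inE ltnS (ltnW ir) ltnSn (ltn_eqF ir) => /(_ isT isT isT).
  by move=> /disjointFr/(_ xQi) ->.
exists ps2; split => //.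
- rewrite !expnS; apply: leq_trans (_ : 3 * (4 ^ r * (size ps1).-1) <= _).
    by rewrite [4 * _]mulnC -mulnA [leqRHS]mulnCA leq_mul2l sz2 orbT.
  by rewrite -mulnA leq_mul2l sz1 orbT.
- move=> x /in2[/in1[?|[i ir xQ]]|xQ]; [by left| |by right; exists r].
  by right; exists i => //; exact: ltnW.
- exact: leq_trans szv2.
Qed.

Lemma close_cycle Q p : linkable Q -> terminal_path p -> uniq (verts p) ->
  {in verts p, forall x, x \notin Q} -> 2 < size (verts p) ->
  exists c, graph_cycle e c /\ {subset verts p <= c}.
Proof.
move=> Qlink /and3P[pp p1 p2] up NQ sz3.
have ends : end_of p != p.1.
  apply/eqP => E; move: up sz3; rewrite /verts /=; case: (p) E => x s /=.
  rewrite /end_of /=; case/lastP: s => // s y; rewrite last_rcons => ->.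
  by rewrite mem_rcons mem_head.
have [|||||||a [b [w [aA bB abw uw [wQ _]]]]] := Qlink [set end_of p] [set p.1] set0.
- by rewrite sub1set.
- by rewrite sub1set.
- by apply/set0Pn; exists (end_of p); rewrite inE.
- by apply/set0Pn; exists p.1; rewrite inE.
- by rewrite disjoints1 inE.
- by rewrite cards0.
- by rewrite cards0.
move: aA bB; rewrite !inE => /eqP def_a /eqP def_b; rewrite {a}def_a {b}def_b in abw.
exists (verts p ++ w); split; last by move=> x; rewrite mem_cat => ->.
split; first by rewrite size_cat; apply: leq_trans sz3 (leq_addr _ _).
apply/andP; split.
  by rewrite /verts /= rcons_cat cat_path pp.
rewrite cat_uniq up uw andbT; apply/hasPn => x /wQ; rewrite inE => /andP[_ xQ].
by apply: contraL xQ => /NQ.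
Qed.
End Rounds.

(** * Disjoint paths through layers *)

Lemma cut_arith_shift k t m al lk s :
  (t + 16) * (al * (k * (t + 16))) <= (t + 16) * (al * (2 * k) + 2 * m + (lk + s) * (k * (t + 16)).+1) ->
  (t + 16) * ((t + 16) * (k * lk)) <= (t + 16) * (4 * m) -> (t + 16) * lk <= 4 * m ->
  (t + 14) * ((t + 16) * m) <= (t + 14) * ((t + 16) * (k * al) + 7 * m) ->
  (t + 16) * ((t + 1) * m) <= (t + 16) * ((k * (t + 16)).+1 * s).
Proof.
move=> H1 H2 H3 H4.
have {}H1 : (t + 16) * ((t + 16) * (k * al)) <= 2 * ((t + 16) * (k * al)) + (t + 16) * (2 * m) +
  (t + 16) * ((t + 16) * (k * lk)) + (t + 16) * lk + (t + 16) * ((k * (t + 16)).+1 * s) by lia.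
move: H1 H2 H3 H4; set b := (t + 16) * (k * al); set c := (t + 16) * ((t + 16) * (k * lk)).
set g := _ * (_.+1 * s); set u := _ * lk => H1 H2 H3 H4.
lia.
Qed.

Lemma cut_arith k lam m al lk s : 15 < lam ->
  lam * (al * (k * lam)) <= lam * (al * (2 * k) + 2 * m + (lk + s) * (k * lam).+1) ->
  lam * (lam * (k * lk)) <= lam * (4 * m) -> lam * lk <= 4 * m ->
  (lam - 2) * (lam * m) <= (lam - 2) * (lam * (k * al) + 7 * m) ->
  lam * ((lam - 15) * m) <= lam * ((k * lam).+1 * s).
Proof.
move=> lam_gt15; have [t ->] : exists t, lam = t + 16 by exists (lam - 16); lia.
have E2 : t + 16 - 2 = t + 14 by lia.
have E15 : t + 16 - 15 = t + 1 by lia.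
by rewrite E2 E15; exact: cut_arith_shift.
Qed.

Section Packing.
Variables (T : finType) (e : rel T) (d k lam : nat) (U : {set T}) (f : T -> nat).
Hypothesis sym_e : symmetric e.
Hypothesis max_deg : forall x, #|neighbours e x| <= d.
Hypothesis f_lt : forall x, f x < k.
Hypothesis k_ge2 : 1 < k.
Let m := #|T|.
Let V c : {set T} := [set x in U | f x == c].
Let deg x := #|neighbours e x :&: U|.
Let low : {set T} := [set x in U | d < lam * (d - deg x)].

Hypothesis balanced : forall v c, c < k ->
  k * lam * (k * #|neighbours e v :&: V c|) <= k * lam * deg v + d /\
  k * lam * deg v <= k * lam * (k * #|neighbours e v :&: V c|) + d.
Hypothesis balanced_U : k * lam * #|U| <= k * lam * (k * #|V 0|) + 2 * m.
Hypothesis balanced_low : forall c, c < k ->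
  k * lam * (k * #|low :&: V c|) <= k * lam * #|low| + 2 * m.
Hypothesis low_small : lam * #|low| <= 2 * m.
Hypothesis U_big : lam * m <= lam * #|U| + m.
Hypotheses (d_gt0 : 0 < d) (lam_gt0 : 0 < lam).

(** Directed from each layer to the next, so that directed paths from the first layer to
    the last contain one vertex of every layer. *)
Definition layer_edge : rel T := fun u v => [&& e u v, u \in U, v \in U & f v == (f u).+1].
Let out u := #|[set v | layer_edge u v]|.
Let inn v := #|[set u | layer_edge u v]|.
Let A := V 0 :\: low.
Let B := V k.-1 :\: low.

Lemma out_layer u : u \in U -> out u = #|neighbours e u :&: V (f u).+1|.
Proof.
move=> uU; apply: eq_card => v; rewrite !inE /layer_edge uU /=.
by case: (e u v).
Qed.

Lemma inn_layer v : v \in U -> 0 < f v -> inn v = #|neighbours e v :&: V (f v).-1|.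
Proof.
move=> vU fv; apply: eq_card => u; rewrite !inE /layer_edge vU /= sym_e.
case: (e v u) => //=; case: (u \in U) => //=.
by rewrite -{1}(prednK fv) eqSS eq_sym.
Qed.

Lemma inn0 v : f v = 0 -> inn v = 0.
Proof.
move=> fv; apply/eqP; rewrite cards_eq0; apply/eqP/setP => u.
by rewrite !inE /layer_edge fv !andbF.
Qed.

Lemma inn_notU v : v \notin U -> inn v = 0.
Proof.
move=> vU; apply/eqP; rewrite cards_eq0; apply/eqP/setP => u.
by rewrite !inE /layer_edge (negPf vU) !andbF.
Qed.

Lemma deg_le v : deg v <= d.
Proof. by apply: leq_trans (max_deg v); apply/subset_leq_card/subsetIl. Qed.

(** The factor (0 < f v) records that nothing enters the first layer. *)
Lemma inn_bound v : k * lam * (k * inn v) <= (0 < f v) * (k * lam * d + d).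
Proof.
have [fv0|fv] := posnP (f v); first by rewrite inn0 // !muln0.
have [vU|vU] := boolP (v \in U); last by rewrite inn_notU // !muln0.
rewrite mul1n inn_layer //; have [|le1 _] := balanced v (c := (f v).-1).
  by apply: leq_ltn_trans (leq_pred _) (f_lt v).
by apply: leq_trans le1 _; rewrite leq_add2r leq_mul2l deg_le orbT.
Qed.

Lemma inn_out v : v \in U -> v \notin B ->
  k * lam * (k * inn v) <= (0 < f v) * (k * lam * (k * out v)) + 2 * d +
     (v \in low :&: V k.-1) * (k * lam * d + d).
Proof.
move=> vU vB; have [fv0|fv] := posnP (f v); first by rewrite inn0 // !muln0.
have [fvk|fvk] := eqVneq (f v) k.-1.
  apply: leq_trans (inn_bound v) _; rewrite fv mul1n.
  have -> : v \in low :&: V k.-1.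
    by move: vB; rewrite in_setI in_setD [v \in V _]inE vU fvk eqxx !andbT negbK.
  by rewrite !mul1n leq_addl.
rewrite mul1n inn_layer // out_layer //.
have [|le1 _] := balanced v (c := (f v).-1).
  by apply: leq_ltn_trans (leq_pred _) (f_lt v).
have [|_ le2] := balanced v (c := (f v).+1).
  by have := f_lt v; move/eqP: fvk; lia.
apply: leq_trans le1 _; lia.
Qed.

Lemma out_big u : u \in A -> k * lam * d <= k * lam * (k * out u) + 2 * (k * d).
Proof.
rewrite in_setD => /andP[ulow uV]; have:= uV; rewrite inE => /andP[uU /eqP fu].
move: ulow; rewrite inE uU /= -leqNgt => ldeg.
rewrite out_layer // fu; have [|_ le2] := balanced u (c := 1); first exact: k_ge2.
have dd := deg_le u.
have : k * (lam * (d - deg u)) <= k * d by rewrite leq_mul2l ldeg orbT.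
move: le2; set g := deg u in dd ldeg *; set o := #|_|; move=> le2 kl.
have : k * lam * d <= k * lam * g + k * d by nia.
by nia.
Qed.

(** Let X be what is reached from A without meeting S. Edges starting in X end in X or
    S. Inside X in-degrees and out-degrees nearly agree, except that the first layer has
    no incoming edges; so the edges out of A are matched by edges into S, and S has
    nearly as many vertices as A. *)
Lemma cut_bound S : separates layer_edge A B S -> (lam - 15) * m <= (k * lam).+1 * #|S|.
Proof.
move=> sepS.
pose r u v := layer_edge u v && (v \notin S).
pose X : {set T} := [set v | [exists a in A :\: S, connect r a v]].
have XP v : v \in X -> exists a p, [/\ a \in A :\: S, path r a p & v = last a p].
  by rewrite inE => /exists_inP[a aA /connectP[p pp ->]]; exists a, p.
have rS u p : u \notin S -> path r u p -> ~~ has (mem S) (u :: p).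
  elim: p u => [|v p IHp] u uS /=; first by rewrite orbF.
  by case/andP=> /andP[_ vS] /(IHp v vS); rewrite (negPf uS).
have rE u p : path r u p -> path layer_edge u p by apply: sub_path => x y /andP[].
have XU v : v \in X -> v \in U.
  case/XP => a [p [aA pp ->]]; case/lastP: p pp => [_|p x].
    by move: aA; rewrite !inE => /andP[_ /andP[_ /andP[]]].
  by rewrite last_rcons rcons_path => /andP[_ /andP[/and4P[]]].
have XB v : v \in X -> v \notin B.
  case/XP => a [p [aA pp ->]]; apply/negP => lB.
  have [aS aA'] := setDP aA.
  by have:= sepS a p (rE _ _ pp) aS lB; apply/negP; apply: rS.
have Xout u v : u \in X -> layer_edge u v -> v \in X :|: S.
  rewrite inE => /exists_inP[a aA au] uv; rewrite inE orbC.
  case vS: (v \in S) => //=; rewrite inE; apply/exists_inP; exists a => //.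
  by apply: connect_trans au _; apply: connect1; rewrite /r uv vS.
have count : \sum_(u in X) out u <= \sum_(v in X) inn v + \sum_(v in S) inn v.
  have -> : \sum_(u in X) out u = \sum_v \sum_(u in X) layer_edge u v.
    rewrite exchange_big; apply: eq_bigr => u _; rewrite /out -sum1_card big_mkcond.
    by apply: eq_bigr => v _; rewrite inE; case: (layer_edge u v).
  have innE v : \sum_(u in X) layer_edge u v <= inn v.
    rewrite /inn -sum1_card big_mkcond [leqRHS]big_mkcond; apply: leq_sum => u _.
    by rewrite inE; case: (u \in X); case: (layer_edge u v).
  rewrite -![\sum_(v in _) inn v]sum_mul_mem -big_split; apply: leq_sum => v _.
  have [vXS|vXS] := boolP (v \in X :|: S).
    apply: leq_trans (innE v) _; move: vXS; rewrite in_setU.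
    by case: (v \in X); case: (v \in S) => //; rewrite ?mul1n ?mul0n ?addn0 ?leq_addr.
  rewrite big1 // => u uX; apply/eqP; rewrite eqb0.
  by apply: contra vXS; apply: Xout.
have inX : k * lam * (k * \sum_(v in X) inn v) <=
    k * lam * (k * \sum_(v in X) (0 < f v) * out v) + 2 * d * m +
    #|low :&: V k.-1| * (k * lam * d + d).
  rewrite !big_distrr /=; apply: leq_trans (_ : \sum_(v in X)
    ((0 < f v) * (k * lam * (k * out v)) + 2 * d +
     (v \in low :&: V k.-1) * (k * lam * d + d)) <= _).
    by apply: leq_sum => v vX; apply: inn_out; [exact: XU | exact: XB].
  rewrite big_split /= big_split /=; apply: leq_add; first apply: leq_add.
  - by apply: leq_sum => v _; rewrite !mulnA; case: (0 < f v); rewrite ?muln0 ?mul0n ?muln1 ?mul1n.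
  - by rewrite sum_nat_const [leqLHS]mulnC leq_mul2l max_card orbT.
  rewrite -big_distrl /= leq_mul2r; apply/orP; right.
  rewrite -sum1_card big_mkcond [leqRHS]big_mkcond; apply: leq_sum => v _.
  by case: (v \in X); case: (v \in _ :&: _).
have inS : k * lam * (k * \sum_(v in S) inn v) <= #|S :\: A| * (k * lam * d + d).
  rewrite !big_distrr /= -sum_nat_const [leqLHS](big_setID A) /=.
  rewrite big1 => [|v]; last first.
    by rewrite !inE => /andP[_ /andP[_ /andP[_ /eqP fv]]]; rewrite inn0 ?muln0.
  rewrite add0n; apply: leq_sum => v _; apply: leq_trans (inn_bound v) _.
  by case: (0 < f v); rewrite ?mul1n ?mul0n.
(* All vertices of A outside S lie in X, and their out-degree is about d / k. *)
have outX : #|A :\: S| * (k * lam * d) <=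
    k * lam * (k * \sum_(v in X) (f v == 0) * out v) + #|A :\: S| * (2 * (k * d)).
  have sAX : A :\: S \subset X.
    by apply/subsetP => a aA; rewrite inE; apply/exists_inP; exists a.
  apply: leq_trans (_ : k * lam * (k * \sum_(v in A :\: S) (f v == 0) * out v) +
                        #|A :\: S| * (2 * (k * d)) <= _); last first.
    rewrite leq_add2r leq_mul2l leq_mul2l [leqRHS](big_setID (A :\: S)) /=.
    by rewrite (setIidPr sAX) leq_addr !orbT.
  rewrite big_distrr big_distrr -!sum_nat_const -big_split /=.
  apply: leq_sum => v /setDP[vA _]; have:= vA; rewrite in_setD => /andP[_].
  rewrite inE => /andP[_ /eqP fv]; rewrite fv eqxx mul1n; exact: out_big.
have splitX : \sum_(u in X) out u =
    \sum_(v in X) (0 < f v) * out v + \sum_(v in X) (f v == 0) * out v.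
  by rewrite -big_split; apply: eq_bigr => v _; case: (f v) => [|?] /=; rewrite ?mul1n ?mul0n ?addn0.
have main : #|A :\: S| * (k * lam * d) <= #|A :\: S| * (2 * (k * d)) + 2 * d * m +
   (#|low :&: V k.-1| + #|S :\: A|) * (k * lam * d + d).
  move: count; rewrite splitX -(leq_pmul2l (_ : 0 < k * lam * k)); last first.
    by rewrite !muln_gt0 lam_gt0 (ltnW k_ge2).
  move: inX inS outX; rewrite -!mulnA.
  move: (\sum_(v in X) (0 < f v) * out v) (\sum_(v in X) (f v == 0) * out v).
  move: (\sum_(v in X) inn v) (\sum_(v in S) inn v) => a b o p.
  rewrite !mulnA mulnDl !mulnDr; lia.
have cA := cardsID S A; have cS := cardsID A S; have cV := cardsID low (V 0).
rewrite setIC in cV; rewrite [S :&: A]setIC in cS; rewrite -/A in cV.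
have lowk := balanced_low (c := k.-1) (ltac:(lia)).
have low0 := balanced_low (c := 0) (ltac:(lia)).
move: main lowk low0 balanced_U low_small U_big; rewrite -/m.
move: #|A :\: S| #|A :&: S| #|S :\: A| #|low :&: V k.-1| #|low :&: V 0| #|A| #|S| #|V 0| #|low| #|U| cA cS cV.
move=> a s0 s1 lk l0 al s v0 l u cA cS cV main hlk hl0 hU hl hUm.
have main1 : a * (k * lam) <= a * (2 * k) + 2 * m + (lk + s1) * (k * lam).+1.
  by rewrite -(leq_pmul2l d_gt0); move: main; lia.
have main2 : al * (k * lam) <= al * (2 * k) + 2 * m + (lk + s) * (k * lam).+1.
  by rewrite -cA -cS; move: main1; rewrite !mulnDl !mulnS; lia.
have kl : k * (lam * l) <= k * (2 * m) by rewrite leq_mul2l hl orbT.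
have low_le x : k * lam * (k * x) <= k * lam * l + 2 * m -> lam * (k * x) <= 4 * m.
  move=> le1; rewrite -(leq_pmul2l (ltnW k_ge2)); move: le1 kl.
  have : 2 * m <= k * m by rewrite leq_mul2r k_ge2 orbT.
  lia.
have {}hlk := low_le _ hlk; have {}hl0 := low_le _ hl0.
have hv0 : lam * m <= lam * (k * v0) + 3 * m.
  rewrite -(leq_pmul2l (ltnW k_ge2)).
  have : k * (lam * m) <= k * (lam * u + m) by rewrite leq_mul2l hUm orbT.
  have : 2 * m <= k * m by rewrite leq_mul2r k_ge2 orbT.
  by move: hU; lia.
have hal : lam * m <= lam * (k * al) + 7 * m by rewrite -cV !mulnDr in hv0; lia.
have [lam_small|lam_big] := leqP lam 15.
  by move: (lam_small); rewrite -subn_eq0 => /eqP->.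
rewrite -(leq_pmul2l lam_gt0).
have main3 : lam * (al * (k * lam)) <=
    lam * (al * (2 * k) + 2 * m + (lk + s) * (k * lam).+1) by rewrite leq_mul2l main2 orbT.
have hlk2 : lam * (lam * (k * lk)) <= lam * (4 * m) by rewrite leq_mul2l hlk orbT.
have hlk3 : lam * lk <= 4 * m.
  by apply: leq_trans hlk; rewrite leq_mul2l leq_pmull ?orbT // ltnW.
have : (lam - 2) * (lam * m) <= (lam - 2) * (lam * (k * al) + 7 * m) by rewrite leq_mul2l hal orbT.
exact: cut_arith lam_big main3 hlk2 hlk3.
Qed.

(** Menger's theorem in the layer graph; [cut_bound] bounds every separator from below. *)
Lemma layered_paths n : n * (k * lam) <= (lam - 16) * m -> 16 < lam ->
  exists F : 'I_n -> T * seq T, forall i,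
    [/\ path e (F i).1 (F i).2, (F i).1 \in V 0 :\: low, last (F i).1 (F i).2 \in V k.-1 :\: low,
        uniq (verts (F i)) & size (verts (F i)) = k] /\
    {subset verts (F i) <= U} /\
    forall j v, v \in verts (F i) -> v \in verts (F j) -> i = j.
Proof.
move=> n_le lam_gt16.
have [S sepS|F [jF dF]] := @menger T layer_edge A B n.
  rewrite leqNgt; apply/negP => ltS; have := cut_bound sepS.
  have : #|S| * (k * lam) <= n.-1 * (k * lam).
    by rewrite leq_mul2r; apply/orP; right; case: (n) ltS.
  have : 0 < k * lam by rewrite muln_gt0 lam_gt0 ltnW.
  have := max_card S; rewrite -/m mulSn [k * lam * _]mulnC.
  case: (n) ltS n_le => // n' _ /=; rewrite mulSn.
  rewrite (_ : lam - 15 = (lam - 16).+1) ?mulSn; last lia.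
  by move: (_ * m) (n' * _) (#|S| * _) => *; lia.
exists F => i; have [pF FA FB uF] := jF i.
have path_layer u p : path layer_edge u p ->
    f (last u p) = f u + size p /\ {subset p <= U}.
  elim: p u => [|v p IHp] u /=; first by rewrite addn0.
  case/andP=> /and4P[_ _ vU /eqP fv] /IHp[-> sp]; split; first by rewrite fv addSnnS.
  by move=> x; rewrite inE => /orP[/eqP->//|/sp].
have [fl sU] := path_layer _ _ pF; split; last split.
- split => //; first by apply: sub_path pF => x y /and4P[].
  move: FA FB; rewrite !inE => /andP[_ /andP[_ /eqP fA]] /andP[_ /andP[_ /eqP fB]].
  by move: fl; rewrite fA fB add0n /= => <-; rewrite prednK // ltnW.
- move=> x; rewrite inE => /orP[/eqP->|/sU//].
  by move: FA; rewrite !inE => /andP[_ /andP[]].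
exact: dF.
Qed.

End Packing.

(** * Balanced colourings and linkable reservoirs *)

Lemma upper_arith k lam s x D : 0 < k ->
  k ^ 2 * lam * (k * x) <= k ^ 2 * lam * s + D ->
  k * lam * (k * x) <= k * lam * s + D.
Proof.
move=> k_gt0 le1; rewrite -(leq_pmul2l k_gt0) mulnDr.
apply: leq_trans (_ : k ^ 2 * lam * s + D <= _); first by rewrite !mulnA mulnn -!mulnA in le1 *.
by rewrite !mulnA mulnn leq_add2l leq_pmull.
Qed.

Lemma lower_arith k lam s x D : 0 < k ->
  k ^ 2 * lam * (k * s) <= k ^ 2 * lam * (k * x) + k.-1 * (k ^ 2 * lam * s + D) ->
  k * lam * s <= k * lam * (k * x) + D.
Proof.
case: k => // k _ /=; rewrite -mulnn => le1.
have {}le1 : k.+1 * (k.+1 * lam * s) <= k.+1 * (k.+1 * lam * (k.+1 * x)) + k * D by lia.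
rewrite -(leq_pmul2l (ltn0Sn k)) mulnDr; apply: leq_trans le1 _.
by rewrite leq_add2l leq_mul2r leqnSn orbT.
Qed.

Section TwoSided.
Variables (R : realType) (T : finType).

Lemma sum_colour_card k (f : {ffun T -> 'I_k}) (S : {set T}) :
  \sum_c #|S :&: [set x | f x == c]| = #|S|.
Proof.
rewrite -sum1_card (partition_big f predT) //=; apply: eq_bigr => c _.
by rewrite -sum1_card; apply: eq_bigl => x; rewrite !inE.
Qed.

(** The lower bound follows from the upper one: whatever a class lacks, the other k - 1
    classes of the same set have in excess. *)
Lemma balanced_colouring (I : finType) (S : I -> {set T}) (D : I -> nat) (k lam D0 : nat) :
  (0 < k)%N -> (0 < lam)%N -> (#|I| * k < 2 ^ (3 * lam))%N ->
  (forall i, #|S i| <= D i)%N -> (forall i, D0 <= D i)%N ->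
  (27 * k ^ 5 * lam ^ 3 <= D0)%N ->
  exists f : {ffun T -> 'I_k}, forall i c,
    (k * lam * (k * #|S i :&: [set x | f x == c]|) <= k * lam * #|S i| + D i /\
     k * lam * #|S i| <= k * lam * (k * #|S i :&: [set x | f x == c]|) + D i)%N.
Proof.
move=> k_gt0 lam_gt0 Ik SD D0D D0_ge.
have [f fP] := colouring_upper R k_gt0 lam_gt0 Ik SD D0D D0_ge.
exists f => i c; have up := fP i; set X := fun c => #|S i :&: [set x | f x == c]| in up *.
have sumX : (k ^ 2 * lam * (k * #|S i|) <=
    k ^ 2 * lam * (k * X c) + k.-1 * (k ^ 2 * lam * #|S i| + D i))%N.
  rewrite -{1}(sum_colour_card f (S i)) (bigD1 c) //= !mulnDr leq_add2l.
  rewrite !big_distrr /=; apply: leq_trans (_ : \sum_(j < k | j != c) (k ^ 2 * lam * #|S i| + D i) <= _)%N.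
    by apply: leq_sum => j _; apply: up.
  by rewrite sum_nat_const cardC1 card_ord mulnDr.
split; [exact: upper_arith (up c) | exact: lower_arith sumX].
Qed.
End TwoSided.

Section Linkable.
Variables (T : finType) (e : rel T) (d k : nat) (Term : {set T}).
Hypothesis sym_e : symmetric e.
Hypothesis max_deg : forall x, #|neighbours e x| <= d.

(** Counting the edges between A and N(A): there are at least d / 2 per vertex of A, but
    at most 4 d / k per vertex of N(A). *)
Lemma sparse_expands : 0 < d ->
  (forall a, a \in Term -> d <= 2 * #|neighbours e a|) ->
  (forall v, k * #|neighbours e v :&: Term| <= 4 * d) ->
  forall A : {set T}, A \subset Term -> k * #|A| <= 8 * #|nbs e A|.
Proof.
move=> d_gt0 degT sparse A sAT; rewrite -(leq_pmul2l d_gt0).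
have e1 : d * #|A| <= 2 * edges e A (nbs e A).
  rewrite (edges_nbsE (subxx _)) big_distrr /= mulnC -sum_nat_const.
  by apply: leq_sum => a aA; apply: degT; apply: (subsetP sAT).
have e2 : k * edges e (nbs e A) A <= 4 * d * #|nbs e A|.
  rewrite /edges big_distrr /= mulnC -sum_nat_const; apply: leq_sum => v _.
  by apply: leq_trans (sparse v); rewrite leq_mul2l subset_leq_card ?orbT ?setIS.
rewrite edgesC // in e2.
have : k * (d * #|A|) <= k * (2 * edges e A (nbs e A)) by rewrite leq_mul2l e1 orbT.
by move: e2; lia.
Qed.

Variables (q h theta K lam L : nat).
Hypothesis expands : forall S : {set T}, 2 * #|S| <= #|T| -> d * #|S| <= q * edges e S (~: S).
Hypotheses (q_gt0 : 0 < q) (h_gt0 : 0 < h) (KE : K = 48 * q * h).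
Hypotheses (K_le : K <= theta) (theta_le : 12 * q * theta <= d).
Hypothesis T_le : #|T| <= 2 ^ lam.
Hypothesis Term_expands : forall A : {set T}, A \subset Term -> k * #|A| <= 8 * #|nbs e A|.
Hypotheses (LE : L = 24 * q * lam + 1) (k_big : 8 * (L + K * (1 + L)) <= k).

(** [Term_expands] gives each set of terminals k / 8 times as many neighbours, enough to
    start the growth in [link] even after L vertices per terminal are forbidden. *)
Lemma reservoir_linkable (Q : {set T}) : reservoir e theta h Q -> [disjoint Term & Q] ->
  linkable e Term L Q.
Proof.
move=> Qres TQ A B W sA sB A0 B0 dAB WA WB.
have start (C : {set T}) : C \subset Term -> #|W| <= L * #|C| ->
    K * (#|C| + #|W|) <= #|nbs e C :\: W|.
  move=> sC WC; have := Term_expands sC; have := cardsID W (nbs e C).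
  have : #|nbs e C :&: W| <= #|W| by apply/subset_leq_card/subsetIr.
  have : 8 * (L + K * (1 + L)) * #|C| <= k * #|C| by rewrite leq_mul2r k_big orbT.
  have : K * #|W| <= K * (L * #|C|) by rewrite leq_mul2l WC orbT.
  by nia.
have dQ (C : {set T}) : C \subset Term -> [disjoint C & Q].
  by move=> sC; apply: disjointWl TQ.
have := @link T e sym_e d q h theta K lam max_deg expands q_gt0 h_gt0 KE K_le theta_le T_le
  Q W A B Qres A0 B0 (dQ A sA) (dQ B sB) dAB (start A sA WA) (start B sB WB).
by rewrite LE.
Qed.
End Linkable.

(** * Choice of the parameters *)

Section Numerics.
Variable lam : nat.
Hypothesis lam_big : 99 < lam.

Lemma lam_gt0 : 0 < lam. Proof. exact: leq_trans lam_big. Qed.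

Lemma expn_absorb c i j : c <= lam ^ i -> c * lam ^ j <= lam ^ (i + j).
Proof. by move=> le_c; rewrite expnD leq_mul2r le_c orbT. Qed.

Lemma pow100 i : 100 ^ i <= lam ^ i.
Proof. by case: i => // i; rewrite leq_exp2r. Qed.

Lemma le_million c : c <= 1000 * 1000 -> c <= lam ^ 3.
Proof.
move/leq_trans; apply; apply: leq_trans (pow100 3).
by rewrite !expnS; lia.
Qed.

(** The inverse q of the expansion rate; the number M of reservoirs, in lam ^ 2 blocks
    of 4 lam; the threshold h of the reservoirs; the ratio K and the length L in [link];
    the number k of layers. *)
Let q := lam ^ 5.
Let M := lam ^ 2 * (4 * lam).
Let h := 5 * M * lam.
Let K := 48 * q * h.
Let L := 24 * q * lam + 1.
Let k := lam ^ 18.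

Lemma K_eq : K = 960 * lam ^ 9.
Proof. by rewrite /K /h /M /q; move: lam => x; rewrite !expnS expn0; lia. Qed.

Lemma K_bound : K * (12 * q) <= lam ^ 100.
Proof.
rewrite K_eq /q; apply: leq_trans (_ : 11520 * lam ^ 14 <= _).
  rewrite -[lam ^ 14]/(lam ^ (9 + 5)) expnD; move: (lam ^ 9) (lam ^ 5) => a b.
  by rewrite mulnACA leq_mul2r orbC.
apply: leq_trans (@expn_absorb _ 3 _ _) _; first by exact: le_million.
by rewrite leq_exp2l ?(leq_trans _ lam_big).
Qed.

Lemma k_bound : 8 * (L + K * (1 + L)) <= k.
Proof.
have LE : L = 24 * lam ^ 6 + 1 by rewrite /L /q -mulnA -expnSr.
have p6 : 1 <= lam ^ 6 by rewrite expn_gt0 lam_gt0.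
have p9 : 1 <= lam ^ 9 by rewrite expn_gt0 lam_gt0.
apply: leq_trans (_ : 200 * 1000 * lam ^ 15 <= _); last first.
  by apply: (@expn_absorb _ 3 15); exact: le_million.
rewrite K_eq LE -[lam ^ 15]/(lam ^ (6 + 9)) expnD; move: (lam ^ 6) (lam ^ 9) p6 p9 => a b a1 b1.
have : a <= a * b by rewrite leq_pmulr.
have : b <= a * b by rewrite leq_pmull.
by nia.
Qed.

Lemma layer_bound : 27 * k ^ 5 * lam ^ 3 <= lam ^ 100.
Proof.
rewrite /k -expnM -mulnA -expnD; apply: leq_trans (@expn_absorb _ 3 _ _) _.
  by exact: le_million.
by rewrite leq_exp2l ?(leq_trans _ lam_big).
Qed.

Lemma M_bound : 2 * M <= lam ^ 100.
Proof.
have -> : 2 * M = 8 * lam ^ 3 by rewrite /M !expnS expn0; lia.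
apply: leq_trans (@expn_absorb _ 3 _ _) _; first by exact: le_million.
by rewrite leq_exp2l ?(leq_trans _ lam_big).
Qed.

Lemma klam_bound : 2 * (k * lam) <= lam ^ 100.
Proof.
rewrite /k -expnSr; apply: leq_trans (@expn_absorb _ 3 _ _) _; first by exact: le_million.
by rewrite leq_exp2l ?(leq_trans _ lam_big).
Qed.

End Numerics.

Lemma uniq_flatten_map (I T : eqType) (g : I -> seq T) (s : seq I) :
  uniq s -> (forall i, uniq (g i)) -> (forall i j v, v \in g i -> v \in g j -> i = j) ->
  uniq (flatten (map g s)).
Proof.
move=> + ug dg; elim: s => //= i s IHs /andP[iNs us].
rewrite cat_uniq ug IHs // andbT; apply/hasPn => v /flattenP[_ /mapP[j js ->] vj].
by apply: contra iNs => vi; rewrite (dg _ _ _ vi vj).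
Qed.

Lemma size_flatten_map (I T : Type) (g : I -> seq T) (s : seq I) k :
  (forall i, size (g i) = k) -> size (flatten (map g s)) = size s * k.
Proof. by move=> gk; elim: s => //= i s IHs; rewrite size_cat gk IHs. Qed.

(** Pigeonhole: the colours are grouped into B blocks of r consecutive ones. *)
Lemma small_block (T : finType) (B r : nat) (f : {ffun T -> 'I_(B * r)}) :
  0 < B -> exists2 b, b < B & B * #|[set x | f x %/ r == b]| <= #|T|.
Proof.
move=> B_gt0.
have lt_f x : f x %/ r < B.
  move: (nat_of_ord (f x)) (ltn_ord (f x)) => y lty.
  have [r0|r_gt0] := posnP r; first by move: lty; rewrite r0 muln0.
  by rewrite ltn_divLR.
pose g : {ffun T -> 'I_B} := [ffun x => Ordinal (lt_f x)].
have sum_g := sum_colour_card g setT; rewrite cardsT in sum_g.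
have blockE (c : 'I_B) : setT :&: [set x | g x == c] = [set x | f x %/ r == c].
  by apply/setP => x; rewrite !inE ffunE.
have [/existsP[c cP]|/existsPn none] := boolP [exists c : 'I_B, B * #|setT :&: [set x | g x == c]| <= #|T|].
  by exists c => //; rewrite -blockE.
suff: B * #|T| < B * #|T| by rewrite ltnn.
rewrite -{2}sum_g big_distrr /=; apply: leq_trans (_ : \sum_(c < B) #|T|.+1 <= _).
  by rewrite sum_nat_const card_ord ltn_pmul2l.
by apply: leq_sum => c _; rewrite ltnNge none.
Qed.

(** * One long cycle in an expander *)

Lemma low_arith d m lam l D : 0 < d -> d * l <= lam * D -> lam ^ 2 * D <= 2 * d * m ->
  lam * l <= 2 * m.
Proof.
move=> d_gt0 le1 le2; rewrite -(leq_pmul2l d_gt0) mulnCA.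
apply: leq_trans (_ : lam * (lam * D) <= _); first by rewrite leq_mul2l le1 orbT.
by rewrite mulnA mulnn; apply: leq_trans le2 _; rewrite mulnA [2 * d]mulnC -!mulnA.
Qed.

Lemma cover_arith lam k m n u : 15 < lam -> 0 < k * lam -> k * lam <= m ->
  n = (lam - 16) * m %/ (k * lam) -> u + n * k <= m -> lam * u <= 17 * m.
Proof.
move=> lam15 kl_gt0 kl_le nE un.
have := ltn_ceil ((lam - 16) * m) kl_gt0; rewrite -nE mulSn => lt1.
have : lam * (u + n * k) <= lam * m by rewrite leq_mul2l un orbT.
have : lam * m = (lam - 16) * m + 16 * m by rewrite -mulnDl subnK.
by move: lt1; move: ((lam - 16) * m) => z; rewrite mulnDr; lia.
Qed.

(** 3 lam rounds leave a single path, because (4 / 3) ^ 3 > 2. *)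
Lemma merge_count lam t n : 0 < lam -> 4 ^ (3 * lam) * t <= 3 ^ (3 * lam) * n ->
  n <= 2 ^ lam -> t = 0.
Proof.
move=> lam_gt0 le1 n_le; apply/eqP; rewrite -leqn0 leqNgt; apply/negP => t_gt0.
have : 64 ^ lam <= 54 ^ lam.
  apply: leq_trans (_ : 4 ^ (3 * lam) * t <= _); first by rewrite expnM leq_pmulr.
  apply: leq_trans le1 _; rewrite expnM -[54]/(27 * 2) expnMn.
  by rewrite leq_mul2l n_le orbT.
by rewrite leq_exp2r.
Qed.

Lemma degree_arith d lam g : 1 < lam -> lam * (d - g) <= d -> d <= 2 * g.
Proof.
move=> lam1 le1; have : 2 * (d - g) <= d by apply: leq_trans le1; rewrite leq_mul2r lam1 orbT.
lia.
Qed.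

Lemma sub_split d a b n : a + b = n -> d - a <= d - n + b.
Proof. lia. Qed.

Lemma cubic_arith y k m : 4 <= y -> m <= y -> k <= m -> m.+2 * k < y * y * y.
Proof.
move=> y4 my km; apply: leq_ltn_trans (_ : y.+2 * y < _).
  by apply: leq_mul; [lia | exact: leq_trans km my].
by rewrite ltn_mul2r; apply/andP; split; nia.
Qed.

Section ExpanderCycle.
Variables (R : realType) (T : finType) (e : rel T) (d lam : nat).
Hypothesis sym_e : symmetric e.
Hypothesis max_deg : forall x, #|neighbours e x| <= d.
Hypothesis T_le : #|T| <= 2 ^ lam.
Hypothesis expands : forall S : {set T}, 2 * #|S| <= #|T| -> d * #|S| <= lam ^ 5 * edges e S (~: S).
Hypothesis deficit : lam ^ 3 * (\sum_x (d - #|neighbours e x|)) <= d * #|T|.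
Hypothesis d_le : d <= 2 * #|T|.
Hypothesis d_big : lam ^ 100 <= d.
Hypothesis lam_big : 99 < lam.

(** A block of 4 lam reservoirs is set aside, of which 3 lam serve the rounds of merging
    and one closes the cycle; U is the rest. Of the vertices of U only few are in low,
    that is, have lost many neighbours, so the layers of a balanced colouring of U carry
    the paths to be merged. *)
Theorem expander_cycle : exists c, graph_cycle e c /\ lam * #|[set x | x \notin c]| <= 17 * #|T|.
Proof.
pose q := lam ^ 5; pose r := 4 * lam; pose B := lam ^ 2; pose M := B * r.
pose h := 5 * M * lam; pose K := 48 * q * h; pose L := 24 * q * lam + 1; pose k := lam ^ 18.
pose theta := d %/ (12 * q); pose m := #|T|.
have l_gt0 : 0 < lam := lam_gt0 lam_big.
have q_gt0 : 0 < q by rewrite expn_gt0 l_gt0.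
have B_gt0 : 0 < B by rewrite expn_gt0 l_gt0.
have r_gt0 : 0 < r by rewrite /r muln_gt0.
have M_gt0 : 0 < M by rewrite /M muln_gt0 B_gt0.
have h_gt0 : 0 < h by rewrite /h muln_gt0 (muln_gt0 5 M) M_gt0.
have k_gt1 : 1 < k by rewrite -{1}(exp1n 18) ltn_exp2r // (leq_trans _ lam_big).
have d_gt0 : 0 < d by apply: leq_trans d_big; rewrite expn_gt0 l_gt0.
have K_le : K <= theta.
  have q12_gt0 : 0 < 12 * q by rewrite muln_gt0 q_gt0.
  by rewrite leq_divRL //; apply: leq_trans d_big; apply: K_bound.
have theta_le : 12 * q * theta <= d by rewrite mulnC leq_divM.
have M_le : M <= 2 ^ lam.
  apply: leq_trans T_le; rewrite -(leq_pmul2l (isT : 0 < 2)).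
  exact: leq_trans (M_bound lam_big) (leq_trans d_big d_le).
have kl_le : k * lam <= m.
  rewrite -(leq_pmul2l (isT : 0 < 2)).
  exact: leq_trans (klam_bound lam_big) (leq_trans d_big d_le).
have k_le : k <= m by apply: leq_trans kl_le; rewrite leq_pmulr.
have lam2 : 2 <= lam by apply: leq_trans lam_big.
(* All M reservoirs are hitting; a light block of them is kept, and the others are
   returned to U. *)
have [f0 f0_res] := reservoir_colouring R e theta M_gt0 M_le T_le lam2.
have [b b_lt blk] := small_block f0 B_gt0.
pose Q i : {set T} := [set x | f0 x == b * r + i :> nat].
pose U : {set T} := [set x | f0 x %/ r != b].
have QU i : i < r -> Q i \subset ~: U.
  move=> ir; apply/subsetP => x; rewrite !inE negbK => /eqP->.
  by rewrite divnMDl // divn_small // addn0.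
have Q_res i : i < r -> reservoir e theta h (Q i).
  move=> ir; have lt_c : b * r + i < M.
    apply: leq_trans (_ : b.+1 * r <= _); first by rewrite mulSn addnC ltn_add2r.
    by rewrite leq_mul2r b_lt orbT.
  by have := f0_res (Ordinal lt_c).
have UC_small : B * #|~: U| <= m.
  by apply: leq_trans blk; rewrite leq_mul2l; apply/orP; right; apply/subset_leq_card/subsetP => x; rewrite !inE negbK.
pose deg x := #|neighbours e x :&: U|.
pose low : {set T} := [set x in U | d < lam * (d - deg x)].
have deg_le x : deg x <= d.
  by apply: leq_trans (max_deg x); apply/subset_leq_card/subsetIl.
have low_small : lam * #|low| <= 2 * m.
  apply: (low_arith d_gt0 (D := \sum_x (d - deg x))).
    rewrite mulnC -sum_nat_const big_distrr /= [leqRHS](bigID (mem low)) /=.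
    apply: leq_trans (leq_addr _ _); apply: leq_sum => x.
    by rewrite inE => /andP[_ /ltnW].
  have sumD : \sum_x (d - deg x) <= \sum_x (d - #|neighbours e x|) + d * #|~: U|.
    apply: leq_trans (_ : \sum_x (d - #|neighbours e x|) + edges e setT (~: U) <= _).
      rewrite /edges [X in _ + X](eq_bigl predT) => [|x]; last by rewrite inE.
      rewrite -big_split /=; apply: leq_sum => x _.
      have := cardsID U (neighbours e x); rewrite -/(deg x) setDE.
      exact: sub_split.
    by rewrite leq_add2l; apply: edges_leqr.
  apply: leq_trans (_ : lam ^ 2 * (\sum_x (d - #|neighbours e x|) + d * #|~: U|) <= _).
    by rewrite leq_mul2l sumD orbT.
  rewrite mulnDr mul2n -addnn mulnDl; apply: leq_add; last first.
    by rewrite mulnCA leq_mul2l UC_small orbT.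
  apply: leq_trans deficit; rewrite leq_mul2r; apply/orP; right.
  by rewrite leq_exp2l // ltnW.
have U_big : lam * m <= lam * #|U| + m.
  rewrite -{1}(cardsC U : _ = m) mulnDr leq_add2l; apply: leq_trans UC_small.
  by rewrite leq_mul2r /B -mulnn leq_pmulr ?orbT.
(* The sets that every layer must split evenly: all neighbourhoods, U and low. *)
pose S (i : option (option T)) : {set T} :=
  match i with Some (Some v) => neighbours e v :&: U | Some None => U | None => low end.
pose D (i : option (option T)) : nat := if i is Some (Some v) then d else 2 * m.
have [f fP] : exists f : {ffun T -> 'I_k}, forall i c,
    (k * lam * (k * #|S i :&: [set x | f x == c]|) <= k * lam * #|S i| + D i /\
     k * lam * #|S i| <= k * lam * (k * #|S i :&: [set x | f x == c]|) + D i)%N.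
  apply: (@balanced_colouring R _ _ S D k lam d) => //.
  - exact: ltnW.
  - have -> : 2 ^ (3 * lam) = 2 ^ lam * 2 ^ lam * 2 ^ lam by rewrite -!expnD; congr (_ ^ _); lia.
    by rewrite !card_option; apply: cubic_arith => //; rewrite (@leq_exp2l 2 2).
  - case=> [[v|]|] /=; first exact: deg_le.
      by apply: leq_trans (max_card _) _; rewrite leq_pmull.
    by apply: leq_trans (max_card _) _; rewrite leq_pmull.
  - by case=> [[v|]|].
  - exact: leq_trans (layer_bound lam_big) d_big.
pose V c : {set T} := [set x in U | f x == c :> nat].
have SV (A : {set T}) (c : 'I_k) : A \subset U -> A :&: [set x | f x == c] = A :&: V c.
  move=> /subsetP AU; apply/setP => x; rewrite !in_setI [x \in V c]in_set in_set.
  by case xA: (x \in A) => //=; rewrite (AU x xA).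
pose n := (lam - 16) * m %/ (k * lam).
have kl_gt0 : 0 < k * lam by rewrite muln_gt0 l_gt0 ltnW.
have lowU : low \subset U by apply/subsetP => x; rewrite inE => /andP[].
have bal v c : c < k ->
    k * lam * (k * #|neighbours e v :&: V c|) <= k * lam * deg v + d /\
    k * lam * deg v <= k * lam * (k * #|neighbours e v :&: V c|) + d.
  move=> ck; have /= := fP (Some (Some v)) (Ordinal ck).
  rewrite (SV _ (Ordinal ck)) ?subsetIr // -setIA (setIidPr (_ : V c \subset U)) //.
  by apply/subsetP => x; rewrite inE => /andP[].
have balU : k * lam * #|U| <= k * lam * (k * #|V 0|) + 2 * m.
  have [_] := fP (Some None) (Ordinal (ltnW k_gt1)).
  rewrite /S /= SV // (setIidPr (_ : V 0 \subset U)) //.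
  by apply/subsetP => x; rewrite inE => /andP[].
have ballow c : c < k -> k * lam * (k * #|low :&: V c|) <= k * lam * #|low| + 2 * m.
  by move=> ck; have [+ _] := fP None (Ordinal ck); rewrite /S /= SV.
have [F FP] := @layered_paths T e d k lam U (fun x => f x : nat) sym_e max_deg
  (fun x => ltn_ord (f x)) k_gt1 bal balU ballow low_small U_big d_gt0 l_gt0 n (leq_divM _ _)
  (ltac:(exact: leq_trans lam_big)).
pose Term := (V 0 :|: V k.-1) :\: low.
have TermU : Term \subset U.
  by apply/subsetP => x; rewrite !inE => /andP[_ /orP[]/andP[]].
have Term_exp (A : {set T}) : A \subset Term -> k * #|A| <= 8 * #|nbs e A|.
  move: A; apply: (@sparse_expands T e d k Term sym_e d_gt0) => [a|v].
    move=> aT; have aU := subsetP TermU a aT; move: aT; rewrite in_setD => /andP[+ _].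
    rewrite inE aU /= -leqNgt => /(degree_arith lam2)/leq_trans; apply.
    by rewrite leq_mul2l; apply/subset_leq_card/subsetIl.
  have half c : c < k -> k * #|neighbours e v :&: V c| <= 2 * d.
    move=> ck; have [le1 _] := bal v c ck; rewrite -(leq_pmul2l kl_gt0).
    apply: leq_trans le1 _; rewrite mulnCA mul2n -addnn.
    apply: leq_add; last by rewrite leq_pmull.
    by rewrite leq_mul2l deg_le orbT.
  apply: leq_trans (_ : k * (#|neighbours e v :&: V 0| + #|neighbours e v :&: V k.-1|) <= _).
    rewrite leq_mul2l; apply/orP; right; apply: leq_trans (leq_card_setU _ _).
    by apply/subset_leq_card; rewrite -setIUr; apply/setIS/subsetDl.
  by rewrite mulnDr -[4 * d]/((2 + 2) * d) mulnDl leq_add // half // ?ltn_predL ltnW.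
have Qlink i : i < r -> linkable e Term L (Q i).
  move=> ir; apply: (@reservoir_linkable T e d k Term sym_e max_deg q h theta K lam L) => //.
  - exact: k_bound.
  - exact: Q_res.
  - rewrite disjoints_subset; apply: subset_trans TermU _.
    by rewrite -[U]setCK setCS QU.
have r_ok i : i < (3 * lam).+1 -> i < r.
  by move=> /leq_trans; apply; rewrite /r [4 * lam]mulSn addnC -addn1 leq_add2l.
have dQ i j : i != j -> [disjoint Q i & Q j].
  move=> ij; rewrite -setI_eq0; apply/eqP/setP => x; rewrite !inE.
  by apply: contraNF ij => /andP[/eqP->]; rewrite eqn_add2l.
pose ps := [seq F i | i <- enum 'I_n].
have FT i : terminal_path e Term (F i).
  have [[pF]] := FP i; rewrite !(in_setD, in_set) => /and3P[F0 FU FV] /and3P[l0 lU lV] _ _ _.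
  by rewrite /terminal_path pF /= /end_of !(in_setU, in_setD, in_set) F0 FU FV l0 lU lV orbT.
have ps_verts : vertices_of ps = flatten [seq verts (F i) | i <- enum 'I_n].
  by rewrite /vertices_of /ps -map_comp.
have fam : path_family e Term ps.
  apply/andP; split; first by apply/allP => p /mapP[i _ ->].
  rewrite ps_verts; apply: uniq_flatten_map; first exact: enum_uniq.
    by move=> i; have [[]] := FP i.
  by move=> i j v; have [_ [_ dF]] := FP i; apply: dF.
have szps : size (vertices_of ps) = n * k.
  rewrite ps_verts (size_flatten_map _ (k := k)) ?size_enum_ord // => i.
  by have [[]] := FP i.
have psU x : x \in vertices_of ps -> x \in U.
  rewrite ps_verts => /flattenP[_ /mapP[i _ ->] xi].
  by have [_ [sU _]] := FP i; apply: sU.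
have NQ i : i < r -> {in vertices_of ps, forall x, x \notin Q i}.
  move=> ir x /psU xU; apply/negP => xQ; have := subsetP (QU i ir) x xQ.
  by rewrite in_setC xU.
have n_gt0 : 0 < n.
  rewrite divn_gt0 //; apply: leq_trans kl_le _; apply: leq_pmull.
  by rewrite subn_gt0; apply: leq_trans lam_big.
have n_gt2 : 2 < n * k.
  apply: leq_trans (_ : k <= _); last exact: leq_pmull.
  by apply: leq_trans (_ : lam <= _); [apply: leq_trans lam_big | rewrite /k expnS leq_pmulr // expn_gt0 l_gt0].
have szp : size ps = n by rewrite size_map size_enum_ord.
have [||||ps' [fam' ps'_gt0 cnt in' szv]] := @merge_rounds T e Term L Q (3 * lam) ps _ _ fam.
- by move=> i il; apply: Qlink; apply: r_ok; exact: ltnW.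
- by move=> i j _ _; apply: dQ.
- by rewrite szp.
- by move=> i il; apply: NQ; apply: r_ok; exact: ltnW.
have n_le : n <= m.
  rewrite -(leq_pmul2r kl_gt0); apply: leq_trans (leq_divM _ _) _.
  rewrite mulnC leq_mul2l; apply/orP; right; apply: leq_trans (leq_subr _ _) _.
  by rewrite leq_pmull // ltnW.
have sz1 : (size ps').-1 = 0.
  apply: merge_count l_gt0 cnt _; rewrite szp; apply: leq_trans T_le.
  by apply: leq_trans n_le; apply: leq_pred.
case: ps' fam' ps'_gt0 cnt in' szv sz1 => [|p [|p' ps']] // fam' _ _ in' szv _.
have [/andP[pT _] up] := andP fam'.
rewrite /vertices_of /= cats0 in up in' szv.
have [||c [cyc sub]] := close_cycle (Qlink (3 * lam) (r_ok _ (ltnSn _))) pT up.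
- move=> x /in' [xps|[i il xQ]]; first by apply: NQ => //; apply: r_ok.
  by rewrite (disjointFr (dQ i (3 * lam) _) xQ) // ltn_eqF.
- by apply: leq_trans szv; rewrite szps.
exists c; split => //; apply: (@cover_arith lam k m n) => //.
  exact: leq_trans lam_big.
rewrite -szps -(cardsC [set x | x \notin c] : _ = m) leq_add2l; apply: leq_trans szv _.
apply: leq_trans (_ : #|verts p| <= _).
  by rewrite (card_uniqP (up : uniq (verts p))).
apply/subset_leq_card/subsetP => x xp.
by rewrite !inE negbK sub.
Qed.
End ExpanderCycle.

(** * Paths and cycles in near-cliques *)

Section NearClique.
Variables (T : finType) (e : rel T).
Hypothesis sym_e : symmetric e.
Implicit Types (X C W S : {set T}).

Lemma card_missing X w g x : #|X :\: neighbours e x| <= g -> g + size w < #|X| ->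
  exists z, [/\ z \in X, z \notin w & e x z].
Proof.
move=> miss lt_g; have /subsetPn[z zX] : ~~ (X \subset (X :\: neighbours e x) :|: [set z in w]).
  apply: contraL lt_g => /subset_leq_card le1; rewrite -leqNgt; apply: leq_trans le1 _.
  apply: leq_trans (leq_card_setU _ _) _; apply: leq_add => //.
  by rewrite cardsE; apply: card_size.
rewrite !inE negb_or zX andbT negbK => /andP[xz zw]; by exists z.
Qed.

(** Greedy extension from x gives a path through |X| - g vertices of X. *)
Lemma near_clique_path X g x y : x \notin X ->
  {in x |: (y |: X), forall v, #|X :\: neighbours e v| <= g} -> 2 * g < #|X| ->
  exists w, [/\ path e x (rcons w y), uniq w, {subset w <= X} & #|X| <= size w + 2 * g].
Proof.
move=> xX miss X_big.
have long n : n <= #|X| - g -> exists w, [/\ path e x w, uniq w, {subset w <= X} & size w = n].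
  elim: n => [|n IHn] ltn; first by exists [::].
  have [w [pw uw wX szw]] := IHn (ltnW ltn).
  have lX : last x w \in x |: (y |: X).
    have := mem_last x w; rewrite inE => /orP[/eqP->|/wX]; rewrite !inE ?eqxx // => ->.
    by rewrite !orbT.
  have [z [zX zw lz]] := card_missing (miss _ lX) (ltac:(rewrite szw; lia) : g + size w < #|X|).
  exists (rcons w z); split; rewrite ?size_rcons ?szw //.
  - by rewrite rcons_path pw.
  - by rewrite rcons_uniq zw.
  - by move=> v; rewrite mem_rcons inE => /orP[/eqP->//|/wX].
have [w [pw uw wX szw]] := long _ (leqnn _).
(* The last g + 1 vertices of the greedy path cannot all be missed by y, so the path is
   cut at a neighbour of y among them. *)
pose a := #|X| - g - g.+1.
have ya : y \in x |: (y |: X) by rewrite !inE eqxx orbT.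
have szd : size (drop a w) = g.+1 by rewrite size_drop szw /a; lia.
have /hasP[z zw yz] : has (e y) (drop a w).
  apply: contraT => /hasPn none; have := miss _ ya; rewrite leqNgt => /negP[].
  rewrite -szd -(card_uniqP (drop_uniq a uw)).
  apply/subset_leq_card/subsetP => v vd; rewrite !inE none //=.
  by apply: wX; apply: mem_drop vd.
have [t1 [t2 dE]] : exists t1 t2, drop a w = t1 ++ z :: t2.
  by case/splitPr: zw => t1 t2; exists t1, t2.
pose w' := rcons (take a w ++ t1) z.
have wE : w = w' ++ t2 by rewrite /w' -cats1 -!catA -dE cat_take_drop.
exists w'; split.
- move: pw; rewrite wE cat_path => /andP[pw' _].
  by rewrite rcons_path pw' /w' last_rcons sym_e.
- by move: uw; rewrite wE cat_uniq => /andP[].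
- by move=> v vw; apply: wX; rewrite wE mem_cat vw.
rewrite size_rcons size_cat size_take_min szw.
have : minn a (#|X| - g) = a by apply/minn_idPl; rewrite /a leq_subr.
by move=> ->; rewrite /a; lia.
Qed.

Lemma near_clique_cycle X g : irreflexive e -> {in X, forall v, #|X :\: neighbours e v| <= g} ->
  2 * g + 3 < #|X| -> exists c, [/\ graph_cycle e c, {subset c <= X} & #|X| <= size c + 2 * g].
Proof.
move=> irr miss X_big.
have [x xX] : exists x, x \in X by apply/set0Pn; rewrite -card_gt0; lia.
have [y [yX _ xy]] := card_missing (w := [::]) (miss x xX) (ltac:(move: X_big => /=; lia)).
have yx : y != x by apply: contraTneq xy => ->; rewrite irr.
pose Y := X :\ x :\ y.
have YX : Y \subset X by apply: subset_trans (subsetDl _ _) (subsetDl _ _).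
have cY : #|X| = #|Y| + 2.
  by rewrite (cardsD1 x) xX (cardsD1 y) !inE yx yX /= -/Y; lia.
have [|v||w [pw uw wY szw]] := @near_clique_path Y g x y.
- by rewrite !inE eqxx andbF.
- move=> vxy; have vX : v \in X.
    by move: vxy; rewrite !in_setU !in_set1 => /or3P[/eqP->|/eqP->|/(subsetP YX)].
  by apply: leq_trans (miss v vX); apply: subset_leq_card; apply: setSD.
- lia.
exists (x :: rcons w y); split.
- split; first by rewrite /= size_rcons; lia.
  apply/andP; split; first by rewrite /= rcons_path pw last_rcons sym_e.
  rewrite /= mem_rcons inE negb_or eq_sym yx rcons_uniq uw /= andbT.
  by apply/andP; split; apply/negP => /wY; rewrite !inE eqxx ?andbF.
- move=> v; rewrite inE mem_rcons inE => /or3P[/eqP->//|/eqP->//|/wY].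
  exact: (subsetP YX).
by rewrite /= size_rcons; lia.
Qed.

(** The vertex w separates X from the rest of the graph. *)
Definition closed_off w X := w \notin X /\ forall x y, x \in X -> e x y -> y \in X \/ y = w.

(** Any two vertices of C have a common neighbour in C other than w, so w cannot split
    C. *)
Lemma near_clique_side C g w X : {in C, forall v, #|C :\: neighbours e v| <= g} ->
  2 * g + 1 < #|C| -> closed_off w X -> C :\ w \subset X \/ [disjoint C & X].
Proof.
move=> miss C_big [wX clX]; have [|/pred0Pn[u /= /andP[uC uX]]] := boolP [disjoint C & X].
  by right.
left; apply/subsetP => v /setD1P[vw vC].
have /subsetPn[z zC] : ~~ (C \subset (C :\: neighbours e u) :|: (C :\: neighbours e v) :|: [set w]).
  apply: contraL C_big => /leq_card_setU3; rewrite cards1 -leqNgt.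
  have := miss u uC; have := miss v vC; move: #|_ :\: _| #|C :\: _| #|C| => *; lia.
rewrite !inE !negb_or zC !andbT !negbK => /andP[/andP[uz vz] zw].
have [zX|zw'] := clX u z uX uz; last by rewrite zw' eqxx in zw.
by have [|vw'] := clX z v zX (ltac:(by rewrite sym_e)); last by rewrite vw' eqxx in vw.
Qed.

End NearClique.

(** * Counting vertices around separated cores *)

Lemma base_arith c d s a w E : c <= a -> d < s -> a * (w - (s - d.+1)) <= E ->
  c * d.+1 + c * w <= c * s + E.
Proof.
move=> ca ds aE; rewrite -mulnDr.
apply: leq_trans (_ : c * (s + (w - (s - d.+1))) <= _).
  by rewrite leq_mul2l; apply/orP; right; lia.
rewrite mulnDr leq_add2l; apply: leq_trans aE.
by rewrite leq_mul2r ca orbT.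
Qed.

Lemma split_arith0 c d j1 j2 s1 s2 w1 w2 E1 E2 E : 0 < j1 -> 0 < j2 ->
  c * j1 * d.+1 + c * w1 <= c * s1 + j1.-1 * (d - c) + E1 ->
  c * j2 * d.+1 + c * w2 <= c * s2 + j2.-1 * (d - c) + E2 -> E1 + E2 <= E ->
  c * (j1 + j2) * d.+1 + c * (w1 + w2) <= c * (s1 + s2) + (j1 + j2).-1 * (d - c) + E.
Proof.
case: j1 => // j1 _; case: j2 => // j2 _ /=; rewrite addnS /=.
move: (d - c) => x; nia.
Qed.

Lemma split_arith1 c d j1 j2 s1 s2 s w1 w2 w E1 E2 E : 0 < j1 -> 0 < j2 -> c <= d ->
  c * j1 * d.+1 + c * w1 <= c * s1 + j1.-1 * (d - c) + E1 ->
  c * j2 * d.+1 + c * w2 <= c * s2 + j2.-1 * (d - c) + E2 ->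
  s1 + s2 = s.+1 ->
  (w1 + w2 = w.+1 /\ E1 + E2 <= E) \/ (w1 + w2 = w.+2 /\ E1 + E2 <= E + d) ->
  c * (j1 + j2) * d.+1 + c * w <= c * s + (j1 + j2).-1 * (d - c) + E.
Proof.
case: j1 => // j1 _; case: j2 => // j2 _ cd /=; rewrite addnS /= => H1 H2 Hs HW.
have [x dE] : exists x, d = c + x by exists (d - c); lia.
rewrite dE (_ : c + x - c = x) in H1 H2 HW *; last by lia.
have ES : c * s1 + c * s2 = c * s + c by rewrite -mulnDr Hs mulnS addnC.
case: HW => -[HW HE].
  have EW : c * w1 + c * w2 = c * w + c by rewrite -mulnDr HW mulnS addnC.
  by nia.
have EW : c * w1 + c * w2 = c * w + 2 * c by rewrite -mulnDr HW; lia.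
by nia.
Qed.

Lemma small_core_arith (b : bool) c N n x w j : n = b + x -> c + N <= n ->
  w + j <= N -> 1 < j -> x = 0 -> False.
Proof. by case: b => *; lia. Qed.

Lemma cut_size_arith w1 w j1 j2 N : w1 <= w.+1 -> w + (j1 + j2) <= N -> 0 < j2 ->
  w1 + j1 <= N.
Proof. lia. Qed.

Lemma cut_in_arith a a' b b' c1 c2 n d x v : a <= a' -> b <= b' -> n <= d -> c1 + c2 = n ->
  x.+1 + v.+1 = (x + (v + true)).+1 /\ c1 + a + (c2 + b) <= a' + (n + b').
Proof. by rewrite addn1; lia. Qed.

Lemma cut_out_arith a a' b b' c1 c2 n d x v : a <= a' -> b <= b' -> n <= d -> c1 + c2 = n ->
  x.+1 + v.+1 = (x + (v + false)).+2 /\ c1 + a + (c2 + b) <= a' + (0 + b') + d.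
Proof. by rewrite addn0; lia. Qed.

Section Count.
Variables (T : finType) (e : rel T) (N c d : nat) (C : 'I_N -> {set T}).
Hypothesis sym_e : symmetric e.
Hypothesis irr_e : irreflexive e.
Hypothesis reg : regular e d.
Hypothesis side : forall l w X, closed_off e w X -> C l :\ w \subset X \/ [disjoint C l & X].
Hypothesis separated : forall i j, i != j -> exists w X,
  [/\ closed_off e w X, C i :\ w \subset X & [disjoint C j & X]].
Hypothesis C_big : forall l, c + N <= #|C l|.
Hypothesis c_le : c <= d.

(** A vertex of S outside W has all its d neighbours in S, so it misses at most |S| - d
    - 1 vertices of W; counting the edges between W and the rest of S gives the bound. *)
Lemma separated_base l (S W : {set T}) : C l \subset S -> W \subset S ->
  {in S :\: W, forall v, neighbours e v \subset S} -> #|W| < N ->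
  c * d.+1 + c * #|W| <= c * #|S| + \sum_(w in W) #|neighbours e w :&: S|.
Proof.
move=> CS WS clS W_lt; pose a := #|S :\: W|.
have cS := cardsID W S; rewrite (setIidPr WS) in cS.
have := C_big l; have := subset_leq_card CS => le1 le2.
have a_big : c < a by rewrite /a; lia.
have [v0 v0S] : exists v, v \in S :\: W by apply/set0Pn; rewrite -card_gt0; lia.
have degS v : v \in S :\: W -> #|S :\: neighbours e v| = #|S| - d.
  by move=> vS; rewrite cardsD setIC (setIidPl (clS v vS)) reg.
have missS v : v \in S :\: W -> v \in S :\: neighbours e v.
  by rewrite !inE irr_e => /andP[].
have ltdS : d < #|S|.
  have : 0 < #|S :\: neighbours e v0| by apply/card_gt0P; exists v0; apply: missS.
  by rewrite degS // subn_gt0.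
apply: (base_arith (ltnW a_big) ltdS).
apply: leq_trans (_ : edges e W (S :\: W) <= _); last first.
  by apply: leq_sum => w _; apply/subset_leq_card/setIS/subsetDl.
rewrite edgesC // /edges /a -sum_nat_const; apply: leq_sum => v vS.
have := cardsID (neighbours e v) W; rewrite setIC => cW.
have : #|W :\: neighbours e v| <= #|(S :\: neighbours e v) :\ v|.
  apply/subset_leq_card/subsetP => x; rewrite !inE => /andP[-> xW].
  rewrite (subsetP WS x xW) !andbT; apply: contraTneq xW => ->.
  by case/setDP: vS.
have := cardsD1 v (S :\: neighbours e v); rewrite (missS v vS) degS //.
move: cW ltdS; move: #|_ :&: _| #|W :\: _| #|_ :\ _| #|W| #|S| => *; lia.
Qed.

(** S is a part of the graph whose edges leave it only at the boundary W, and J lists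
    the cores inside it. Split S along a vertex w that separates two cores. The
    induction works because both sides of the inequality are almost additive: w is
    counted in both parts, once more in S and once or twice more in W, but its
    neighbours in S are shared between the parts, so each of the |J| - 1 splits costs at
    most d - c. In the case of the whole graph this reads n >= N (d + 1) up to a small
    error. *)
Lemma separated_count (J : {set 'I_N}) (S W : {set T}) : J != set0 ->
  {in J, forall l, C l \subset S} -> W \subset S ->
  {in S :\: W, forall v, neighbours e v \subset S} -> #|W| + #|J| <= N ->
  c * #|J| * d.+1 + c * #|W| <=
    c * #|S| + #|J|.-1 * (d - c) + \sum_(w in W) #|neighbours e w :&: S|.
Proof.
have [n] := ubnP #|J|; elim: n => // n IHn in J S W *; rewrite ltnS => leJ J0 CS WS clS WJ.
have [J1|J_gt1] := leqP #|J| 1.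
  have /cards1P[l JE] : #|J| == 1 by rewrite eqn_leq J1 card_gt0.
  rewrite JE cards1 muln1 mul0n addn0; apply: (separated_base (l := l)) => //.
    by apply: CS; rewrite JE inE.
  by move: WJ; rewrite JE cards1 addn1.
have [i iJ] := set0Pn _ J0.
have [j] : exists j, j \in J :\ i.
  by apply/set0Pn; rewrite -card_gt0; move: J_gt1; rewrite (cardsD1 i) iJ.
rewrite in_setD1 => /andP[ji jJ].
have [w [X [clX CiX CjX]]] : exists w X, [/\ closed_off e w X, C i :\ w \subset X & [disjoint C j & X]].
  by apply: separated; rewrite eq_sym.
have [wX clX'] := clX.
pose J1 := [set l in J | C l :\ w \subset X]; pose J2 := J :\: J1.
have C_not l : [disjoint C l & X] -> ~~ (C l :\ w \subset X).
  move=> dX; apply/negP => sX; have : C l :\ w == set0.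
    by rewrite -subset0 -(disjoint_setI0 dX) subsetI sX subsetDl.
  rewrite -cards_eq0 => /eqP; exact: small_core_arith (cardsD1 w (C l)) (C_big l) WJ J_gt1.
have iJ1 : i \in J1 by rewrite inE iJ.
have jJ2 : j \in J2 by rewrite !inE jJ andbT C_not.
have J12 : #|J| = #|J1| + #|J2|.
  by rewrite -(cardsID J1 J) (setIidPr _) //; apply/subsetP => l; rewrite inE => /andP[].
have J1_gt0 : 0 < #|J1| by apply/card_gt0P; exists i.
have J2_gt0 : 0 < #|J2| by apply/card_gt0P; exists j.
pose S1 := S :&: (w |: X); pose S2 := S :\: X.
pose W1 := (W :&: X) :|: (S :&: [set w]); pose W2 := (W :\: X) :|: (S :&: [set w]).
have W_bound (W' : {set T}) : W' \subset W -> #|W' :|: (S :&: [set w])| <= #|W|.+1.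
  move=> sW; apply: leq_trans (leq_card_setU _ _) _; rewrite -addn1; apply: leq_add.
    exact: subset_leq_card.
  by rewrite -(cards1 w); apply/subset_leq_card/subsetIr.
have IH1 : c * #|J1| * d.+1 + c * #|W1| <=
    c * #|S1| + #|J1|.-1 * (d - c) + \sum_(w in W1) #|neighbours e w :&: S1|.
  apply: IHn.
  - by apply: leq_trans leJ; rewrite J12 -addn1 leq_add2l.
  - by rewrite -card_gt0.
  - move=> l; rewrite inE => /andP[lJ lX]; rewrite subsetI CS //=.
    by rewrite -subDset.
  - apply/subsetP => x; rewrite !inE => /orP[/andP[xW ->]|/andP[-> ->]] //.
    by rewrite (subsetP WS) ?orbT.
  - move=> v; rewrite !inE negb_or => /andP[/andP[nWX nSw] /andP[vS vwX]].
    rewrite vS /= in nSw; rewrite (negPf nSw) /= in vwX.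
    have vN : v \in S :\: W by rewrite inE vS andbT; move: nWX; rewrite vwX andbT.
    apply/subsetP => y vy; rewrite !inE (subsetP (clS v vN) y vy) /=.
    by move: vy; rewrite inE => /(clX' _ _ vwX)[->|->]; rewrite ?eqxx ?orbT.
  - by rewrite J12 in WJ; exact: cut_size_arith (W_bound _ (subsetIl W X)) WJ J2_gt0.
have IH2 : c * #|J2| * d.+1 + c * #|W2| <=
    c * #|S2| + #|J2|.-1 * (d - c) + \sum_(w in W2) #|neighbours e w :&: S2|.
  apply: IHn.
  - by apply: leq_trans leJ; rewrite J12 -add1n leq_add2r.
  - by rewrite -card_gt0.
  - move=> l; rewrite !inE => /andP[+ lJ]; rewrite lJ /= => nX.
    by rewrite subsetD CS //=; have [sX|//] := side l clX; rewrite sX in nX.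
  - apply/subsetP => x; rewrite !inE => /orP[/andP[-> xW]|/andP[-> /eqP->]] //.
      by rewrite (subsetP WS).
    by rewrite wX.
  - move=> v; rewrite !inE negb_or => /andP[/andP[nWX nSw] /andP[vX vS]].
    rewrite vS /= in nSw; rewrite vX /= in nWX.
    have vN : v \in S :\: W by rewrite inE vS andbT.
    apply/subsetP => y vy; rewrite !inE (subsetP (clS v vN) y vy) andbT.
    apply/negP => yX; move: vy; rewrite inE sym_e => /(clX' _ _ yX)[vX'|vw].
      by rewrite vX' in vX.
    by rewrite vw eqxx in nSw.
  - apply: cut_size_arith (W_bound _ (subsetDl W X)) _ J1_gt0.
    by rewrite [#|J2| + _]addnC -J12.
have NS1 x : neighbours e x :&: S1 \subset neighbours e x :&: S by apply/setIS/subsetIl.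
have NS2 x : neighbours e x :&: S2 \subset neighbours e x :&: S by apply/setIS/subsetDl.
have [wS|wS] := boolP (w \in S); last first.
  have Sw0 : S :&: [set w] = set0.
    by apply/setP => x; rewrite !inE; apply/negP => /andP[xS /eqP xw]; rewrite -xw xS in wS.
  rewrite /W1 /W2 Sw0 !setU0 in IH1 IH2.
  have -> : #|W| = #|W :&: X| + #|W :\: X| by rewrite cardsID.
  have -> : #|S| = #|S1| + #|S2|.
    rewrite -(cardsID X S) /S2; congr (#|pred_of_set _| + _).
    by rewrite /S1 setIUr Sw0 set0U.
  rewrite J12; apply: split_arith0 IH1 IH2 _ => //.
  rewrite [leqRHS](big_setID X) /=; apply: leq_add; apply: leq_sum => x _; exact: subset_leq_card.
have Sw : S :&: [set w] = [set w] by apply/setIidPr; rewrite sub1set.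
rewrite /W1 /W2 Sw in IH1 IH2; rewrite J12.
have sS : #|S1| + #|S2| = #|S|.+1.
  rewrite -(cardsID X S) -addSn; congr (_ + _).
  by rewrite /S1 setIUr Sw cardsU1 inE (negPf wX) andbF.
apply: (split_arith1 J1_gt0 J2_gt0 c_le IH1 IH2 sS).
have NwX : #|neighbours e w :&: S1| + #|neighbours e w :&: S2| = #|neighbours e w :&: S|.
  rewrite -(cardsID X (_ :&: S)); congr (_ + _); apply: eq_card => x; rewrite !inE.
    by have [->|] := eqVneq x w; rewrite ?irr_e //= andbA.
  by case: (e w x); case: (x \in X); case: (x \in S).
have cW1 : #|W :&: X :|: [set w]| = (#|W :&: X|).+1.
  by rewrite setUC cardsU1 inE (negPf wX) andbF.
have sW1 : \sum_(x in W :&: X :|: [set w]) #|neighbours e x :&: S1| =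
    #|neighbours e w :&: S1| + \sum_(x in W :&: X) #|neighbours e x :&: S1|.
  by rewrite setUC big_setU1 //= inE (negPf wX) andbF.
rewrite cW1 sW1.
pose V := (W :\: X) :\ w.
have VE : #|V| + (w \in W) = #|W :\: X|.
  by rewrite [RHS](cardsD1 w) in_setD wX addnC.
have W2E : W :\: X :|: [set w] = w |: V.
  by apply/setP => x; rewrite !inE; case: eqP => _ /=; rewrite ?orbT ?orbF.
have wV : w \notin V by rewrite !inE eqxx.
have sW2 : \sum_(x in w |: V) #|neighbours e x :&: S2| =
    #|neighbours e w :&: S2| + \sum_(x in V) #|neighbours e x :&: S2| by rewrite big_setU1.
have cW2 : #|w |: V| = #|V|.+1 by rewrite cardsU1 wV.
rewrite W2E sW2 cW2.
have le1 : \sum_(x in W :&: X) #|neighbours e x :&: S1| <= \sum_(x in W :&: X) #|neighbours e x :&: S|.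
  by apply: leq_sum => x _; exact: subset_leq_card.
have le2 : \sum_(x in V) #|neighbours e x :&: S2| <= \sum_(x in V) #|neighbours e x :&: S|.
  by apply: leq_sum => x _; exact: subset_leq_card.
have sW : \sum_(x in W) #|neighbours e x :&: S| = \sum_(x in W :&: X) #|neighbours e x :&: S| +
    ((w \in W) * #|neighbours e w :&: S| + \sum_(x in V) #|neighbours e x :&: S|).
  rewrite (big_setID X) /=; congr (_ + _); case: (boolP (w \in W)) => wW.
    by rewrite mul1n (big_setD1 w) //= inE wX.
  rewrite mul0n add0n /V; apply: eq_bigl => x; rewrite !inE.
  by case: eqP => //= ->; rewrite (negPf wW) andbF.
have cW := cardsID X W; rewrite -VE in cW; rewrite sW -cW.
have le3 : #|neighbours e w :&: S| <= d by rewrite -(reg w); apply/subset_leq_card/subsetIl.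
case: (w \in W); rewrite ?mul1n ?mul0n; [left | right].
  exact: cut_in_arith le1 le2 le3 NwX.
exact: cut_out_arith le1 le2 le3 NwX.
Qed.

(** The error in [separated_count] is (N - 1)(d - c) < c, so integrality removes it. *)
Lemma not_all_separated : 0 < N -> N * (d - c) < c -> N * d.+1 <= #|T|.
Proof.
move=> N_gt0 Nd.
have J0 : [set: 'I_N] != set0 by apply/set0Pn; exists (Ordinal N_gt0).
have := @separated_count setT setT set0 J0.
have clT : {in [set: T] :\: set0, forall v, neighbours e v \subset [set: T]} by move=> v _; apply: subsetT.
move=> /(_ (fun l _ => subsetT _) (sub0set _) clT).
rewrite !cardsT card_ord !cards0 big_set0 muln0 !addn0 leqnn => /(_ isT).
move=> le1; rewrite leqNgt; apply/negP => lt1.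
have : c * #|T|.+1 <= c * (N * d.+1) by rewrite leq_mul2l lt1 orbT.
rewrite mulnA mulnS => le2.
have : N.-1 * (d - c) <= N * (d - c) by rewrite leq_mul2r leq_pred orbT.
by move: le1 le2 Nd; move: (N * _) (N.-1 * _) (c * #|_|) (_ * _.+1) => *; lia.
Qed.
End Count.

(** * One cycle through two near-cliques *)

Lemma card_uncovered (T : finType) (Y : {set T}) (w : seq T) k :
  uniq w -> {subset w <= Y} -> #|Y| <= size w + k -> #|Y :\: [set v in w]| <= k.
Proof.
move=> uw wY; have <- : #|Y :&: [set v in w]| = size w.
  rewrite -(card_uniqP uw); apply: eq_card => v; rewrite !inE.
  by case vw: (v \in w); rewrite ?andbF // wY.
by rewrite -(cardsID [set v in w] Y) leq_add2l.
Qed.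

Lemma remove2_arith g (b1 b2 : bool) n n1 n2 : n = b1 + n1 -> n1 = b2 + n2 ->
  2 * g + 2 < n -> 2 * g < n2.
Proof. by case: b1; case: b2; lia. Qed.

Lemma size3_arith s1 s2 a b : 0 < s2 -> 2 < s1.+1 + (b + (s2.+1 + a)).
Proof. lia. Qed.

Section Merge.
Variables (T : finType) (e : rel T).
Hypothesis sym_e : symmetric e.
Implicit Types (A B X : {set T}).

(** Menger's theorem for two paths: a separator with at most one vertex w cuts off the
    part reachable from A without w. *)
Lemma two_disjoint_paths A B (x0 : T) :
  ~ (exists w X, [/\ closed_off e w X, A :\ w \subset X & [disjoint B & X]]) ->
  exists F : 'I_2 -> T * seq T, (forall i, joins e A B (F i)) /\
    forall i j v, v \in verts (F i) -> v \in verts (F j) -> i = j.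
Proof.
move=> nsep; apply: menger => S sepS; rewrite ltnNge; apply/negP => S_le1; apply: nsep.
have [w Sw] : exists w, S \subset [set w].
  have [->|/set0Pn[w wS]] := eqVneq S set0; first by exists x0; apply: sub0set.
  by exists w; have /eqP-> : [set w] == S by rewrite eqEcard sub1set wS cards1.
pose r u v := e u v && (v != w).
pose X : {set T} := [set v | [exists a in A :\ w, connect r a v]].
have XP v : v \in X -> exists a p, [/\ a \in A :\ w, path r a p & v = last a p].
  by rewrite inE => /exists_inP[a aA /connectP[p pp ->]]; exists a, p.
have rw a p : a \in A :\ w -> path r a p -> w \notin a :: p.
  move=> /setD1P[aw _] pp; rewrite inE negb_or eq_sym aw /=.
  elim: p a pp {aw} => //= v p IHp a /andP[/andP[_ vw] /IHp]; by rewrite inE negb_or eq_sym vw.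
exists w, X; split.
- split.
    apply/negP => /XP[a [p [aA pp lw]]]; move: (rw a p aA pp); rewrite lw.
    by rewrite mem_last.
  move=> x y; rewrite !inE => /exists_inP[a aA ax] xy; have [->|yw] := eqVneq y w; first by right.
  left; apply/exists_inP; exists a => //; apply: connect_trans ax _; apply: connect1.
  by rewrite /r xy.
- by apply/subsetP => a aA; rewrite inE; apply/exists_inP; exists a.
rewrite -setI_eq0; apply/eqP/setP => v; rewrite in_setI in_set0; apply/negP => /andP[vB].
case/XP => a [p [aA pp lv]]; have := rw a p aA pp; apply/negP; rewrite negbK.
have pe : path e a p by apply: sub_path pp => x y /andP[].
have [] := setD1P aA => _ aA'.
have /hasP[z zp zS] := sepS a p pe aA' (ltac:(by rewrite -lv)).
by have:= subsetP Sw z zS; rewrite inE => /eqP <-.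
Qed.

(** From the last vertex in A, go on to the first vertex in B. *)
Lemma joins_trim A B p : [disjoint A & B] -> joins e A B p ->
  exists p', [/\ joins e A B p', {subset verts p' <= verts p},
    {in verts p', forall v, v \in A -> v = p'.1} &
    {in verts p', forall v, v \in B -> v = last p'.1 p'.2}].
Proof.
move=> dAB [pp pA pB up]; case: p pp pA pB up => u s /= pp pA pB up.
have [|s1 [s2 [sE lA nA]]] := @last_hit _ A u s.
  by apply/hasP; exists u; rewrite ?mem_head.
rewrite {s}sE in pp pB up *; rewrite cat_path in pp; rewrite last_cat in pB.
set x := last u s1 in lA pp pB *.
have [|t1 [t2 [tE lB nB]]] := @first_hit _ B x s2.
  by apply/hasP; exists (last x s2); rewrite ?mem_last.
rewrite {s2}tE in pp pB up nA *; have /andP[_] := pp; rewrite cat_path => /andP[pt _].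
have sub v : v \in x :: t1 -> v \in u :: s1 ++ t1 ++ t2.
  rewrite inE => /orP[/eqP->|vt]; first by rewrite -cat_cons mem_cat mem_last.
  by rewrite inE !mem_cat vt !orbT.
exists (x, t1); split => //.
- split => //; have : uniq ((u :: s1) ++ t1 ++ t2) := up.
  rewrite lastI cat_rcons cat_uniq -/x => /and3P[_ _].
  by rewrite -[x :: t1 ++ t2]/((x :: t1) ++ t2) cat_uniq => /andP[].
- move=> v; rewrite /verts /= inE => /orP[/eqP//|vt] vA.
  by case/negP: nA; apply/hasP; exists v; rewrite ?mem_cat ?vt.
move=> v; rewrite /verts /= lastI mem_rcons inE => /orP[/eqP//|vt] vB.
by case/negP: nB; apply/hasP; exists v.
Qed.

(** Each near-clique contributes a path between the ends of p1 and p2 that lie in it. *)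
Lemma merged_cycle A B g p1 p2 : [disjoint A & B] -> joins e A B p1 -> joins e A B p2 ->
  (forall v, v \in verts p1 -> v \notin verts p2) ->
  {in verts p1, forall v, v \in A -> v = p1.1} -> {in verts p1, forall v, v \in B -> v = last p1.1 p1.2} ->
  {in verts p2, forall v, v \in A -> v = p2.1} -> {in verts p2, forall v, v \in B -> v = last p2.1 p2.2} ->
  {in A, forall v, #|A :\: neighbours e v| <= g} -> {in B, forall v, #|B :\: neighbours e v| <= g} ->
  2 * g + 2 < #|A| -> 2 * g + 2 < #|B| ->
  exists c, [/\ graph_cycle e c, {subset c <= A :|: B :|: [set v in verts p1] :|: [set v in verts p2]},
     {subset verts p1 <= c} /\ {subset verts p2 <= c},
     #|A :\: [set v in c]| <= 2 * g & #|B :\: [set v in c]| <= 2 * g].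
Proof.
move=> dAB [pp1 A1 B1 u1] [pp2 A2 B2 u2] d12 a1 b1 a2 b2 missA missB Abig Bbig.
set y1 := last p1.1 p1.2 in B1 b1 *; set y2 := last p2.1 p2.2 in B2 b2 *.
have go (C : {set T}) x y : x \in C -> y \in C -> {in C, forall v, #|C :\: neighbours e v| <= g} ->
    2 * g + 2 < #|C| -> exists w, [/\ path e x (rcons w y), uniq w, {subset w <= C :\ x :\ y} &
       #|C :\ x :\ y| <= size w + 2 * g].
  move=> xC yC miss Cbig; apply: near_clique_path => //; first by rewrite !inE eqxx andbF.
    move=> v vxy; have vC : v \in C.
      by move: vxy; rewrite !inE => /or3P[/eqP->|/eqP->|/and3P[]].
    apply: leq_trans (miss v vC); apply: subset_leq_card; apply: setSD.
    exact: subset_trans (subsetDl _ _) (subsetDl _ _).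
  exact: remove2_arith (cardsD1 x C) (cardsD1 y (C :\ x)) Cbig.
have [wB [pB uB sB szB]] := go B y1 y2 B1 B2 missB Bbig.
have [wA [pA uA sA szA]] := go A p2.1 p1.1 A2 A1 missA Abig.
(* Along p1, then through B, back along p2, and through A. *)
pose c := verts p1 ++ wB ++ rev (verts p2) ++ wA.
have cE : c = p1.1 :: p1.2 ++ rcons wB y2 ++ rev (belast p2.1 p2.2) ++ wA.
  rewrite /c /verts; congr (_ :: _ ++ _).
  by rewrite [X in rev X]lastI rev_rcons cat_rcons.
have cov (C : {set T}) x y w : x \in c -> y \in c -> {subset w <= c} -> uniq w ->
    {subset w <= C :\ x :\ y} -> #|C :\ x :\ y| <= size w + 2 * g ->
    #|C :\: [set v in c]| <= 2 * g.
  move=> xc yc wc uw wC szw; apply: leq_trans (card_uncovered uw wC szw).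
  apply: subset_leq_card; apply/subsetP => v; rewrite !inE => /andP[vc ->].
  rewrite !andbT; apply/and3P; split.
  - by apply: contra vc => /wc.
  - by apply: contraNneq vc => ->.
  - by apply: contraNneq vc => ->.
have p1c : {subset verts p1 <= c} by move=> v vp; rewrite mem_cat vp.
have p2c : {subset verts p2 <= c} by move=> v vp; rewrite !mem_cat mem_rev vp !orbT.
have wBc : {subset wB <= c} by move=> v vp; rewrite !mem_cat vp !orbT.
have wAc : {subset wA <= c} by move=> v vp; rewrite !mem_cat vp !orbT.
have y1p : y1 \in verts p1 by apply: mem_last.
have y2p : y2 \in verts p2 by apply: mem_last.
have x1p : p1.1 \in verts p1 by apply: mem_head.
have x2p : p2.1 \in verts p2 by apply: mem_head.
have wAA v : v \in wA -> v \in A by move/sA; rewrite !inE => /and3P[].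
have wBB v : v \in wB -> v \in B by move/sB; rewrite !inE => /and3P[].
have p2_ne : p2.2 != [::].
  apply: contraTneq B2 => E; rewrite /y2 E /=.
  by rewrite (disjointFr dAB A2).
exists c; split.
- split.
    rewrite /c !size_cat size_rev; apply: size3_arith.
    by rewrite lt0n size_eq0.
  apply/andP; split.
    rewrite cE /= rcons_cat cat_path pp1 /= -/y1 -!cats1 -!catA catA cats1 cat_path pB.
    rewrite last_rcons cat_path.
    have -> : path e y2 (rev (belast p2.1 p2.2)).
      by rewrite /y2 rev_path (eq_path (e' := e)) // => x y; apply: sym_e.
    have -> : last y2 (rev (belast p2.1 p2.2)) = p2.1.
      by case: (p2.2) p2_ne => // a s _; rewrite /= rev_cons last_rcons.
    by rewrite cats1.
  rewrite /c !cat_uniq u1 uB rev_uniq u2 uA !andbT /=.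
  apply/and3P; split.
  + apply/hasPn => v; rewrite !mem_cat mem_rev => /or3P[/[dup] /wBB vB vw|vp|/[dup] /wAA vA vw].
    * apply/negP => vp; have vy := b1 v vp vB; move: (sB v vw); rewrite !inE vy eqxx.
      by rewrite andbF.
    * by apply: contraL vp => /d12.
    * apply/negP => vp; have vx := a1 v vp vA; move: (sA v vw); rewrite !inE vx eqxx.
      by rewrite ?andbF.
  + apply/hasPn => v; rewrite mem_cat mem_rev => /orP[vp|/wAA vA].
    * apply/negP => vw; have vy := b2 v vp (wBB v vw); move: (sB v vw); rewrite !inE vy eqxx.
      by rewrite ?andbF.
    * by apply/negP => /wBB; rewrite (disjointFr dAB vA).
  + apply/hasPn => v vw; rewrite mem_rev; apply/negP => vp.
    by have vx := a2 v vp (wAA v vw); move: (sA v vw); rewrite !inE vx eqxx ?andbF.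
- move=> v; rewrite /c !mem_cat mem_rev !in_setU !in_set.
  by case/or4P => [->|/wBB->|->|/wAA->]; rewrite ?orbT.
- by [].
- exact: cov (p2c _ x2p) (p1c _ x1p) wAc uA sA szA.
- exact: cov (p1c _ y1p) (p2c _ y2p) wBc uB sB szB.
Qed.

End Merge.

(** * Families of disjoint cycles *)

Section Collect.
Variables (T : finType) (e : rel T).

(** The cycles lie in the disjoint sets Y i. *)
Lemma collect_cycles (I : eqType) (Y : I -> {set T}) (s : seq I) (c : I -> seq T) :
  uniq s -> {in s, forall i, graph_cycle e (c i) /\ {subset c i <= Y i}} ->
  {in s &, forall i j, i != j -> [disjoint Y i & Y j]} ->
  disjoint_cycles e (map c s).
Proof.
move=> us cP dY; split; first by move=> _ /mapP[i iS ->]; case: (cP i iS).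
elim: s us cP dY => //= i s IHs /andP[iNs us] cP dY; apply/andP; split; last first.
  apply: IHs => //; first by move=> j js; apply: cP; rewrite inE js orbT.
  by move=> j k js ks; apply: dY; rewrite inE ?js ?ks orbT.
apply/allP => _ /mapP[j js ->].
have [_ ci] := cP i (mem_head _ _); have [_ cj] := cP j (ltac:(by rewrite inE js orbT)).
have ij : i != j by apply: contraNneq iNs => ->.
have dij := dY i j (mem_head _ _) (ltac:(by rewrite inE js orbT)) ij.
apply/pred0P => v /=; apply/negP => /andP[/ci vi /cj vj].
by rewrite (disjointFr dij vi) in vj.
Qed.

Lemma uncovered_sub (cs : seq (seq T)) c : c \in cs -> uncovered cs \subset ~: [set v in c].
Proof.
by move=> ccs; apply/subsetP => x; rewrite !inE; apply: contra => xc; apply/hasP; exists c.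
Qed.
End Collect.

Lemma card_le_cover (T I : finType) (P : pred I) (U : I -> {set T}) (X : {set T}) :
  #|X| <= #|~: \bigcup_(l | P l) U l| + \sum_(l | P l) #|U l :&: X|.
Proof.
rewrite -(cardsID (\bigcup_(l | P l) U l) X) addnC; apply: leq_add.
  by apply: subset_leq_card; rewrite setDE subsetIr.
rewrite -sum1_card; under [leqRHS]eq_bigr do rewrite -sum1_card big_mkcond.
rewrite exchange_big big_mkcond; apply: leq_sum => x _ /=.
case: ifP => //; rewrite in_setI => /andP[xX /bigcupP[l Pl xl]].
by rewrite (bigD1 l) //= in_setI xl xX.
Qed.

Section DenseMerge.
Variables (T : finType) (e : rel T) (N c d g : nat) (C : 'I_N -> {set T}).
Hypothesis sym_e : symmetric e.
Hypothesis irr_e : irreflexive e.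
Hypothesis reg : regular e d.
Hypothesis dC : forall i j, i != j -> [disjoint C i & C j].
Hypothesis missC : forall l, {in C l, forall v, #|C l :\: neighbours e v| <= g}.
Hypothesis C_big : forall l, c + N <= #|C l|.
Hypotheses (c_le : c <= d) (g_le : 2 * g + 2 <= c) (Nd : N * (d - c) < c).
Hypotheses (N_gt0 : 0 < N) (T_lt : #|T| < N * d.+1).

(** Otherwise [not_all_separated] contradicts the number of vertices. *)
Lemma exists_linked_pair : exists i j, i != j /\
  ~ (exists w X, [/\ closed_off e w X, C i :\ w \subset X & [disjoint C j & X]]).
Proof.
have [sep|] := pselect (forall i j, i != j -> exists w X,
  [/\ closed_off e w X, C i :\ w \subset X & [disjoint C j & X]]).
  suff : N * d.+1 <= #|T| by rewrite leqNgt T_lt.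
  apply: (@not_all_separated T e N c d C) => // l w X.
  apply: near_clique_side (missC (l := l)) _ => //.
  by have := C_big l; move: #|C l| N_gt0 g_le; clear; lia.
move/existsNP => [i /existsNP[j /not_implyP[ij nsep]]].
by exists i, j.
Qed.

(** Two linked cores share a cycle, and every other core, unless it is almost used up by
    the linking paths, has a cycle of its own. *)
Lemma dense_merge : exists cs, [/\ disjoint_cycles e cs, size cs <= N.-1 &
  #|uncovered cs| <= #|~: \bigcup_l C l| + N * (2 * g + 3)].
Proof.
have [i [j [ij nsep]]] := exists_linked_pair.
have Cbig l : 2 * g + 2 < #|C l|.
  by apply: leq_trans (C_big l); rewrite -addn1 leq_add.
have [x0 x0C] : exists x, x \in C i by apply/card_gt0P; apply: leq_trans (Cbig i).
have [F [jF dF]] := two_disjoint_paths x0 nsep.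
have dij := dC ij.
have [p1 [j1 s1 a1 b1]] := joins_trim dij (jF ord0).
have [p2 [j2 s2 a2 b2]] := joins_trim dij (jF ord_max).
have d12 v : v \in verts p1 -> v \notin verts p2.
  by move=> /s1 v1; apply/negP => /s2 v2; have := dF _ _ _ v1 v2.
have [mc [cyc sub [sub1 sub2] covA covB]] := merged_cycle sym_e dij j1 j2 d12 a1 b1 a2 b2
  (missC (l := i)) (missC (l := j)) (Cbig i) (Cbig j).
pose D := [set v in verts p1] :|: [set v in verts p2].
have Dmc v : v \in D -> v \in mc by rewrite !inE => /orP[/sub1|/sub2].
(* The two linking paths may run through other cores. What they leave of a core carries
   a cycle unless it has at most 2g + 3 vertices, and then these may stay uncovered. *)
have /fin_all_exists[cl clP] l : exists cl, 2 * g + 3 < #|C l :\: D| ->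
    [/\ graph_cycle e cl, {subset cl <= C l :\: D} & #|C l :\: D| <= size cl + 2 * g].
  have [big|small] := ltnP (2 * g + 3) #|C l :\: D|; last by exists [::].
  have [|cl clP] := near_clique_cycle sym_e irr_e _ big; last by exists cl.
  move=> v /setDP[vC _]; apply: leq_trans (missC vC); apply/subset_leq_card/setSD/subsetDl.
pose Y (o : option 'I_N) := if o is Some l then C l :\: D else C i :|: C j :|: D.
pose cc (o : option 'I_N) := if o is Some l then cl l else mc.
pose J := [set l | [&& l != i, l != j & 2 * g + 3 < #|C l :\: D|]].
pose s := None :: map Some (enum J).
have us : uniq s.
  rewrite /s /= map_inj_uniq ?enum_uniq ?andbT; last by move=> ? ? [].
  by apply/mapP => -[].
have sP l : Some l \in s = (l \in J).
  by rewrite inE /= mem_map ?mem_enum // => ? ? [].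
exists (map cc s); split.
- apply: (collect_cycles (Y := Y)) => //.
    move=> [l|] => [|_]; last first.
      by split => // v /sub; rewrite /= /D setUA.
    by rewrite sP inE => /and3P[_ _ /clP[]].
  have dN l : l \in J -> [disjoint C l :\: D & C i :|: C j :|: D].
    rewrite inE => /and3P[li lj _]; rewrite -setI_eq0; apply/eqP/setP => v.
    rewrite in_setI in_setD !in_setU in_set0; apply/negP => /andP[/andP[vD vl]].
    by rewrite (negPf vD) orbF (disjointFr (dC li) vl) (disjointFr (dC lj) vl).
  move=> [l|] [l'|] //; rewrite ?sP => lJ l'J ll'.
  + apply: disjointWl (subsetDl _ _) _; apply: disjointWr (subsetDl _ _) _; exact: dC.
  + exact: dN.
  + by rewrite disjoint_sym; apply: dN.
- rewrite size_map /s /= size_map -cardE.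
  have : J \subset ~: [set i; j] by apply/subsetP => l; rewrite !inE negb_or => /and3P[-> ->].
  move/subset_leq_card; have := cardsC [set i; j]; rewrite cards2 ij card_ord.
  by clear; move: #|J| #|~: _| => *; lia.
set cs := map cc s.
have mc_in : mc \in cs by apply/mapP; exists None; rewrite ?mem_head.
apply: leq_trans (_ : #|~: \bigcup_l C l| + #|'I_N| * (2 * g + 3) <= _); last by rewrite card_ord.
apply: leq_trans (card_le_cover xpredT C _) _.
rewrite leq_add2l -sum_nat_const; apply: leq_sum => l _.
have sub_mc : C l :&: uncovered cs \subset C l :\: [set v in mc].
  by rewrite setDE; apply: setIS; apply: uncovered_sub.
have [->|li] := eqVneq l i.
  apply: leq_trans (_ : 2 * g <= _); last exact: leq_addr.
  by apply: leq_trans covA; apply/subset_leq_card; rewrite setDE; apply/setIS/uncovered_sub.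
have [->|lj] := eqVneq l j.
  apply: leq_trans (_ : 2 * g <= _); last exact: leq_addr.
  by apply: leq_trans covB; apply/subset_leq_card; rewrite setDE; apply/setIS/uncovered_sub.
have subD : C l :&: uncovered cs \subset C l :\: D.
  apply: subset_trans sub_mc _; apply/subsetP => v; rewrite in_setD in_set => /andP[vm vl].
  by rewrite in_setD vl andbT; apply: contra vm => /Dmc.
have [big|le3] := ltnP (2 * g + 3) #|C l :\: D|; last first.
  by apply: leq_trans le3; apply: subset_leq_card.
have [[_ /andP[_ ucl]] cl_sub cl_sz] := clP l big.
apply: leq_trans (_ : 2 * g <= _); last exact: leq_addr.
apply: leq_trans (card_uncovered ucl cl_sub cl_sz); apply: subset_leq_card.
rewrite setDE subsetI subD; apply: subset_trans (subsetIr _ _) _; apply: uncovered_sub.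
by apply/mapP; exists (Some l); rewrite // sP inE li lj.
Qed.
End DenseMerge.

(** * Long cycles inside a class *)

Section ClassCycle.
Variables (R : realType) (T : finType) (e : rel T) (d lam : nat) (U : {set T}).
Hypothesis sym_e : symmetric e.
Hypothesis reg : regular e d.
Hypothesis U_le : #|U| <= 2 ^ lam.
Hypothesis expands : forall S : {set T}, S \subset U -> 2 * #|S| <= #|U| ->
  d * #|S| <= lam ^ 5 * edges e S (U :\: S).
Hypothesis leaving : lam ^ 3 * (\sum_(x in U) #|neighbours e x :\: U|) <= d * #|U|.
Hypothesis d_le : d <= 2 * #|U|.
Hypothesis d_big : lam ^ 100 <= d.
Hypothesis lam_big : 99 < lam.

(** [expander_cycle] applied to the subgraph induced on U, a graph on the subtype of U. *)
Lemma class_cycle : exists c,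
  [/\ graph_cycle e c, {subset c <= U} & lam * #|U :\: [set x in c]| <= 17 * #|U|].
Proof.
pose sT := {x : T | x \in U}; pose eU : rel sT := fun x y => e (val x) (val y).
have cT : #|{: sT}| = #|U| by rewrite card_sig; apply: eq_card => x; rewrite inE.
have inj := @val_inj _ _ sT.
have nbU (x : sT) (S : {set sT}) :
    #|neighbours eU x :&: S| = #|neighbours e (val x) :&: (val @: S)|.
  rewrite -(card_imset _ inj); apply: eq_card => y; rewrite inE; apply/imsetP/andP.
    by case=> z; rewrite !inE => /andP[xz zS] ->; split=> //; apply: imset_f.
  case=> xy /imsetP[z zS yz]; exists z => //.
  by rewrite !inE zS andbT; move: xy; rewrite inE yz.
have valT : val @: [set: sT] = U.
  apply/setP => y; apply/imsetP/idP; first by case=> z _ ->; apply: valP.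
  by move=> yU; exists (Sub y yU); rewrite ?inE ?SubK.
have nbT (x : sT) : #|neighbours eU x| = #|neighbours e (val x) :&: U|.
  by rewrite -[neighbours eU x]setIT nbU valT.
have sum_val (F : T -> nat) (S : {set sT}) : \sum_(x in S) F (val x) = \sum_(x in val @: S) F x.
  by rewrite big_imset //= => x y _ _; apply: inj.
have symU : symmetric eU by move=> x y; apply: sym_e.
have degU x : #|neighbours eU x| <= d.
  by rewrite nbT -(reg (val x)); apply/subset_leq_card/subsetIl.
have [|S S_le|||||c [[sz cyc] cov]] := @expander_cycle R sT eU d lam symU degU.
- by rewrite cT.
- have -> : edges eU S (~: S) = edges e (val @: S) (U :\: (val @: S)).
    rewrite /edges -sum_val; apply: eq_bigr => x _; rewrite nbU.
    suff -> : val @: (~: S) = U :\: (val @: S) by [].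
    apply/setP => y; rewrite in_setD; apply/imsetP/andP.
      case=> z; rewrite inE => zS ->; split; last exact: valP.
      by rewrite mem_imset.
    case=> yS yU; exists (Sub y yU); rewrite ?SubK // inE.
    by apply: contra yS => yS; apply/imsetP; exists (Sub y yU); rewrite ?SubK.
  have cS : #|val @: S| = #|S| by rewrite card_imset.
  rewrite -cS; apply: expands.
    by apply: subset_trans (imsetS _ (subsetT S)) _; rewrite valT.
  by rewrite cS -cT.
- rewrite cT; apply: leq_trans leaving; rewrite leq_mul2l; apply/orP; right.
  have -> : \sum_(x in U) #|neighbours e x :\: U| =
      \sum_(x in val @: [set: sT]) #|neighbours e x :\: U| by rewrite valT.
  rewrite -sum_val [leqRHS](eq_bigl predT) => [|x]; last by rewrite inE.
  apply: leq_sum => x _; rewrite nbT -(reg (val x)).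
  by rewrite -(cardsID U (neighbours e (val x))) addKn.
- by rewrite cT.
- exact: d_big.
- exact: lam_big.
exists (map val c); split.
- split; first by rewrite size_map.
  move: cyc; rewrite /ucycle cycle_map map_inj_uniq //.
- by move=> _ /mapP[x _ ->]; apply: valP.
apply: leq_trans (_ : lam * #|[set x | x \notin c]| <= _); last by rewrite -cT.
rewrite leq_mul2l; apply/orP; right.
have <- : #|val @: [set x | x \notin c]| = #|[set x | x \notin c]| by rewrite card_imset.
apply/subset_leq_card/subsetP => y; rewrite in_setD in_set => /andP[yc yU].
apply/imsetP; exists (Sub y yU); rewrite ?SubK // inE.
by apply: contra yc => yc; apply/mapP; exists (Sub y yU); rewrite ?SubK.
Qed.
End ClassCycle.

(** Discarding a lightest member does not lower the average. *)
Lemma heavy_subset (I : finType) (a : I -> nat) (k : nat) (J : {set I}) : k <= #|J| ->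
  exists2 K : {set I}, K \subset J /\ #|K| = k & k * (\sum_(i in J) a i) <= #|J| * (\sum_(i in K) a i).
Proof.
have [n] := ubnP #|J|; elim: n => // n IHn in J *; rewrite ltnS => leJ kJ.
have [kE|ltk] := eqVneq k #|J|; first by exists J; rewrite ?kE.
have {}ltk : k < #|J| by rewrite ltn_neqAle ltk.
have [i0 i0J] : exists i, i \in J by apply/card_gt0P; apply: leq_ltn_trans ltk.
case: (arg_minnP a i0J) => i; rewrite -/(i \in J) => iJ min_i.
have cJ : #|J| = #|J :\ i|.+1 by rewrite (cardsD1 i) iJ.
have [||K [KJ cK] avgK] := IHn (J :\ i); [by rewrite -cJ | by rewrite -ltnS -cJ |].
exists K; first by split=> //; apply: subset_trans KJ (subsetDl _ _).
have sJ : \sum_(j in J) a j = a i + \sum_(j in J :\ i) a j by rewrite (big_setD1 i).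
have ai : #|J :\ i| * a i <= \sum_(j in J :\ i) a j.
  by rewrite -sum_nat_const; apply: leq_sum => j /setD1P[_ jJ]; apply: min_i.
rewrite sJ cJ; rewrite cJ in ltk; move: ltk avgK ai {min_i sJ cJ kJ IHn leJ}.
set s := \sum_(j in J :\ i) a j; set u := \sum_(j in K) a j.
move: #|J :\ i| (a i) => m x ltk avgK ai.
have [m0|m_gt0] := posnP m; first by move: ltk; rewrite m0 ltnS leqn0 => /eqP->.
rewrite -(leq_pmul2l m_gt0).
have : m.+1 * (k * s) <= m.+1 * (m * u) by rewrite leq_mul2l avgK orbT.
have : k * (m * x) <= k * s by rewrite leq_mul2l ai orbT.
by lia.
Qed.

(** * Reducing the number of cycles *)

Lemma class_size_arith L d a g s : L * g <= d -> a + g = d -> a < s -> L * d.+1 <= L * s + d.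
Proof.
move=> Lg dE lt_as; apply: leq_trans (_ : L * s + L * g <= _); last by rewrite leq_add2l.
by rewrite -mulnDr leq_mul2l; apply/orP; right; lia.
Qed.

Lemma excess_arith0 L D N0 d S :
  (D + N0.+1) * (L * d.+1) <= L * S + (D + N0.+1) * d ->
  S <= N0.+1 * d.+1 -> L * D * d.+1 <= (D + N0.+1) * d.
Proof.
move=> le1 le2; have le3 : L * S <= L * (N0.+1 * d.+1) by rewrite leq_mul2l le2 orbT.
rewrite mulnDl in le1.
have e1 : L * D * d.+1 = D * (L * d.+1) by rewrite mulnAC mulnC mulnA [RHS]mulnC [RHS]mulnC; lia.
have e2 : L * (N0.+1 * d.+1) = N0.+1 * (L * d.+1) by rewrite mulnCA.
lia.
Qed.

Lemma excess_arith L N N0 n d S : N * (L * d.+1) <= L * S + N * d -> S <= n ->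
  n < N0.+1 * d.+1 -> N0 < N -> L * (N - N0.+1) < N.
Proof.
move=> le1 Sn lt_n ltN; move: le1; have := subnK ltN; move: (N - N0.+1) => D <- le1.
rewrite -(ltn_pmul2r (isT : 0 < d.+1)).
have le2 : S <= N0.+1 * d.+1 := leq_trans Sn (ltnW lt_n).
have le3 := excess_arith0 le1 le2.
apply: leq_ltn_trans le3 _.
by rewrite ltn_pmul2l // addnS.
Qed.

Lemma few_dropped lam N N0 : lam <= N0 -> N0 < N -> lam ^ 3 * (N - N0.+1) < N ->
  lam * (N - N0) <= 2 * N.
Proof.
move=> lamN ltN lt3.
have le1 : lam * (N - N0.+1) <= N.
  apply: leq_trans (ltnW lt3); rewrite leq_mul2r; case: (lam) => [|l] //; rewrite ?orbT //.
  by apply/orP; right; rewrite expnS leq_pmulr // expn_gt0.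
have -> : N - N0 = (N - N0.+1).+1 by lia.
by rewrite mulnS; lia.
Qed.

Lemma one_extra lam N N0 : 1 < lam -> N0 < lam -> N0 < N -> lam ^ 3 * (N - N0.+1) < N -> N = N0.+1.
Proof.
move=> lam1 ltl ltN; have := subnK ltN; move: (N - N0.+1) => [|D] <- // lt3; exfalso.
move: lt3; apply/negP; rewrite -leqNgt.
apply: leq_trans (_ : lam.+1 * D.+1 <= _); first by nia.
rewrite leq_mul2r; apply/orP; right; rewrite !expnS expn0 muln1; nia.
Qed.

Lemma dropped_arith lam N N0 n sG sK : 0 < N -> N0 <= N -> N0 * sG <= N * sK -> sG <= n -> sK <= sG ->
  lam * (N - N0) <= 2 * N -> lam * (sG - sK) <= 2 * n.
Proof.
move=> N_gt0 N0N avg sGn sKG le2; rewrite -(leq_pmul2l N_gt0).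
have le3 : N * (sG - sK) <= (N - N0) * sG.
  by rewrite mulnBr mulnBl; apply: leq_sub2l.
apply: leq_trans (_ : lam * ((N - N0) * sG) <= _).
  by rewrite mulnCA leq_mul2l le3 orbT.
rewrite mulnA; apply: leq_trans (_ : 2 * N * sG <= _).
  by rewrite leq_mul2r le2 orbT.
by rewrite [N * (2 * n)]mulnCA -mulnA leq_mul2l leq_mul2l sGn !orbT.
Qed.

Lemma class_upper_arith lam N d u S : 1 < lam -> N.+1 <= lam ->
  N * (lam ^ 3 * d.+1) <= lam ^ 3 * S + N * d -> u + S < N.+1 * d.+1 ->
  lam ^ 2 * u <= lam ^ 2 * d.+1 + d.
Proof.
move=> lam1 Nl le1 lt1; rewrite -(leq_pmul2l (ltnW lam1)).
have le2 : lam ^ 3 * (u + S) <= lam ^ 3 * (N.+1 * d.+1) by rewrite leq_mul2l ltnW ?orbT.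
have le3 : N * d <= lam * d by rewrite leq_mul2r ltnW ?orbT.
rewrite mulnA -expnS mulnDr [lam * (lam ^ 2 * _)]mulnA -expnS.
rewrite mulnDr mulSn [lam ^ 3 * (_ + _)]mulnDr in le2.
have e2 : lam ^ 3 * (N * d.+1) = N * (lam ^ 3 * d.+1) by rewrite mulnCA.
lia.
Qed.

Lemma miss_arith lam d u g x : 0 < lam -> lam <= d -> x + d = u + g -> lam * g <= d ->
  lam ^ 2 * u <= lam ^ 2 * d.+1 + d -> lam * x <= 3 * d.
Proof.
move=> l_gt0 ld xd lg lu; rewrite -(leq_pmul2l l_gt0).
have e1 : lam ^ 2 * x + lam ^ 2 * d = lam ^ 2 * u + lam ^ 2 * g by rewrite -!mulnDr xd.
have e2 : lam * (lam * g) <= lam * d by rewrite leq_mul2l lg orbT.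
have e3 : lam * lam <= lam * d by rewrite leq_mul2l ld orbT.
have e4 : d <= lam * d by rewrite leq_pmull.
rewrite mulnS -[lam ^ 2]mulnn in lu e1; rewrite mulnA [lam * (3 * d)]mulnCA.
rewrite -!mulnA in lu e1 *; lia.
Qed.

Lemma core_big_arith lam d N u c x : 99 < lam -> lam ^ 3 <= d -> N <= lam ->
  lam ^ 3 * d.+1 <= lam ^ 3 * u + d -> u <= 2 * d -> c + x = u -> lam ^ 2 * x <= u ->
  d - (4 * d) %/ lam ^ 2 + N <= c.
Proof.
move=> lam_big l3 Nl le1 u2 cx xu.
have l2_gt0 : 0 < lam ^ 2 by rewrite expn_gt0 (leq_trans _ lam_big).
have le1' : lam ^ 2 * d.+1 <= lam ^ 2 * u + d.
  have l_gt0 : 0 < lam by apply: leq_trans lam_big.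
  rewrite -(leq_pmul2l l_gt0) mulnA -expnS; apply: leq_trans le1 _.
  by rewrite mulnDr mulnA -expnS leq_add2l leq_pmull.
have e1 : lam ^ 2 * N <= d.
  by apply: leq_trans l3; rewrite [lam ^ 3]expnSr leq_mul2l Nl orbT.
have [small|big] := leqP (d + N) c; first by apply: leq_trans small; rewrite leq_add2r leq_subr.
have y_le : 4 * d %/ lam ^ 2 <= d.
  have l4 : 4 <= lam ^ 2 by rewrite -[4]/(2 ^ 2) leq_exp2r // (leq_trans _ lam_big).
  by rewrite -(leq_pmul2l (isT : 0 < 4)); apply: leq_trans (leq_divM _ (lam ^ 2)); rewrite mulnC leq_mul2l l4 orbT.
suff : d + N - c <= 4 * d %/ lam ^ 2 by move: big y_le; move: (_ %/ _) => y; lia.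
rewrite leq_divRL // mulnC mulnBr leq_subLR mulnDr.
have e2 : lam ^ 2 * u = lam ^ 2 * c + lam ^ 2 * x by rewrite -mulnDr cx.
by move: le1'; rewrite mulnS; lia.
Qed.

Lemma gap_arith lam d N : 99 < lam -> lam <= d -> N <= lam ->
  let c := d - (4 * d) %/ lam ^ 2 in let g := (3 * d) %/ lam in
  [/\ c <= d, 2 * g + 2 <= c & N * (d - c) < c].
Proof.
move=> lam_big ld Nl c g.
have l_gt0 : 0 < lam by apply: leq_trans lam_big.
pose y := (4 * d) %/ lam ^ 2.
have y2 : lam ^ 2 * y <= 4 * d by rewrite mulnC leq_divM.
have g2 : lam * g <= 3 * d by rewrite mulnC leq_divM.
have g3 : 100 * g <= 3 * d by apply: leq_trans g2; rewrite leq_mul2r lam_big orbT.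
have ly : 100 * (lam * y) <= 4 * d.
  by apply: leq_trans y2; rewrite -mulnn -mulnA leq_mul2r lam_big orbT.
have yl : y <= lam * y by rewrite leq_pmull.
have Ny : N * y <= lam * y by rewrite leq_mul2r Nl orbT.
have cE : d - c = y by rewrite /c subKn // -/y; lia.
have d100 : 100 <= d by apply: leq_trans ld.
split; rewrite ?leq_subr // ?cE /c -/y; lia.
Qed.

Lemma final_arith lam N d g n bad X : 0 < lam -> lam <= d -> N * d <= 2 * n -> lam * g <= 3 * d ->
  lam * bad <= 3 * n -> X <= bad + N * (2 * g + 3) -> lam * X <= 21 * n.
Proof.
move=> l_gt0 ld Nd lg lb XX.
have : lam * X <= lam * (bad + N * (2 * g + 3)) by rewrite leq_mul2l XX orbT.
have : N * (lam * (2 * g + 3)) <= N * (9 * d).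
  by rewrite leq_mul2l; apply/orP; right; rewrite mulnDr; lia.
have -> : lam * (bad + N * (2 * g + 3)) = lam * bad + N * (lam * (2 * g + 3)).
  by rewrite (mulnDr lam bad) (mulnCA lam N).
by rewrite [N * (9 * d)]mulnCA; lia.
Qed.

Lemma double_arith lam d u : 1 < lam -> 1 < d -> lam ^ 2 * u <= lam ^ 2 * d.+1 + d -> u <= 2 * d.
Proof.
move=> lam_gt1 d_gt1 le1; have l2 : 1 < lam ^ 2 by rewrite -[1](exp1n 2) ltn_exp2r.
have l2_gt0 : 0 < lam ^ 2 by apply: ltnW.
rewrite -(leq_pmul2l l2_gt0); apply: leq_trans le1 _; move: (lam ^ 2) l2 => y; nia.
Qed.

Lemma half_arith L d u : 1 < L -> L * d.+1 <= L * u + d -> d <= 2 * u.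
Proof.
move=> L_gt1 le1; have [|ltu] := leqP d.+1 u; first lia.
have : 2 * (d.+1 - u) <= L * (d.+1 - u) by rewrite leq_mul2r L_gt1 orbT.
by rewrite [L * (_ - _)]mulnBr; lia.
Qed.

Lemma keep_arith lam n sG sK uK b X y : sK + uK = n -> sG + b = n -> sK <= sG ->
  lam * b <= 2 * n -> lam * (sG - sK) <= 2 * n -> X <= uK + y -> lam * y <= 17 * sK ->
  lam * X <= 21 * n.
Proof.
move=> eK eG le1 lb ls lX ly.
have : lam * X <= lam * (uK + y) by rewrite leq_mul2l lX orbT.
have -> : uK = b + (sG - sK) by lia.
by rewrite !mulnDr; lia.
Qed.

Section Cover.
Variables (R : realType) (T : finType) (e : rel T) (d lam : nat).
Hypothesis sym_e : symmetric e.
Hypothesis irr_e : irreflexive e.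
Hypothesis reg : regular e d.
Hypothesis T_le : #|T| <= 2 ^ lam.
Hypothesis d_big : lam ^ 100 <= d.
Hypothesis lam_big : 99 < lam.

(** With N0 = floor (n / (d + 1)), either all N good classes can keep their cycles, or
    N0 >= lam and the N0 largest classes suffice, or N = N0 + 1 and the classes are
    near-cliques, two of which are joined in one cycle. *)
Theorem nearly_covering_cycles : exists cs,
  [/\ disjoint_cycles e cs, size cs * d.+1 <= #|T| & lam * #|uncovered cs| <= 21 * #|T|].
Proof.
pose n := #|T|; pose L := lam ^ 3.
have l_gt0 : 0 < lam by apply: leq_trans lam_big.
have l_gt1 : 1 < lam by apply: leq_trans lam_big.
have L_le : L <= d by apply: leq_trans d_big; rewrite leq_exp2l.
have ld : lam <= d by apply: leq_trans L_le; rewrite /L expnS leq_pmulr // expn_gt0 l_gt0.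
have d_gt0 : 0 < d by apply: leq_trans ld.
have [h [exp_h cut_h]] := @expander_partition T e sym_e d (lam ^ 5) lam T_le.
pose cls c := label_class h c.
pose lv c := \sum_(x in cls c) #|neighbours e x :\: cls c|.
(* The good classes, from which few edges leave; all classes are expanders, but only
   these are nearly regular. *)
pose G := [set c | (0 < #|cls c|) && (L * lv c <= d * #|cls c|)].
have mem_cls x : x \in cls (h x) by rewrite inE.
have clsE x c : x \in cls c -> h x = c by rewrite inE => /eqP.
have dcls c c' : c != c' -> [disjoint cls c & cls c'].
  move=> cc'; apply/pred0P => x /=; apply/negP => /andP[/clsE xc /clsE xc'].
  by rewrite -xc -xc' eqxx in cc'.
have sum_cls (F : T -> nat) (P : pred 'I_#|T|.+1) :
    \sum_(c | P c) \sum_(x in cls c) F x = \sum_(x | P (h x)) F x.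
  rewrite (partition_big h P) //=; apply: eq_bigr => c Pc; apply: eq_bigl => x.
  by rewrite inE; case: eqP => [->|]; rewrite ?Pc ?andbF.
have card_cls c : #|cls c| = \sum_(x in cls c) 1 by rewrite sum1_card.
pose Bd : {set T} := [set x | h x \notin G].
have Bd_small : lam * #|Bd| <= 2 * n.
  have le1 : d * #|Bd| <= L * \sum_x #|neighbours e x :\: cls (h x)|.
    have -> : #|Bd| = \sum_(c | c \notin G) #|cls c|.
      under [RHS]eq_bigr do rewrite card_cls.
      by rewrite (sum_cls (fun=> 1) (fun c => c \notin G)) -sum1_card; apply: eq_bigl => x; rewrite inE.
    have <- : \sum_c lv c = \sum_x #|neighbours e x :\: cls (h x)|.
      rewrite -(sum_cls (fun x => #|neighbours e x :\: cls (h x)|) predT) /=.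
      by apply: eq_bigr => c _; apply: eq_bigr => x /clsE->.
    rewrite !big_distrr /= [leqRHS](bigID (mem G)) /=; apply: leq_trans (leq_addl _ _).
    apply: leq_sum => c; rewrite inE negb_and -leqNgt leqn0 => /orP[/eqP->|]; first by rewrite muln0.
    by rewrite -ltnNge => /ltnW.
  rewrite -(leq_pmul2l d_gt0).
  have le2 : lam * (lam * (L * \sum_x #|neighbours e x :\: cls (h x)|)) <= lam * (2 * d * n).
    rewrite [leqRHS]mulnC; apply: leq_trans cut_h.
    by rewrite /L [lam ^ 5]expnS [lam ^ 4]expnS -!mulnA.
  rewrite leq_pmul2l // in le2.
  apply: leq_trans (_ : lam * (d * #|Bd|) <= _); first by rewrite mulnCA.
  apply: leq_trans (_ : lam * (L * \sum_x #|neighbours e x :\: cls (h x)|) <= _).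
    by rewrite leq_mul2l le1 orbT.
  by apply: leq_trans le2 _; rewrite mulnCA mulnA.
have lv_le c : c \in G -> L * lv c <= d * #|cls c| by rewrite inE => /andP[].
have deg_split x (U : {set T}) : #|neighbours e x :&: U| + #|neighbours e x :\: U| = d.
  by rewrite cardsID reg.
have cls_size c : c \in G -> L * d.+1 <= L * #|cls c| + d.
  move=> cG; have cls_gt0 : 0 < #|cls c| by move: cG; rewrite inE => /andP[].
  have [x xc lx] : exists2 x, x \in cls c & L * #|neighbours e x :\: cls c| <= d.
    have [/exists_inP[x xc lx]|/exists_inPn none] := boolP [exists x in cls c, L * #|neighbours e x :\: cls c| <= d].
      by exists x.
    have := lv_le c cG; rewrite leqNgt => /negP[]; rewrite /lv big_distrr /= mulnC -sum_nat_const.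
    have [x xc] : exists x, x \in cls c by apply/card_gt0P.
    rewrite (bigD1 x) //= [ltnRHS](bigD1 x) //= -addSn; apply: leq_add.
      by rewrite ltnNge none.
    by apply: leq_sum => y /andP[yc _]; rewrite ltnW // ltnNge none.
  apply: (class_size_arith lx (deg_split x (cls c))).
  rewrite [#|cls c|](cardsD1 x) xc ltnS; apply/subset_leq_card/subsetP => y.
  by rewrite !inE => /andP[xy ->]; rewrite andbT; apply: contraTneq xy => ->; rewrite irr_e.
have d_le2 c : c \in G -> d <= 2 * #|cls c|.
  move/cls_size; apply: half_arith; apply: leq_trans l_gt1 _.
  by rewrite /L expnS leq_pmulr // expn_gt0 l_gt0.
have /fin_all_exists[cy cyP] c : exists cy, c \in G ->
    [/\ graph_cycle e cy, {subset cy <= cls c} & lam * #|cls c :\: [set x in cy]| <= 17 * #|cls c|].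
  have [cG|cG] := boolP (c \in G); last by exists [::].
  have [||||cy cyP] := @class_cycle R T e d lam (cls c) sym_e reg _ _ _ _ d_big lam_big; last by exists cy.
  - by apply: leq_trans T_le; apply: max_card.
  - by move=> S; apply: exp_h.
  - exact: lv_le.
  - exact: d_le2.
pose N := #|G|.
have coverE (K : {set 'I_#|T|.+1}) : ~: (\bigcup_(c in K) cls c) = [set x | h x \notin K].
  apply/setP => x; rewrite in_setC in_set; congr negb.
  by apply/bigcupP/idP => [[c cK /clsE->]//|hK]; exists (h x).
have sumE (K : {set 'I_#|T|.+1}) : \sum_(c in K) #|cls c| + #|~: (\bigcup_(c in K) cls c)| = n.
  under eq_bigr do rewrite card_cls.
  rewrite (sum_cls (fun=> 1) (mem K)) sum1_card coverE -[RHS](cardsC [set x | h x \in K]).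
  congr (_ + _); first by apply: eq_card => x; rewrite in_set.
  by apply: eq_card => x; rewrite in_setC !in_set.
have sumG_le : \sum_(c in G) #|cls c| + #|Bd| = n by rewrite -[RHS](sumE G) coverE.
have keep (K : {set 'I_#|T|.+1}) : K \subset G -> #|K| * d.+1 <= n ->
    lam * (\sum_(c in G) #|cls c| - \sum_(c in K) #|cls c|) <= 2 * n ->
    exists cs, [/\ disjoint_cycles e cs, size cs * d.+1 <= #|T| & lam * #|uncovered cs| <= 21 * #|T|].
  move=> KG Kd lossK; exists (map cy (enum K)).
  have inK c : (c \in enum K) = (c \in K) by rewrite mem_enum.
  have sub_sum : \sum_(c in K) #|cls c| <= \sum_(c in G) #|cls c|.
    by rewrite [leqRHS](big_setID K) /= (setIidPr KG) leq_addr.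
  split.
  - apply: (collect_cycles (Y := cls)); first exact: enum_uniq.
      by move=> c; rewrite inK => /(subsetP KG)/cyP[].
    by move=> c c' _ _; apply: dcls.
  - by rewrite size_map -cardE.
  apply: (keep_arith (sumE K) sumG_le sub_sum Bd_small lossK (card_le_cover (mem K) cls _)).
  rewrite !big_distrr /=; apply: leq_sum => c cK; have [_ _ cov] := cyP c (subsetP KG c cK).
  apply: leq_trans cov; rewrite leq_mul2l; apply/orP; right; apply: subset_leq_card.
  rewrite setDE; apply: setIS; apply: uncovered_sub; apply: map_f.
  by rewrite inK.
have sizeG : N * (L * d.+1) <= L * (\sum_(c in G) #|cls c|) + N * d.
  rewrite big_distrr /= -!sum_nat_const -big_split /=; apply: leq_sum => c cG; exact: cls_size.
have [Nd|Nd] := leqP (N * d.+1) n.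
  by apply: (keep G) => //; rewrite subnn muln0.
pose N0 := n %/ d.+1.
have n_lt : n < N0.+1 * d.+1 by apply: ltn_ceil.
have N0_le : N0 * d.+1 <= n by apply: leq_divM.
have ltN : N0 < N by rewrite ltn_divLR.
have sumG_n : \sum_(c in G) #|cls c| <= n by rewrite -sumG_le leq_addr.
have ex3 := excess_arith sizeG sumG_n n_lt ltN.
have N_gt0 : 0 < N by apply: leq_trans ltN.
(* N exceeds N0 + 1 by less than N / lam ^ 3, which forces N = N0 + 1 when N0 < lam. *)
have [lamN0|N0lam] := leqP lam N0.
  have [K [KG cK] avgK] := heavy_subset (fun c => #|cls c|) (ltnW ltN).
  apply: (keep K KG); first by rewrite cK.
  apply: (dropped_arith N_gt0 (ltnW ltN) avgK sumG_n); last exact: few_dropped.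
  by rewrite [leqRHS](big_setID K) /= (setIidPr KG) leq_addr.
have NE := one_extra l_gt1 N0lam ltN ex3.
have N_le : N <= lam by rewrite NE.
(* With few classes there is no room for any of them to be much larger than d + 1, so a
   vertex with few neighbours outside its class is adjacent to almost all of the class. *)
pose core c := [set v in cls c | lam * #|neighbours e v :\: cls c| <= d].
have core_sub c : core c \subset cls c by apply/subsetP => v; rewrite inE => /andP[].
have upper c : c \in G -> lam ^ 2 * #|cls c| <= lam ^ 2 * d.+1 + d.
  move=> cG; have cardG : #|G :\ c| = N0.
    by have := cardsD1 c G; rewrite cG -/N NE add1n => -[].
  apply: (@class_upper_arith lam N0 d _ (\sum_(c' in G :\ c) #|cls c'|)) => //.
    rewrite -cardG big_distrr /= -!sum_nat_const -big_split /=.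
    by apply: leq_sum => c' /setD1P[_ c'G]; apply: cls_size.
  apply: leq_ltn_trans n_lt; apply: leq_trans sumG_n.
  by rewrite [leqRHS](big_setD1 c).
have core_loss c : c \in G -> lam ^ 2 * #|cls c :\: core c| <= #|cls c|.
  move=> cG; rewrite -(leq_pmul2l d_gt0).
  apply: leq_trans (_ : L * lv c <= _); last exact: lv_le.
  rewrite /L (expnSr lam 2) -mulnA mulnCA leq_mul2l; apply/orP; right.
  rewrite mulnC -sum_nat_const /lv big_distrr /= [leqRHS](big_setID (core c)) /=.
  apply: leq_trans (leq_addl _ _); apply: leq_sum => v.
  by rewrite in_setD [v \in core c]in_set => /andP[+ vc]; rewrite vc /= -ltnNge => /ltnW.
have core_big c : c \in G -> d - (4 * d) %/ lam ^ 2 + N <= #|core c|.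
  move=> cG; apply: (core_big_arith lam_big L_le N_le (cls_size c cG) (x := #|cls c :\: core c|)).
  - by apply: double_arith (upper c cG) => //; apply: leq_trans ld.
  - by rewrite -(cardsID (core c) (cls c)) (setIidPr (core_sub c)).
  - exact: core_loss.
have core_miss c : c \in G -> {in core c, forall v, #|core c :\: neighbours e v| <= (3 * d) %/ lam}.
  move=> cG v; rewrite inE => /andP[vc lv_v]; rewrite leq_divRL // mulnC.
  apply: leq_trans (_ : lam * #|cls c :\: neighbours e v| <= _).
    by rewrite leq_mul2l; apply/orP; right; apply/subset_leq_card/setSD.
  apply: (miss_arith l_gt0 ld _ lv_v (upper c cG)).
  rewrite -(deg_split v (cls c)) addnA; congr (_ + _).
  by rewrite [neighbours e v :&: _]setIC addnC cardsID.
have [c_le g_le Nd_lt] := gap_arith lam_big ld N_le.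
pose C (l : 'I_N) := core (enum_val l).
have enumG (l : 'I_N) : enum_val l \in G by apply: enum_valP.
have dC (i j : 'I_N) : i != j -> [disjoint C i & C j].
  move=> ij; apply: disjointWl (core_sub _) _; apply: disjointWr (core_sub _) _.
  by apply: dcls; apply: contra ij => /eqP/enum_val_inj->.
have [cs [cs_ok cs_sz cs_unc]] := @dense_merge T e N _ d _ C sym_e irr_e reg dC
  (fun l => core_miss _ (enumG l)) (fun l => core_big _ (enumG l)) c_le g_le Nd_lt N_gt0
  (ltac:(by rewrite NE)).
exists cs; split => //.
  by apply: leq_trans N0_le; rewrite leq_mul2r (leq_trans cs_sz) ?orbT // NE.
apply: (final_arith l_gt0 ld _ _ _ cs_unc).
- apply: leq_trans (_ : 2 * \sum_(c in G) #|cls c| <= _); last by rewrite leq_mul2l sumG_n orbT.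
  by rewrite big_distrr /= -sum_nat_const; apply: leq_sum => c; apply: d_le2.
- by rewrite mulnC leq_divM.
set X := ~: _; apply: leq_trans (_ : lam * (#|~: (\bigcup_(c in G) cls c)| + \sum_(c in G) #|cls c :&: X|) <= _).
  by rewrite leq_mul2l card_le_cover orbT.
rewrite mulnDr coverE -/Bd mulSn addnC; apply: leq_add; last exact: Bd_small.
apply: leq_trans sumG_n; rewrite big_distrr /=; apply: leq_sum => c cG.
apply: leq_trans (core_loss c cG); apply: leq_mul; first by rewrite -mulnn leq_pmulr.
apply/subset_leq_card; rewrite setDE; apply: setIS; rewrite setCS.
by rewrite -(enum_rankK_in cG cG); apply: (bigcup_sup (enum_rank_in cG c)).
Qed.
End Cover.

(** * Logarithms to base 2, and the conclusion *)

Local Open Scope ring_scope.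

Section Log2.
Variable R : realType.

Lemma ln2_gt0 : 0 < ln (2 : R).
Proof. by rewrite ln_gt0 // ltr1n. Qed.

Lemma le_log2 (x y : R) : 0 < x -> x <= y -> log2 x <= log2 y.
Proof.
move=> x_gt0 xy; rewrite /log2 ler_pM2r ?invr_gt0 ?ln2_gt0 //.
by rewrite ler_ln ?posrE // (lt_le_trans x_gt0 xy).
Qed.

Lemma log2_exp2 k : log2 ((2 ^ k)%N%:R : R) = k%:R.
Proof.
rewrite /log2 natrX lnXn // -[ln _ *+ k]mulr_natl mulfK //.
by rewrite gt_eqF // ln2_gt0.
Qed.

Lemma le_log2_nat k n : (2 ^ k <= n)%N -> k%:R <= log2 (n%:R : R).
Proof.
by move=> kn; rewrite -(log2_exp2 k); apply: le_log2; rewrite ?ltr0n ?expn_gt0 // ler_nat.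
Qed.

Lemma log2_nat_le k n : (0 < n)%N -> (n <= 2 ^ k)%N -> log2 (n%:R : R) <= k%:R.
Proof.
by move=> n_gt0 nk; rewrite -(log2_exp2 k); apply: le_log2; rewrite ?ltr0n // ler_nat.
Qed.

End Log2.

(** It converts (log n) ^ 130 into a power of lam, which may exceed log n by one. *)
Lemma exp_gap t : (11 <= t)%N -> (t.+1 ^ 100 <= t ^ 130)%N.
Proof.
move=> t_ge; rewrite -[100%N]/(10 * 10)%N -[130%N]/(13 * 10)%N !expnM leq_exp2r //.
apply: leq_trans (_ : (2 * t) ^ 10 <= _)%N; first by rewrite leq_exp2r //; lia.
rewrite expnMn -[13%N]/(3 + 10)%N expnD leq_mul2r; apply/orP; right.
apply: leq_trans (_ : 11 ^ 3 <= _)%N => //; by rewrite leq_exp2r.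
Qed.

(** The threshold 2 ^ 199 is kept behind an existential, as it is too large to compute
    with. *)
Lemma large_order : exists n0 : nat, forall n, (n0 <= n)%N -> (199 <= trunc_log 2 n)%N /\ (0 < n)%N.
Proof.
exists (2 ^ 199)%N => n n_ge; have n_gt0 : (0 < n)%N.
  by apply: leq_trans n_ge; rewrite expn_gt0.
by split => //; apply: trunc_log_max.
Qed.

Theorem theorem7p1 (R : realType) :
  exists (C : R) (n0 : nat),
    0 < C /\
    forall (T : finType) (e : rel T) (n d : nat),
      simple_graph e ->
      #|T| = n ->
      (n0 <= n)%N ->
      regular e d ->
      log2 (n%:R : R) ^+ 130 <= d%:R ->
      exists cs : seq (seq T),
        [/\ disjoint_cycles e cs,
            ((size cs)%:R : R) <= n%:R / (d + 1)%N%:R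
          & #|uncovered cs|%:R <=
              C * (n%:R / (log2 (log2 n%:R) `^ (1 / 30%:R)))].
Proof.
have [n0 n0P] := large_order; exists 21, n0; split => // T e n d [sym_e irr_e] cT n_ge reg d_ge.
have [t_ge n_gt0] := n0P n n_ge; set t := trunc_log 2 n in t_ge.
have lt_n : (n < 2 ^ t.+1)%N by apply: trunc_log_ltn.
have le_n : (2 ^ t <= n)%N by apply: trunc_logP.
have log_ge : t%:R <= log2 (n%:R : R) by apply: le_log2_nat.
have log_le : log2 (n%:R : R) <= t.+1%:R by apply: log2_nat_le => //; exact: ltnW.
have d_big : (t.+1 ^ 100 <= d)%N.
  apply: leq_trans (exp_gap (leq_trans _ t_ge)) _ => //.
  by rewrite -(ler_nat R) natrX; apply: le_trans d_ge; apply: lerXn2r; rewrite ?nnegrE // (le_trans _ log_ge).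
have lam_big : (99 < t.+1)%N by apply: leq_trans (leqW t_ge).
have [|cs [cs_ok cs_sz cs_unc]] := @nearly_covering_cycles R T e d t.+1 sym_e irr_e reg _ d_big lam_big.
  by rewrite cT ltnW.
exists cs; split => //.
  rewrite ler_pdivlMr ?ltr0n ?addn1 // -natrM ler_nat.
  by rewrite -cT.
have y_ge1 : 1 <= log2 (log2 (n%:R : R)).
  apply: le_trans (_ : log2 ((2 ^ 1)%N%:R : R) <= _); first by rewrite log2_exp2.
  apply: le_log2; first by rewrite ltr0n.
  by apply: le_trans log_ge; rewrite ler_nat; apply: leq_trans t_ge.
have y_le : log2 (log2 (n%:R : R)) <= t.+1%:R.
  rewrite -(log2_exp2 R t.+1); apply: le_log2.
    by apply: lt_le_trans log_ge; rewrite ltr0n; apply: leq_trans t_ge.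
  by apply: le_trans log_le _; rewrite ler_nat ltnW // ltn_expl.
set y := log2 (log2 _) in y_ge1 y_le *.
have pow_le : y `^ (1 / 30%:R) <= t.+1%:R.
  apply: le_trans y_le; rewrite -[leRHS]powRr1; last lra.
  by apply: ler_powR => //; rewrite ler_pdivrMr ?mul1r ?ler1n ?ltr0n.
have pow_gt0 : 0 < y `^ (1 / 30%:R) by apply: powR_gt0; lra.
rewrite mulrA ler_pdivlMr //.
apply: le_trans (_ : #|uncovered cs|%:R * t.+1%:R <= _).
  by apply: ler_wpM2l.
by rewrite -natrM -[21]/(21%:R) -natrM ler_nat mulnC -cT.
Qed.
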